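(* Let $(Q,v)$ be a signed valued quiver of mutation Dynkin type with vertex set $\{1,\dots,n\}$, let $k\in\{1,\dots,n\}$ and let $(Q',v')=\mu_k(Q,v)$. Let $C=C(Q,v)=(c_{ij})$, let $h_i,e_{\varepsilon i}$ be the generators of $\mathfrak g(Q,v)$ and $h'_i,e'_{\varepsilon i}$ the generators of $\mathfrak g(Q',v')$ ($\varepsilon\in\{\pm1\}$, $1\le i\le n$). Then there is an isomorphism of Lie algebras $\varphi_k:\mathfrak g(Q',v')\to\mathfrak g(Q,v)$ given by $$e'_{\varepsilon i}\mapsto\begin{cases}\dfrac{(-\varepsilon)^{c_{ki}}}{|c_{ki}|!}\,(\operatorname{ad} e_{-\delta\varepsilon k})^{|c_{ki}|}(e_{\varepsilon i}) & \text{if there is an arrow } i\to k \text{ of sign }\delta\text{ in }Q,\\ e_{\varepsilon i}&\text{otherwise,}\end{cases}\qquad h'_i\mapsto\begin{cases}h_i-c_{ik}h_k&\text{if } i\to k\text{ in }Q,\\ h_i&\text{otherwise.}\end{cases}$$ Its inverse $\psi_k:\mathfrak g(Q,v)\to\mathfrak g(Q',v')$ is given by $$e_{\varepsilon i}\mapsto\begin{cases}\dfrac{(-\varepsilon)^{c_{ki}}}{|c_{ki}|!}\,(\operatorname{ad} e'_{\delta\varepsilon k})^{|c_{ki}|}(e'_{\varepsilon i}) & \text{if there is an arrow } i\to k \text{ of sign }\delta\text{ in }Q,\\ e'_{\varepsilon i}&\text{otherwise,}\end{cases}\qquad h_i\mapsto\begin{cases}h'_i+c_{ik}h'_k&\text{if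 } i\to k\text{ in }Q,\\ h'_i&\text{otherwise.}\end{cases}$$
   Context: **Gss matrices and mutation.** All matrices are $n\times n$. A generalized skew-symmetrizable (gss) matrix is $B=(b_{ij})$ with entries in $\mathbb Z[t]/(t^2-1)$ such that there are positive integers $d_1,\dots,d_n$ with $d_ib_{ij}=-d_jb_{ji}$ for all $i,j$. For a real number $a\neq0$, $\operatorname{sgn}(a)=a/|a|$, $\operatorname{sgn}(0)=0$; and $\operatorname{sgn}(a+bt)=\operatorname{sgn}(a+b)$. The signed mutation $\mu_k(B)=(b'_{ij})$ is: $b'_{ij}=-b_{ij}$ if ($i=k$ and $\operatorname{sgn}(b_{ij})=1$) or ($j=k$ and $\operatorname{sgn}(b_{ij})=-1$); $b'_{ij}=-tb_{ij}$ if ($i=k$ and $\operatorname{sgn}(b_{ij})=-1$) or ($j=k$ and $\operatorname{sgn}(b_{ij})=1$); $b'_{ij}=t(b_{ij}+\operatorname{sgn}(b_{ik})b_{ik}b_{kj})$ if $\operatorname{sgn}(b_{ik}b_{kj})=1$; $b'_{ij}=b_{ij}$ otherwise. Two gss matrices are mutation equivalent if one is obtained from the other by a finite sequence of mutations. $B$ is pure if every entry lies in $\mathbb Z\cup t\mathbb Z$. **Signed valued quivers.** A signed valued quiver $(Q,v)$ is a simple quiver $Q$ (no loops, at most one arrow between any two vertices) on $\{1,\dots,n\}$ with a function $v=(v_1,v_2)$ from arrows to $\mathbb Z\times\mathbb Z$ such that $\operatorname{sgn}(v_1(\alpha))=\operatorname{sgn}(v_2(\alpha))\ne0$ (this is the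 sign of $\alpha$) and there are positive integers $d_i$ with $d_iv_1(\alpha)=d_jv_2(\alpha)$ for every arrow $\alpha:i\to j$. Signed valued quivers correspond bijectively to pure gss matrices: $B(Q,v)=(b_{ij})$ has, for each arrow $\alpha:i\to j$, $b_{ij}=v_1(\alpha)$, $b_{ji}=-v_2(\alpha)$ if $\alpha$ is positive, and $b_{ij}=-tv_1(\alpha)$, $b_{ji}=tv_2(\alpha)$ if $\alpha$ is negative; other entries are $0$. Thus $i\to j$ in $Q$ iff $\operatorname{sgn}(b_{ij})=1$. **Mutation Dynkin.** The unsigned diagram of $(Q,v)$ has $v_1(\alpha)v_2(\alpha)$ edges between $i$ and $j$ for each arrow $\alpha:i\to j$, with ordering $i>j$ iff $|v_1(\alpha)|>|v_2(\alpha)|$ and $i<j$ iff $|v_1(\alpha)|<|v_2(\alpha)|$ (drawn as a multiple edge pointing from the larger to the smaller vertex). A gss matrix is Dynkin if it is pure and the unsigned diagram of its signed valued quiver is a Dynkin diagram ($A_n,B_n,C_n,D_n,E_n,F_4,G_2$); it is mutation Dynkin if it is mutation equivalent to a Dynkin one; $(Q,v)$ is mutation Dynkin if $B(Q,v)$ is. All mutation Dynkin gss matrices are pure, and for $(Q,v)$ mutation Dynkin, $\mu_k(Q,v)$ is the signed valued quiver associated with $\mu_k(B(Q,v))$. **Cartan counterpart.** $C(Q,v)=(c_{ij})$ has $c_{ii}=2$, $c_{ij}=v_1(\alpha)$ and $c_{ji}=v_2(\alpha)$ for each arrow $\alpha:i\to j$, and other entries $0$. **Lie algebras** (over $\mathbb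 C$). Write $[x_1,\dots,x_m]=[x_1,[x_2,[\dots,x_m]]]$. For $C=C(Q,v)$, $\mathfrak g(Q,v)$ is the Lie algebra with generators $h_i,e_{\varepsilon i}$ ($\varepsilon\in\{\pm1\}$, $1\le i\le n$; $e_{-i}=e_{-1\cdot i}$) and relations, for $\varepsilon,\delta\in\{\pm1\}$: (R1) $[h_i,h_j]=0$; (R2) $[e_i,e_{-i}]=h_i$; (R3) $[h_i,e_{\varepsilon j}]=\varepsilon c_{ij}e_{\varepsilon j}$; (R4) $(\operatorname{ad}e_{\varepsilon i})^{-M+1}(e_{\delta j})=0$ with $M=\min\{0,\varepsilon\delta c_{ij}\}$; (R5) for every chordless cycle of $C$ (distinct indices $i_1,\dots,i_p$, $p\ge3$, with $c_{i_ai_b}\ne0$ for $a\neq b$ exactly when $a,b$ are cyclically adjacent), written from any starting point and in either direction, and every $\varepsilon_1\in\{\pm1\}$: $[e_{\varepsilon_1i_1},e_{\varepsilon_2i_2},\dots,e_{\varepsilon_pi_p}]=0$ where $\varepsilon_{q+1}=-\operatorname{sgn}(c_{i_q,i_{q+1}})\varepsilon_q$; except that if some edge of the cycle has weight $c_{ij}c_{ji}>1$, the relation is imposed only when $i_1$ and $i_p$ are not both long, where a vertex $i$ of the cycle is called long if $|c_{ij}|>|c_{ji}|$ for some vertex $j$ of the cycle. *)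

(* Defs.v *)
From HB Require Import structures.
From mathcomp Require Import all_boot all_order all_algebra all_fingroup.
From mathcomp Require Import qpoly generic_quotient boolp.

Set Implicit Arguments.
Unset Strict Implicit.
Unset Printing Implicit Defensive.

Import Order.TTheory GRing.Theory Num.Theory.
Local Open Scope quotient_scope.
Local Open Scope ring_scope.

Definition Zt := {poly %/ ('X^2 - 1 : {poly int})}.

Definition t : Zt := 'qX.

(* ['X^2 - 1] is monic of size 3, so [{poly %/ _}] really divides by it. *)
Lemma mk_monic_X2sub1 : mk_monic ('X^2 - 1 : {poly int}) = 'X^2 - 1.
Proof. by rewrite /mk_monic size_XnsubC // monicXnsubC. Qed.

Lemma t_square : t * t = 1.
Proof.
have hM : ('X^2 - 1 : {poly int}) \is monic by apply: monicXnsubC.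
have tX : t = 'X :> {poly int} by rewrite qpolyXE ?size_XnsubC.
apply: val_inj; change (Pdiv.CommonRing.rmodp
  ((t : {poly int}) * t) (mk_monic ('X^2 - 1)) = 1%:P).
rewrite tX mk_monic_X2sub1 -expr2.
rewrite -[X in Pdiv.CommonRing.rmodp X _](subrK 1) -[X in X + 1]mul1r.
by rewrite Pdiv.RingMonic.rmodp_addl_mul_small ?size_XnsubC ?size_poly1.
Qed.

(* Elements of [Zt] are polynomials [a + b t] of degree at most 1. *)
Definition sgt (x : Zt) : int := Num.sg (x`_0 + x`_1).

Section GssMatrices.
Variable n : nat.
Implicit Types B : 'M[Zt]_n.

Definition is_gss B : Prop :=
  exists d : 'I_n -> nat, (forall i, (0 < d i)%N) /\
    forall i j, (d i)%:R * B i j = - ((d j)%:R * B j i).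

Definition mutation (k : 'I_n) B : 'M[Zt]_n := \matrix_(i, j)
  if (i == k) && (sgt (B i j) == 1) || (j == k) && (sgt (B i j) == -1)
    then - B i j
  else if (i == k) && (sgt (B i j) == -1) || (j == k) && (sgt (B i j) == 1)
    then - (t * B i j)
  else if sgt (B i k * B k j) == 1
    then t * (B i j + (sgt (B i k))%:~R * B i k * B k j)
  else B i j.

Definition mutations (ks : seq 'I_n) B : 'M[Zt]_n :=
  foldl (fun B' k => mutation k B') B ks.

Definition mutation_equivalent B1 B2 : Prop :=
  exists ks, B2 = mutations ks B1 \/ B1 = mutations ks B2.

Definition is_pure B : Prop :=
  forall i j, exists m : int, B i j = m%:~R \/ B i j = t * m%:~R.

End GssMatrices.

(* A valuation is given by functions on all pairs of vertices; only their
   values on the arrows of the quiver are ever used. *)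
Record svquiver (n : nat) := SVQuiver {
  arr : rel 'I_n;
  v1 : 'I_n -> 'I_n -> int;
  v2 : 'I_n -> 'I_n -> int;
  arr_irr : irreflexive arr;
  arr_asym : forall i j, arr i j -> ~~ arr j i;
  val_sign : forall i j, arr i j ->
    Num.sg (v1 i j) = Num.sg (v2 i j) /\ Num.sg (v1 i j) != 0;
  val_symm : exists d : 'I_n -> nat, (forall i, (0 < d i)%N) /\
    forall i j, arr i j -> (d i)%:R * v1 i j = (d j)%:R * v2 i j
}.

(** Signs are encoded as booleans: [b] stands for [(-1) ^+ b], so that [true]
    is the sign -1, [(+)] is multiplication of signs and [~~] is negation. *)
Definition sign_of (x : int) : bool := x < 0.

Section SignedValuedQuivers.
Variable n : nat.
Implicit Types S : svquiver n.

Definition arr_sign S i j : bool := sign_of (v1 S i j).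

Definition gss_of S : 'M[Zt]_n := \matrix_(i, j)
  if arr S i j then
    if arr_sign S i j then - (t * (v1 S i j)%:~R) else (v1 S i j)%:~R
  else if arr S j i then
    if arr_sign S j i then t * (v2 S j i)%:~R else - (v2 S j i)%:~R
  else 0.

(* [gss_of] is injective up to the values of [v1] and [v2] off the arrows, so
   this says that [S'] is the signed valued quiver of [mutation k (gss_of S)]. *)
Definition svq_mutation (k : 'I_n) S S' : Prop :=
  gss_of S' = mutation k (gss_of S).

Definition cartan S : 'M[int]_n := \matrix_(i, j)
  if i == j then 2
  else if arr S i j then v1 S i j
  else if arr S j i then v2 S j i
  else 0.

End SignedValuedQuivers.

(* [larger i j] means that the multiple edge between [i] and [j] points from
   [i] to [j]. *)
Record diagram (n : nat) := Diagram {
  edges : 'I_n -> 'I_n -> nat;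
  larger : rel 'I_n
}.

Definition diagram_iso n (D D' : diagram n) : Prop :=
  exists s : {perm 'I_n}, forall i j,
    edges D i j = edges D' (s i) (s j) /\ larger D i j = larger D' (s i) (s j).

Definition unsigned_diagram n (S : svquiver n) : diagram n := {|
  edges := fun i j =>
    if arr S i j then absz (v1 S i j * v2 S i j)
    else if arr S j i then absz (v1 S j i * v2 S j i)
    else 0%N;
  larger := fun i j =>
    if arr S i j then `|v1 S i j| > `|v2 S i j|
    else if arr S j i then `|v1 S j i| < `|v2 S j i|
    else false
|}.

Section DynkinDiagrams.
Variable n : nat.

Definition on_edge (a b : nat) : rel 'I_n := fun i j =>
  (i == a :> nat) && (j == b :> nat) || (i == b :> nat) && (j == a :> nat).

Definition on_chain : rel 'I_n := fun i j =>
  (j == i.+1 :> nat) || (i == j.+1 :> nat).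

(* The path 0 - 1 - ... - (n-1), with [m] edges between [a] and [b], oriented
   from [a] to [b]. *)
Definition chain_diagram (m a b : nat) : diagram n := {|
  edges := fun i j => if on_edge a b i j then m else on_chain i j : nat;
  larger := fun i j => (i == a :> nat) && (j == b :> nat)
|}.

(* The path 0 - 1 - ... - (n-2), with the vertex n-1 attached to [a]. *)
Definition branch_diagram (a : nat) : diagram n := {|
  edges := fun i j =>
    [&& (i < n.-1)%N, (j < n.-1)%N & on_chain i j] || on_edge a n.-1 i j;
  larger := fun _ _ => false
|}.

Definition diagram_A : diagram n :=
  {| edges := fun i j => on_chain i j; larger := fun _ _ => false |}.
Definition diagram_B : diagram n := chain_diagram 2 (n - 2) (n - 1).
Definition diagram_C : diagram n := chain_diagram 2 (n - 1) (n - 2).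
Definition diagram_D : diagram n := branch_diagram (n - 3).
Definition diagram_E : diagram n := branch_diagram 2.
Definition diagram_F : diagram n := chain_diagram 2 1 2.
Definition diagram_G : diagram n := chain_diagram 3 0 1.

(* Types B and C are exchanged by reversing all orientations, and F_4 and G_2
   are isomorphic to their reversals. *)
Inductive is_dynkin_diagram (D : diagram n) : Prop :=
| DynkinA of (1 <= n)%N & diagram_iso D diagram_A
| DynkinB of (2 <= n)%N & diagram_iso D diagram_B
| DynkinC of (2 <= n)%N & diagram_iso D diagram_C
| DynkinD of (4 <= n)%N & diagram_iso D diagram_D
| DynkinE of (6 <= n <= 8)%N & diagram_iso D diagram_E
| DynkinF of n = 4%N & diagram_iso D diagram_F
| DynkinG of n = 2%N & diagram_iso D diagram_G.

Definition is_dynkin (B : 'M[Zt]_n) : Prop :=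
  [/\ is_gss B, is_pure B &
      exists S : svquiver n,
        gss_of S = B /\ is_dynkin_diagram (unsigned_diagram S)].

Definition mutation_dynkin (B : 'M[Zt]_n) : Prop :=
  is_gss B /\ exists B0, is_dynkin B0 /\ mutation_equivalent B B0.

End DynkinDiagrams.

HB.mixin Record Lmodule_isLie (K : fieldType) L of GRing.Lmodule K L := {
  lbr : L -> L -> L;
  lbrDl : forall x y z, lbr (x + y) z = lbr x z + lbr y z;
  lbrDr : forall x y z, lbr x (y + z) = lbr x y + lbr x z;
  lbrZl : forall (a : K) x y, lbr (a *: x) y = a *: lbr x y;
  lbrZr : forall (a : K) x y, lbr x (a *: y) = a *: lbr x y;
  lbrxx : forall x, lbr x x = 0;
  lbr_jacobi : forall x y z,
    lbr x (lbr y z) + lbr y (lbr z x) + lbr z (lbr x y) = 0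
}.

#[short(type="lieType")]
HB.structure Definition LieAlgebra (K : fieldType) :=
  { L of GRing.Lmodule K L & Lmodule_isLie K L }.

Definition lie_hom (K : fieldType) (L M : lieType K) (f : L -> M) : Prop :=
  [/\ {morph f : x y / x + y},
      forall (a : K) x, f (a *: x) = a *: f x &
      {morph f : x y / lbr x y}].

Section Presentation.
Variables (K : fieldType) (X : Type).

Inductive lterm :=
| LVar of X
| LZero
| LAdd of lterm & lterm
| LOpp of lterm
| LScale of K & lterm
| LBr of lterm & lterm.

HB.instance Definition _ := gen_eqMixin lterm.
HB.instance Definition _ := gen_choiceMixin lterm.

(* The defining relations: [R u v] imposes [u = v]. *)
Variable R : lterm -> lterm -> Prop.

(* The least congruence containing [R] and the laws of a Lie algebra. *)
Inductive lcong : lterm -> lterm -> Prop :=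
| lc_rel u v of R u v : lcong u v
| lc_refl u : lcong u u
| lc_sym u v of lcong u v : lcong v u
| lc_trans v u w of lcong u v & lcong v w : lcong u w
| lc_add u u' v v' of lcong u u' & lcong v v' : lcong (LAdd u v) (LAdd u' v')
| lc_opp u u' of lcong u u' : lcong (LOpp u) (LOpp u')
| lc_scale a u u' of lcong u u' : lcong (LScale a u) (LScale a u')
| lc_br u u' v v' of lcong u u' & lcong v v' : lcong (LBr u v) (LBr u' v')
| lc_addA u v w : lcong (LAdd u (LAdd v w)) (LAdd (LAdd u v) w)
| lc_addC u v : lcong (LAdd u v) (LAdd v u)
| lc_add0 u : lcong (LAdd LZero u) u
| lc_addN u : lcong (LAdd (LOpp u) u) LZero
| lc_scaleA a b u : lcong (LScale a (LScale b u)) (LScale (a * b) u)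
| lc_scale1 u : lcong (LScale 1 u) u
| lc_scaleDr a u v :
    lcong (LScale a (LAdd u v)) (LAdd (LScale a u) (LScale a v))
| lc_scaleDl u a b :
    lcong (LScale (a + b) u) (LAdd (LScale a u) (LScale b u))
| lc_brDl u v w : lcong (LBr (LAdd u v) w) (LAdd (LBr u w) (LBr v w))
| lc_brDr u v w : lcong (LBr u (LAdd v w)) (LAdd (LBr u v) (LBr u w))
| lc_brZl a u v : lcong (LBr (LScale a u) v) (LScale a (LBr u v))
| lc_brZr a u v : lcong (LBr u (LScale a v)) (LScale a (LBr u v))
| lc_brxx u : lcong (LBr u u) LZero
| lc_jacobi u v w :
    lcong (LAdd (LAdd (LBr u (LBr v w)) (LBr v (LBr w u))) (LBr w (LBr u v)))
          LZero.

Definition lcongb (u v : lterm) : bool := `[< lcong u v >].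

Lemma lcongb_equiv : equiv_class_of lcongb.
Proof.
split=> [u|u v|v u w]; first exact/asboolP/lc_refl.
- by apply/asboolP/asboolP; apply: lc_sym.
- by move=> /asboolP uv /asboolP vw; apply/asboolP; apply: lc_trans vw.
Qed.

Canonical lcong_equiv := EquivRelPack lcongb_equiv.

Definition pres_lie := {eq_quot lcong_equiv}.
HB.instance Definition _ := Choice.on pres_lie.
HB.instance Definition _ := Quotient.on pres_lie.

Local Notation proj := (\pi_pres_lie : lterm -> pres_lie).

Lemma proj_eq u v : proj u = proj v <-> lcong u v.
Proof.
by split=> [/eqmodP/asboolP|uv] //; apply/eqmodP/asboolP.
Qed.

Lemma lcong_repr u : lcong (repr (proj u)) u.
Proof. by apply/proj_eq; rewrite reprK. Qed.

Definition pres_add (x y : pres_lie) := proj (LAdd (repr x) (repr y)).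
Definition pres_opp (x : pres_lie) := proj (LOpp (repr x)).
Definition pres_scale (a : K) (x : pres_lie) := proj (LScale a (repr x)).
Definition pres_br (x y : pres_lie) := proj (LBr (repr x) (repr y)).

Lemma proj_add u v : pres_add (proj u) (proj v) = proj (LAdd u v).
Proof. by apply/proj_eq/lc_add; apply: lcong_repr. Qed.
Lemma proj_opp u : pres_opp (proj u) = proj (LOpp u).
Proof. by apply/proj_eq/lc_opp/lcong_repr. Qed.
Lemma proj_scale a u : pres_scale a (proj u) = proj (LScale a u).
Proof. by apply/proj_eq/lc_scale/lcong_repr. Qed.
Lemma proj_br u v : pres_br (proj u) (proj v) = proj (LBr u v).
Proof. by apply/proj_eq/lc_br; apply: lcong_repr. Qed.

Fact pres_addA : associative pres_add.
Proof.
elim/quotW=> u; elim/quotW=> v; elim/quotW=> w.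
by rewrite (proj_add v w) (proj_add u v) !proj_add; apply/proj_eq/lc_addA.
Qed.
Fact pres_addC : commutative pres_add.
Proof.
elim/quotW=> u; elim/quotW=> v.
by rewrite (proj_add u v) (proj_add v u); apply/proj_eq/lc_addC.
Qed.
Fact pres_add0 : left_id (proj LZero) pres_add.
Proof. by elim/quotW=> u; rewrite proj_add; apply/proj_eq/lc_add0. Qed.
Fact pres_addN : left_inverse (proj LZero) pres_opp pres_add.
Proof.
elim/quotW=> u.
by rewrite (proj_opp u) proj_add; apply/proj_eq/lc_addN.
Qed.

HB.instance Definition _ :=
  GRing.isZmodule.Build pres_lie pres_addA pres_addC pres_add0 pres_addN.

Fact pres_scaleA a b x :
  pres_scale a (pres_scale b x) = pres_scale (a * b) x.
Proof.
elim/quotW: x => u.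
by rewrite (proj_scale b u) !proj_scale; apply/proj_eq/lc_scaleA.
Qed.
Fact pres_scale1 : left_id 1 pres_scale.
Proof. by elim/quotW=> u; rewrite proj_scale; apply/proj_eq/lc_scale1. Qed.
Fact pres_scaleDr : right_distributive pres_scale pres_add.
Proof.
move=> a; elim/quotW=> u; elim/quotW=> v.
rewrite (proj_add u v) (proj_scale a u) (proj_scale a v) proj_scale proj_add.
exact/proj_eq/lc_scaleDr.
Qed.
Fact pres_scaleDl x a b :
  pres_scale (a + b) x = pres_add (pres_scale a x) (pres_scale b x).
Proof.
elim/quotW: x => u.
rewrite (proj_scale a u) (proj_scale b u) proj_scale proj_add.
exact/proj_eq/lc_scaleDl.
Qed.

HB.instance Definition _ := GRing.Zmodule_isLmodule.Build K pres_lie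
  pres_scaleA pres_scale1 pres_scaleDr pres_scaleDl.

Fact pres_brDl x y z :
  pres_br (pres_add x y) z = pres_add (pres_br x z) (pres_br y z).
Proof.
elim/quotW: x => u; elim/quotW: y => v; elim/quotW: z => w.
rewrite (proj_add u v) (proj_br u w) (proj_br v w) proj_br proj_add.
exact/proj_eq/lc_brDl.
Qed.
Fact pres_brDr x y z :
  pres_br x (pres_add y z) = pres_add (pres_br x y) (pres_br x z).
Proof.
elim/quotW: x => u; elim/quotW: y => v; elim/quotW: z => w.
rewrite (proj_add v w) (proj_br u v) (proj_br u w) proj_br proj_add.
exact/proj_eq/lc_brDr.
Qed.
Fact pres_brZl a x y : pres_br (pres_scale a x) y = pres_scale a (pres_br x y).
Proof.
elim/quotW: x => u; elim/quotW: y => v.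
rewrite (proj_scale a u) (proj_br u v) proj_br proj_scale.
exact/proj_eq/lc_brZl.
Qed.
Fact pres_brZr a x y : pres_br x (pres_scale a y) = pres_scale a (pres_br x y).
Proof.
elim/quotW: x => u; elim/quotW: y => v.
rewrite (proj_scale a v) (proj_br u v) proj_br proj_scale.
exact/proj_eq/lc_brZr.
Qed.
Fact pres_brxx x : pres_br x x = proj LZero.
Proof. by elim/quotW: x => u; rewrite proj_br; apply/proj_eq/lc_brxx. Qed.
Fact pres_jacobi x y z :
  pres_add (pres_add (pres_br x (pres_br y z)) (pres_br y (pres_br z x)))
           (pres_br z (pres_br x y)) = proj LZero.
Proof.
elim/quotW: x => u; elim/quotW: y => v; elim/quotW: z => w.
rewrite (proj_br v w) (proj_br w u) (proj_br u v).
rewrite (proj_br u _) (proj_br v _) (proj_br w _).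
rewrite (proj_add (LBr u _) _) proj_add.
exact/proj_eq/lc_jacobi.
Qed.

HB.instance Definition _ := Lmodule_isLie.Build K pres_lie
  pres_brDl pres_brDr pres_brZl pres_brZr pres_brxx pres_jacobi.

Definition pres_gen (x : X) : pres_lie := proj (LVar x).

End Presentation.

Arguments LVar {K X}.
Arguments LZero {K X}.
Arguments pres_gen {K X R} x.

Fixpoint leval (K : fieldType) (X : Type) (L : lieType K) (f : X -> L)
    (u : lterm K X) : L :=
  match u with
  | LVar x => f x
  | LZero => 0
  | LAdd v w => leval f v + leval f w
  | LOpp v => - leval f v
  | LScale a v => a *: leval f v
  | LBr v w => lbr (leval f v) (leval f w)
  end.

Theorem pres_lie_rel (K : fieldType) (X : Type)
    (R : lterm K X -> lterm K X -> Prop) (u v : lterm K X) :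
  R u v -> leval (pres_gen : X -> pres_lie R) u = leval pres_gen v.
Proof.
have evalE w : leval (pres_gen : X -> pres_lie R) w = \pi_(pres_lie R) w.
  elim: w => //= [u' -> v' ->|u' ->|a u' ->|u' -> v' ->].
  - exact: proj_add.
  - exact: proj_opp.
  - exact: proj_scale.
  - exact: proj_br.
by move=> Ruv; rewrite !evalE; apply/proj_eq/lc_rel.
Qed.

(* The universal property of [pres_lie R]. *)
Theorem pres_lie_univ (K : fieldType) (X : Type)
    (R : lterm K X -> lterm K X -> Prop) (L : lieType K) (f : X -> L) :
  (forall u v, R u v -> leval f u = leval f v) ->
  exists phi : pres_lie R -> L,
    [/\ lie_hom phi, forall x, phi (pres_gen x) = f x &
        forall phi', lie_hom phi' -> (forall x, phi' (pres_gen x) = f x) ->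
          phi' =1 phi].
Proof.
move=> fR.
have f_cong u v : lcong R u v -> leval f u = leval f v.
  elim=> //= {u v}.
  - by move=> u v w _ -> _ ->.
  - by move=> u u' v v' _ -> _ ->.
  - by move=> u u' _ ->.
  - by move=> a u u' _ ->.
  - by move=> u u' v v' _ -> _ ->.
  - by move=> *; rewrite addrA.
  - by move=> *; rewrite addrC.
  - by move=> *; rewrite add0r.
  - by move=> *; rewrite addNr.
  - by move=> *; rewrite scalerA.
  - by move=> *; rewrite scale1r.
  - by move=> *; rewrite scalerDr.
  - by move=> *; rewrite scalerDl.
  - by move=> *; rewrite lbrDl.
  - by move=> *; rewrite lbrDr.
  - by move=> *; rewrite lbrZl.
  - by move=> *; rewrite lbrZr.
  - by move=> *; rewrite lbrxx.
  - by move=> *; rewrite lbr_jacobi.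
pose phi (x : pres_lie R) := leval f (repr x).
have phiE u : phi (\pi u) = leval f u by apply/f_cong/lcong_repr.
exists phi; split; last first.
- move=> phi' [phiD phiZ phiB] phiX; elim/quotW=> u; rewrite phiE.
  have phiN x : phi' (- x) = - phi' x by rewrite -scaleN1r phiZ scaleN1r.
  have phi0 : phi' (\pi LZero) = 0.
    by have := phiZ 0 (\pi LZero); rewrite !scale0r.
  elim: u => //= [u <- v <-|u <-|a u <-|u <- v <-].
  + by rewrite -phiD; congr (phi' _); exact/esym/proj_add.
  + by rewrite -phiN; congr (phi' _); exact/esym/proj_opp.
  + by rewrite -phiZ; congr (phi' _); exact/esym/proj_scale.
  + by rewrite -phiB; congr (phi' _); exact/esym/proj_br.
- by move=> x; rewrite phiE.
split.
- by elim/quotW=> u; elim/quotW=> v; rewrite [X in phi X]proj_add !phiE.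
- by move=> a; elim/quotW=> u; rewrite [X in phi X]proj_scale !phiE.
- by elim/quotW=> u; elim/quotW=> v; rewrite [X in phi X]proj_br !phiE.
Qed.

Section QuiverLieAlgebra.
Variables (K : fieldType) (n : nat) (C : 'M[int]_n).

Inductive lie_gen := GenH of 'I_n | GenE of bool & 'I_n.

Local Notation h i := (LVar (GenH i) : lterm K lie_gen).
Local Notation e eps i := (LVar (GenE eps i) : lterm K lie_gen).

(* The right-normed bracket [x_1, [x_2, [..., x_m]]]. *)
Fixpoint lbr_seq (s : seq (lterm K lie_gen)) : lterm K lie_gen :=
  match s with
  | [::] => LZero
  | [:: x] => x
  | x :: s' => LBr x (lbr_seq s')
  end.

Definition chordless_cycle (s : seq 'I_n) : Prop :=
  [/\ uniq s, (3 <= size s)%N &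
      {in s &, forall i j, i != j ->
        (C i j != 0) = (j == next s i) || (i == next s j)}].

Definition cycle_has_multiple_edge (s : seq 'I_n) : bool :=
  has (fun i => has (fun j => (i != j) && (C i j * C j i > 1)) s) s.

Definition long_in_cycle (s : seq 'I_n) (i : 'I_n) : bool :=
  has (fun j => `|C i j| > `|C j i|) s.

(* The elements e_{eps_1 i_1}, ..., e_{eps_p i_p} attached to i_1 :: [i_2, ...],
   with eps_{q+1} = - sgn(c_{i_q, i_{q+1}}) eps_q. *)
Fixpoint signed_walk (eps : bool) (i : 'I_n) (s : seq 'I_n) :
    seq (lterm K lie_gen) :=
  e eps i ::
  if s is j :: s' then signed_walk (~~ (sign_of (C i j) (+) eps)) j s'
  else [::].

Inductive quiver_rel : lterm K lie_gen -> lterm K lie_gen -> Prop :=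
| rel_hh i j : quiver_rel (LBr (h i) (h j)) LZero
| rel_ee i : quiver_rel (LBr (e false i) (e true i)) (h i)
| rel_he i (eps : bool) j :
    quiver_rel (LBr (h i) (e eps j))
               (LScale ((-1) ^+ eps * (C i j)%:~R) (e eps j))
| rel_serre (eps : bool) i (delta : bool) j :
    quiver_rel
      (iter (absz (Num.min 0 ((-1) ^+ eps * (-1) ^+ delta * C i j))).+1
            (LBr (e eps i)) (e delta j))
      LZero
| rel_cycle eps i s of
    chordless_cycle (i :: s) &
    (cycle_has_multiple_edge (i :: s) ->
      ~~ (long_in_cycle (i :: s) i && long_in_cycle (i :: s) (last i s))) :
    quiver_rel (lbr_seq (signed_walk eps i s)) LZero.

End QuiverLieAlgebra.

Definition quiver_lie (K : fieldType) n (S : svquiver n) : lieType K :=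
  pres_lie (@quiver_rel K n (cartan S)).

Definition gh (K : fieldType) n (S : svquiver n) (i : 'I_n) : quiver_lie K S :=
  pres_gen (GenH i).

Definition ge (K : fieldType) n (S : svquiver n) (eps : bool) (i : 'I_n) :
    quiver_lie K S :=
  pres_gen (GenE eps i).

(* Main.v *)
Require Import Defs.
From HB Require Import structures.
From mathcomp Require Import all_boot all_order all_algebra.
From mathcomp Require Import perm qpoly generic_quotient boolp reals.
From mathcomp.real_closed Require Import complex.
From mathcomp Require Import zify ring lra.

Set Implicit Arguments.
Unset Strict Implicit.
Unset Printing Implicit Defensive.

Import Order.TTheory GRing.Theory Num.Theory.
Local Open Scope ring_scope.

(** Let s = exp(ad e) exp(-ad f) exp(ad e) be the automorphism of g(Q,v) lifting the simple
    reflection at k. Up to scalars, the proposed image of e'_i is s(e_i) when i -> k and e_i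
    otherwise: the new simple roots are the old ones, with those of the in-neighbours of k
    reflected. The point is that these elements satisfy the defining relations of g(Q',v'). The
    homomorphism then comes from the universal property, its inverse from the same construction
    applied to Q' with all arrows reversed, and the compositions are computed from f^m e^m v =
    (m!)^2 v for a lowest weight vector v ([mutation_cancel]).

    The combinatorial input is [good_orientation]: C is symmetrizable and positive definite, and
    every chordless cycle of Q is cyclically oriented. Dynkin quivers have no chordless cycles and a
    positive form ([tame_good], [dynkin_tame]). Mutation preserves the property ([good_mutation]):
    on Cartan counterparts it is a change of basis, so positivity survives. Cycles are controlled by
    a parity argument: a chordless cycle carries an odd number of positive entries, since otherwise
    a vector of signs would make the form nonpositive ([chordless_cycle_parity]). By
    [mutation_gss_mx] the signed mutation of matrices is this operation on pairs (orientation,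
    Cartan counterpart). Signed mutations are invertible by mutations, as the fourth power of each
    is the identity, and so [mutation_dynkin_good] reaches the whole mutation class.

    On the algebraic side the Serre relations are traded for local nilpotency ([chevalley_system]),
    which implies them by sl2-theory and is carried along by s. Relations between two reflected
    generators, or between two unreflected ones, are inherited. The mixed ones, for i -> k -> j,
    rest on the cycle relation of the triangle i, k, j ([in_out_killed]).

    For the cycle relations, sl2-theory moves a relation from one admissible starting point to any
    other ([cycle_rel_transfer]), so one starting point per cycle is enough. [mutated_cycle_rel]
    then distinguishes how k meets the cycle: all neighbours on one side (the relation is unchanged
    or its image under s); k outside the cycle, next to an edge created by the mutation
    ([mutated_cycle_ends]); or k on the cycle between an in- and an out-neighbour
    ([mutated_triangle], [mutated_long_cycle]). *)

Local Notation "{[ x , y ]}" := (lbr x y) (at level 0, x, y at level 99).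


(** * Identities in a Lie algebra *)

Section LieBasics.
Variables (K : fieldType) (L : lieType K).
Implicit Types x y z : L.

Fact lbr_linear_subproof x : linear (lbr x).
Proof. by move=> a y z; rewrite lbrDr lbrZr. Qed.

HB.instance Definition _ x :=
  GRing.isLinear.Build K L L _ (lbr x) (lbr_linear_subproof x).

Lemma lbr0r x : {[x, 0]} = 0. Proof. exact: raddf0. Qed.
Lemma lbrNr x y : {[x, - y]} = - {[x, y]}. Proof. exact: raddfN. Qed.

Lemma lbrC x y : {[x, y]} = - {[y, x]}.
Proof.
apply/eqP; rewrite -addr_eq0; apply/eqP.
by have := lbrxx (x + y); rewrite lbrDl !lbrDr !lbrxx addr0 add0r.
Qed.

Lemma lbr0l x : {[0, x]} = 0. Proof. by rewrite lbrC lbr0r oppr0. Qed.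
Lemma lbrNl x y : {[- x, y]} = - {[x, y]}.
Proof. by rewrite lbrC lbrNr -lbrC. Qed.

Lemma lbrJ x y z : {[x, {[y, z]}]} = {[{[x, y]}, z]} + {[y, {[x, z]}]}.
Proof.
have /eqP := lbr_jacobi x y z.
by rewrite (lbrC z x) (lbrC z) lbrNr -addrA -opprD subr_eq0 addrC => /eqP.
Qed.

Lemma lbr_eq0C x y : {[x, y]} = 0 -> {[y, x]} = 0.
Proof. by move=> xy; rewrite lbrC xy oppr0. Qed.

Lemma lbr_comm x y z : {[x, y]} = 0 -> {[x, {[y, z]}]} = {[y, {[x, z]}]}.
Proof. by move=> xy; rewrite lbrJ xy lbr0l add0r. Qed.

Lemma lbr_comml x y z : {[x, z]} = 0 -> {[x, {[y, z]}]} = {[{[x, y]}, z]}.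
Proof. by move=> xz; rewrite lbrJ xz lbr0r addr0. Qed.

Lemma iter_lbr0 x m : iter m (lbr x) 0 = 0.
Proof. by elim: m => //= m ->; rewrite lbr0r. Qed.

Lemma iter_lbrZ x m a y : iter m (lbr x) (a *: y) = a *: iter m (lbr x) y.
Proof. by elim: m => //= m ->; rewrite lbrZr. Qed.

Lemma iter_lbrZl a x m y : iter m (lbr (a *: x)) y = a ^+ m *: iter m (lbr x) y.
Proof.
by elim: m => [|m IH]; rewrite ?expr0 ?scale1r //= IH lbrZl lbrZr scalerA exprS.
Qed.

Lemma iter_lbr_eq0 x m p y :
  (m <= p)%N -> iter m (lbr x) y = 0 -> iter p (lbr x) y = 0.
Proof. by move=> /subnK <- y0; rewrite iterD y0 iter_lbr0. Qed.

Lemma iter_lbr_comm x y m z :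
  {[x, y]} = 0 -> iter m (lbr x) {[y, z]} = {[y, iter m (lbr x) z]}.
Proof. by move=> xy; elim: m => //= m ->; rewrite lbr_comm. Qed.

Lemma iter_lbr_comml x y m z :
  {[x, z]} = 0 -> iter m (lbr x) {[y, z]} = {[iter m (lbr x) y, z]}.
Proof. by move=> xz; elim: m => //= m ->; rewrite lbr_comml. Qed.

(** Leibniz's formula for the derivation [lbr x], by Pascal's rule. *)
Lemma iter_lbrJ x m y z : iter m (lbr x) {[y, z]} =
  \sum_(a < m.+1) {[iter a (lbr x) y, iter (m - a) (lbr x) z]} *+ 'C(m, a).
Proof.
elim: m => [|m IH]; first by rewrite big_ord1 bin0.
rewrite iterS {}IH raddf_sum /=.
rewrite (eq_bigr (fun a : 'I_m.+1 =>
  {[iter a.+1 (lbr x) y, iter (m - a) (lbr x) z]} *+ 'C(m, a) +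
  {[iter a (lbr x) y, iter (m.+1 - a) (lbr x) z]} *+ 'C(m, a))); last first.
  by move=> a _; rewrite raddfMn /= lbrJ mulrnDl subSn // -ltnS.
rewrite big_split /= [RHS]big_ord_recl /= bin0.
rewrite [X in _ + X]big_ord_recl /= bin0 addrCA; congr (_ + _).
rewrite [in RHS](eq_bigr (fun a : 'I_m.+1 =>
  {[iter a.+1 (lbr x) y, iter (m - a) (lbr x) z]} *+ 'C(m, a.+1) +
  {[iter a.+1 (lbr x) y, iter (m - a) (lbr x) z]} *+ 'C(m, a))); last first.
  by move=> a _; rewrite /bump /= add1n subSS binS mulrnDr.
rewrite big_split /= addrC; congr (_ + _).
rewrite [RHS]big_ord_recr /= bin_small // mulr0n addr0.
by apply: eq_bigr => a _; rewrite /bump /= add1n subSS.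
Qed.

End LieBasics.

(** * Exponentials of locally nilpotent derivations *)

Definition locally_nilpotent (K : fieldType) (L : lieType K) (x : L) :=
  forall y, exists m, iter m (lbr x) y == 0.

Section LieExp.
Variables (K : numFieldType) (L : lieType K) (x : L).
Hypothesis x_nilp : locally_nilpotent x.

Definition lie_expn (N : nat) (y : L) : L :=
  \sum_(m < N) (m`!%:R)^-1 *: iter m (lbr x) y.

(** The cut-off depends on [y]; by [lie_expE] every exponent that kills [y] gives the same value. *)
Definition lie_exp (y : L) : L := lie_expn (ex_minn (x_nilp y)) y.

Lemma lie_expnE N M y : (N <= M)%N -> iter N (lbr x) y = 0 ->
  lie_expn M y = lie_expn N y.
Proof.
move=> NM yN; rewrite /lie_expn -!(big_mkord xpredT
  (fun m => (m`!%:R)^-1 *: iter m (lbr x) y)) (big_cat_nat (leq0n N) NM) //=.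
rewrite [X in _ + X]big_nat [X in _ + X]big1 ?addr0 // => m /andP[Nm _].
by rewrite (iter_lbr_eq0 Nm yN) scaler0.
Qed.

Lemma lie_expE N y : iter N (lbr x) y = 0 -> lie_exp y = lie_expn N y.
Proof.
move=> yN; rewrite /lie_exp; case: ex_minnP => M /eqP yM minM.
by rewrite [RHS](@lie_expnE M) //; apply/minM/eqP.
Qed.

(** Divided by [m!], Leibniz's formula becomes the Cauchy product of two exponential series. *)
Lemma lie_exp_hom : lie_hom lie_exp.
Proof.
have nil2 y z : exists N, iter N (lbr x) y = 0 /\ iter N (lbr x) z = 0.
  have [[a /eqP ya] [b /eqP zb]] := (x_nilp y, x_nilp z).
  by exists (maxn a b); split;
    [apply: iter_lbr_eq0 ya; exact: leq_maxl|apply: iter_lbr_eq0 zb; exact: leq_maxr].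
have iterD N y z : iter N (lbr x) (y + z) = iter N (lbr x) y + iter N (lbr x) z.
  by elim: N => //= N ->; rewrite lbrDr.
split.
- move=> y z; have [N [yN zN]] := nil2 y z.
  rewrite !(@lie_expE N) ?iterD ?yN ?zN ?addr0 // /lie_expn -big_split /=.
  by apply: eq_bigr => m _; rewrite iterD scalerDr.
- move=> a y; have [N /eqP yN] := x_nilp y.
  rewrite !(@lie_expE N) ?iter_lbrZ ?yN ?scaler0 // /lie_expn scaler_sumr.
  by apply: eq_bigr => m _; rewrite iter_lbrZ !scalerA mulrC.
- move=> y z; have [N [yN zN]] := nil2 y z.
  pose u m := (m`!%:R)^-1 *: iter m (lbr x) y.
  pose v m := (m`!%:R)^-1 *: iter m (lbr x) z.
  have u0 m : (N <= m)%N -> u m = 0.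
    by move=> Nm; rewrite /u (iter_lbr_eq0 Nm yN) scaler0.
  have v0 m : (N <= m)%N -> v m = 0.
    by move=> Nm; rewrite /v (iter_lbr_eq0 Nm zN) scaler0.
  have yzm m : (m`!%:R)^-1 *: iter m (lbr x) {[y, z]} =
      \sum_(a < m.+1) {[u a, v (m - a)%N]}.
    rewrite iter_lbrJ scaler_sumr; apply: eq_bigr => a _.
    rewrite -scaler_nat scalerA /u /v lbrZl lbrZr scalerA; congr (_ *: _).
    have am : (a <= m)%N by rewrite -ltnS.
    rewrite -(bin_fact am) !natrM.
    have nz p : p`!%:R != 0 :> K by rewrite pnatr_eq0 -lt0n fact_gt0.
    have bnz : 'C(m, a)%:R != 0 :> K by rewrite pnatr_eq0 -lt0n bin_gt0.
    by rewrite !invfM mulrC mulVKf.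
  have yzN : iter (N + N) (lbr x) {[y, z]} = 0.
    have := yzm (N + N)%N; rewrite big1 => [/eqP|a _].
      by rewrite scaler_eq0 invr_eq0 pnatr_eq0 gtn_eqF ?fact_gt0 //= => /eqP.
    have [aN|Na] := leqP N a; first by rewrite u0 ?lbr0l.
    by rewrite v0 ?lbr0r //; lia.
  (* The left side sums over the triangle a + b < 2N, the right side over the square a, b < N. Terms
     with a >= N or b >= N vanish, so the two sums agree. *)
  rewrite (lie_expE yzN) (lie_expE yN) (lie_expE zN) /lie_expn.
  rewrite (eq_bigr (fun m : 'I_(N + N) =>
     \sum_(a < N + N | (a <= m)%N) {[u a, v (m - a)%N]})); last first.
    move=> m _; rewrite yzm.
    by rewrite (big_ord_widen (N + N) (fun a => {[u a, v (m - a)%N]})).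
  rewrite (exchange_big_dep xpredT) //=.
  have -> : lbr (\sum_(m < N) (m`!%:R)^-1 *: iter m (lbr x) y)
    (\sum_(m < N) (m`!%:R)^-1 *: iter m (lbr x) z) =
    \sum_(a < N) \sum_(b < N) {[u a, v b]}.
    rewrite lbrC raddf_sum /= -sumrN; apply: eq_bigr => a _.
    by rewrite -lbrC raddf_sum.
  rewrite (big_ord_widen (N + N) (fun a => \sum_(b < N) {[u a, v b]})) ?leq_addr //.
  rewrite [RHS]big_mkcond /=; apply: eq_bigr => a _.
  case: ltnP => aN; last by rewrite big1 // => b _; rewrite u0 ?lbr0l.
  rewrite -(big_mkord (fun m => a <= m)%N (fun m => {[u a, v (m - a)%N]})).
  rewrite (big_cat_nat (n := a)) //=; last by lia.
  rewrite big_nat_cond big1 ?add0r; last first.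
    by move=> m /andP[/andP[_ ma]]; rewrite leqNgt ma.
  rewrite -{1}[nat_of_ord a]add0n big_addn big_mkcond /=.
  rewrite (eq_bigr (fun b => {[u a, v b]})); last by move=> b _; rewrite leq_addl addnK.
  rewrite (big_cat_nat (n := N)) //=; last by lia.
  rewrite [X in _ + X]big_nat [X in _ + X]big1 ?addr0 ?big_mkord // => b /andP[Nb _].
  by rewrite v0 ?lbr0r.
Qed.

End LieExp.

(** * Triples for sl2 and lowest weight vectors *)

Definition sl2_triple (K : fieldType) (L : lieType K) (e f h : L) :=
  [/\ {[e, f]} = h, {[h, e]} = 2%:R *: e & {[h, f]} = - 2%:R *: f].

Definition lowest (K : fieldType) (L : lieType K) (f h : L) (m : nat) (v : L) :=
  {[f, v]} = 0 /\ {[h, v]} = - m%:R *: v.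

Lemma sl2_tripleC (K : fieldType) (L : lieType K) (e f h : L) :
  sl2_triple e f h -> sl2_triple f e (- h).
Proof.
case=> ef he hf; split; first by rewrite lbrC ef.
  by rewrite lbrNl hf -scaleNr opprK.
by rewrite lbrNl he -scaleNr.
Qed.

Section Sl2.
Variables (K : numFieldType) (L : lieType K) (e f h : L).
Hypothesis efh : sl2_triple e f h.

Let ef : {[e, f]} = h. Proof. by case: efh. Qed.
Let he : {[h, e]} = 2%:R *: e. Proof. by case: efh. Qed.
Let hf : {[h, f]} = - 2%:R *: f. Proof. by case: efh. Qed.

Lemma sl2_h_iter (w : K) v a : {[h, v]} = w *: v ->
  {[h, iter a (lbr e) v]} = (w + a.*2%:R) *: iter a (lbr e) v.
Proof.
move=> hv; elim: a => [|a IH]; first by rewrite addr0.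
rewrite iterS lbrJ he lbrZl IH lbrZr -scalerDl doubleS -[X in X.+2]addn0.
by congr (_ *: _); rewrite -addn2 addn0 natrD; ring.
Qed.

Lemma sl2_f_iter (w : K) v a : {[f, v]} = 0 -> {[h, v]} = w *: v ->
  {[f, iter a.+1 (lbr e) v]} =
    (- (a.+1%:R * (w + a%:R))) *: iter a (lbr e) v.
Proof.
move=> fv hv; have fe : {[f, e]} = - h by rewrite lbrC ef.
elim: a => [|a IH].
  rewrite /= lbrJ fe fv lbr0r addr0 lbrNl hv -scaleNr.
  by congr (_ *: _); ring.
rewrite iterS lbrJ fe {}IH lbrNl (sl2_h_iter _ hv) -scaleNr lbrZr -iterS.
by rewrite -scalerDl; congr (_ *: _); rewrite -muln2 natrM -!(natr1, addn1) ?natrD; ring.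
Qed.

Section Nilpotent.
Hypothesis e_nilp : locally_nilpotent e.

(** For a positive weight the coefficient in [sl2_f_iter] never vanishes, so [e^N v = 0] descends to
    [v = 0]. *)
Lemma highest_weight_ge0 v (m : nat) :
  {[f, v]} = 0 -> {[h, v]} = m.+1%:R *: v -> v = 0.
Proof.
move=> fv hv; case: (e_nilp v) => N; elim: N => [|N IH] /eqP; first by [].
move=> eN; apply: IH; apply/eqP.
have := sl2_f_iter N fv hv; rewrite eN lbr0r => /esym/eqP.
rewrite scaler_eq0 oppr_eq0 mulf_eq0 -natrD !pnatr_eq0 /=.
by move=> /eqP.
Qed.

(** For weight [-m] the coefficient in [sl2_f_iter] vanishes only at [a = m], so the descent from
    some [e^N v = 0] stops at [e^(m+1) v = 0]. *)
Lemma lowest_nilp m v : lowest f h m v -> iter m.+1 (lbr e) v = 0.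
Proof.
move=> [fv hv]; case: (e_nilp v) => N /eqP.
have [Nm|mN] := leqP N m.+1; first exact: iter_lbr_eq0.
rewrite -(subnK mN); elim: (N - m.+2)%N => [|p IH] eN.
  have := sl2_f_iter m.+1 fv hv; rewrite eN lbr0r => /esym/eqP.
  rewrite scaler_eq0 oppr_eq0 mulf_eq0 pnatr_eq0 /= addrC -natrB //.
  by rewrite subSnn oner_eq0 => /eqP.
apply: IH; have := sl2_f_iter (p + m.+2) fv hv; rewrite eN lbr0r => /esym/eqP.
rewrite scaler_eq0 oppr_eq0 mulf_eq0 pnatr_eq0 /= addrC -natrB; last by lia.
by rewrite pnatr_eq0 => /orP[|/eqP//]; lia.
Qed.
End Nilpotent.

Lemma lowest_f_iter m v a : lowest f h m v ->
  {[f, iter a.+1 (lbr e) v]} = (a.+1%:R * (m%:R - a%:R)) *: iter a (lbr e) v.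
Proof.
by case=> fv hv; rewrite (sl2_f_iter a fv hv); congr (_ *: _); ring.
Qed.

Lemma lowest_fa_em m v a : lowest f h m v -> (a <= m)%N ->
  iter a (lbr f) (iter m (lbr e) v) =
    ((m ^_ a)%:R * a`!%:R) *: iter (m - a) (lbr e) v.
Proof.
move=> vm; elim: a => [|a IH] am; first by rewrite subn0 mulr1 scale1r.
rewrite iterS IH 1?ltnW // lbrZr -(subnSK am) (lowest_f_iter _ vm) scalerA.
rewrite -natrB ?leq_subr // subKn // subnSK // ffactnSr factS !natrM.
by congr (_ *: _); ring.
Qed.

(** The factor cancels the two normalisations [1/m!] when the homomorphisms of the theorem are
    composed. *)
Lemma lowest_fm_em m v : lowest f h m v ->
  iter m (lbr f) (iter m (lbr e) v) = (m`!%:R ^+ 2) *: v.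
Proof. by move=> vm; rewrite (lowest_fa_em vm) // subnn ffactnn expr2. Qed.

Lemma lowest_br m v y : {[f, y]} = 0 -> {[h, y]} = 0 ->
  lowest f h m v -> lowest f h m {[v, y]}.
Proof.
by move=> fy hy [fv hv]; split; rewrite lbr_comml // ?fv ?hv ?lbr0l // lbrZl.
Qed.

Lemma lowest_brr m v y : {[f, y]} = 0 -> {[h, y]} = 0 ->
  lowest f h m v -> lowest f h m {[y, v]}.
Proof.
by move=> fy hy [fv hv]; split; rewrite lbr_comm // ?fv ?hv ?lbr0r // lbrZr.
Qed.

End Sl2.

(** * The automorphism lifting a simple reflection *)

Section Reflection.
Variables (K : numFieldType) (L : lieType K) (e f h : L).
Hypothesis efh : sl2_triple e f h.

Let ef : {[e, f]} = h. Proof. by case: efh. Qed.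
Let he : {[h, e]} = 2%:R *: e. Proof. by case: efh. Qed.
Let hf : {[h, f]} = - 2%:R *: f. Proof. by case: efh. Qed.

Hypotheses (e_nilp : locally_nilpotent e) (f_nilp : locally_nilpotent f).

Lemma locally_nilpotentN : locally_nilpotent (- f).
Proof.
move=> y; have [m /eqP ym] := f_nilp y; exists m; apply/eqP.
by rewrite -scaleN1r iter_lbrZl ym scaler0.
Qed.

(** The Weyl element of SL2, acting through exponentials. *)
Definition reflection (y : L) : L :=
  lie_exp e_nilp (lie_exp locally_nilpotentN (lie_exp e_nilp y)).

Local Notation s := reflection.

Lemma reflection_hom : lie_hom s.
Proof.
have [eD eZ eB] := lie_exp_hom e_nilp.
have [fD fZ fB] := lie_exp_hom locally_nilpotentN.
by split=> [x y|a x|x y]; rewrite /s ?eD ?fD ?eD ?eZ ?fZ ?eZ ?eB ?fB ?eB.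
Qed.

Lemma reflectionD x y : s (x + y) = s x + s y.
Proof. by case: reflection_hom. Qed.
Lemma reflectionZ a x : s (a *: x) = a *: s x.
Proof. by case: reflection_hom. Qed.
Lemma reflectionB x y : s {[x, y]} = {[s x, s y]}.
Proof. by case: reflection_hom. Qed.
Lemma reflection0 : s 0 = 0.
Proof. by have := reflectionZ 0 0; rewrite !scale0r. Qed.
Lemma reflection_iter m x y :
  s (iter m (lbr x) y) = iter m (lbr (s x)) (s y).
Proof. by elim: m => //= m; rewrite reflectionB => ->. Qed.

Section FourDim.
Variables (v0 v1 v2 v3 : L) (p1 p2 p3 : K).
Hypotheses (e0 : {[e, v0]} = v1) (e1 : {[e, v1]} = v2) (e2 : {[e, v2]} = v3).
Hypotheses (e3 : {[e, v3]} = 0) (f0 : {[f, v0]} = 0).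
Hypotheses (f1 : {[f, v1]} = p1 *: v0) (f2 : {[f, v2]} = p2 *: v1).
Hypothesis (f3 : {[f, v3]} = p3 *: v2).

Let V (a b c d : K) := a *: v0 + b *: v1 + c *: v2 + d *: v3.

Let V_D a b c d a' b' c' d' :
  V a b c d + V a' b' c' d' = V (a + a') (b + b') (c + c') (d + d').
Proof.
rewrite /V !scalerDl [LHS]addrACA; congr (_ + _); rewrite [LHS]addrACA; congr (_ + _).
by rewrite [LHS]addrACA.
Qed.

Let V_Z x a b c d : x *: V a b c d = V (x * a) (x * b) (x * c) (x * d).
Proof. by rewrite /V !scalerDr !scalerA. Qed.

Let V0 : v0 = V 1 0 0 0. Proof. by rewrite /V !scale0r scale1r !addr0. Qed.
Let V1 : v1 = V 0 1 0 0.
Proof. by rewrite /V !scale0r scale1r !addr0 add0r. Qed.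
Let V2 : v2 = V 0 0 1 0.
Proof. by rewrite /V !scale0r scale1r !addr0 !add0r. Qed.
Let V3 : v3 = V 0 0 0 1.
Proof. by rewrite /V !scale0r scale1r !add0r. Qed.

Let exp4 (x : L) (x_nilp : locally_nilpotent x) y :
  iter 4 (lbr x) y = 0 -> lie_exp x_nilp y =
  y + {[x, y]} + 2%:R^-1 *: {[x, {[x, y]}]} +
  6%:R^-1 *: {[x, {[x, {[x, y]}]}]}.
Proof.
move=> y4; rewrite (lie_expE _ y4) /lie_expn !big_ord_recr big_ord0 /=.
by rewrite !factS fact0 !muln1 !invr1 !scale1r add0r.
Qed.

Let expE a b c d : lie_exp e_nilp (V a b c d) =
  V a (a + b) (a / 2%:R + b + c) (a / 6%:R + b / 2%:R + c + d).
Proof.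
have [eD eZ _] := lie_exp_hom e_nilp.
rewrite {1}/V !eD !eZ.
rewrite !exp4 /= ?(e0, e1, e2, e3, lbr0r) // ?scaler0 ?addr0.
rewrite {1}V0 {1 2}V1 {1 2 3}V2 {1 2 3 4}V3.
by rewrite !(V_Z, V_D); congr V; field.
Qed.

Let expNfE a b c d : lie_exp locally_nilpotentN (V a b c d) =
  V (a - p1 * b + p1 * p2 / 2%:R * c - p1 * p2 * p3 / 6%:R * d)
    (b - p2 * c + p2 * p3 / 2%:R * d) (c - p3 * d) d.
Proof.
have [fD fZ _] := lie_exp_hom locally_nilpotentN.
rewrite {1}/V !fD !fZ.
rewrite !exp4 /= ?(f0, f1, f2, f3, lbr0r, lbrNl, lbrNr, lbrZr, oppr0, scaler0)
  ?(f0, f1, f2, f3, lbr0r, lbrNl, lbrNr, lbrZr, oppr0, scaler0, opprK) ?addr0 //.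
rewrite -!scaleNr V0 V1 V2 V3.
by rewrite !(V_Z, V_D); congr V; field.
Qed.

(** Entries of the Cartan counterparts off the diagonal are at most 3 in absolute value, so only
    modules of dimension at most 4 occur. Keeping the [p_i] generic treats all of them at once; in
    the smaller modules the last vectors are zero. *)
Lemma reflection4 : s v0 =
  (1 - p1 + p1 * p2 / 4%:R - p1 * p2 * p3 / 36%:R) *: v0 +
  (2%:R - p1 - p2 / 2%:R + p1 * p2 / 4%:R + p2 * p3 / 12%:R
    - p1 * p2 * p3 / 36%:R) *: v1 +
  (2%:R - p1 / 2%:R - p2 / 2%:R - p3 / 6%:R + p1 * p2 / 8%:R + p2 * p3 / 12%:R
    - p1 * p2 * p3 / 72%:R) *: v2 +
  (4%:R / 3%:R - p1 / 6%:R - p2 / 4%:R - p3 / 6%:R + p1 * p2 / 24%:R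
    + p2 * p3 / 24%:R - p1 * p2 * p3 / 216%:R) *: v3.
Proof. by rewrite /s {1}V0 expE expNfE expE /V; congr (_ *: _ + _ *: _ + _ *: _ + _ *: _); field. Qed.
End FourDim.

(** The lowest weight vector goes to the highest one: for [p_i = i (m - i + 1)] the other
    coefficients in [reflection4] vanish or multiply zero vectors. *)
Lemma reflection_lowest m v : (m <= 3)%N -> lowest f h m v ->
  s v = (m`!%:R)^-1 *: iter m (lbr e) v.
Proof.
move=> m3 vm; have vE a := lowest_f_iter efh a vm.
have v0 a : (m < a)%N -> iter a (lbr e) v = 0.
  by move=> ma; apply: iter_lbr_eq0 ma (lowest_nilp efh e_nilp vm).
have ev4 : {[e, iter 3 (lbr e) v]} = 0 by rewrite -iterS v0.
rewrite (reflection4 erefl erefl erefl ev4 vm.1 (vE 0) (vE 1) (vE 2)).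
have [v1 v2 v3] : [/\ (m < 1)%N -> {[e, v]} = 0,
  (m < 2)%N -> {[e, {[e, v]}]} = 0 & (m < 3)%N -> {[e, {[e, {[e, v]}]}]} = 0].
  by split; [exact: (v0 1%N)|exact: (v0 2%N)|exact: (v0 3%N)].
case: m m3 {vm vE ev4 v0} v1 v2 v3 => [|[|[|[|//]]]] _ v1 v2 v3 /=;
  [rewrite v1 //|rewrite v2 //|rewrite v3 //|];
  rewrite ?lbr0r ?scaler0 ?addr0 ?factS ?fact0.
- by congr (_ *: _); field.
- rewrite [X in X *: v](_ : _ = 0) ?scale0r ?add0r; last by field.
  by congr (_ *: _); field.
- rewrite [X in X *: v](_ : _ = 0) ?scale0r ?add0r; last by field.
  rewrite [X in X *: {[e, v]}](_ : _ = 0) ?scale0r ?add0r; last by field.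
  by congr (_ *: _); field.
- rewrite [X in X *: v](_ : _ = 0) ?scale0r ?add0r; last by field.
  rewrite [X in X *: {[e, v]}](_ : _ = 0) ?scale0r ?add0r; last by field.
  rewrite [X in X *: {[e, {[e, v]}]}](_ : _ = 0) ?scale0r ?add0r; last by field.
  by congr (_ *: _); field.
Qed.

Let fe : {[f, e]} = - h. Proof. by rewrite lbrC ef. Qed.
Let eh : {[e, h]} = - (2%:R *: e). Proof. by rewrite lbrC he. Qed.
Let fh : {[f, h]} = 2%:R *: f. Proof. by rewrite lbrC hf scaleNr opprK. Qed.

Let exp3 (x : L) (x_nilp : locally_nilpotent x) y :
  {[x, {[x, {[x, y]}]}]} = 0 -> lie_exp x_nilp y =
  y + {[x, y]} + 2%:R^-1 *: {[x, {[x, y]}]}.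
Proof.
move=> y3; rewrite (@lie_expE _ _ _ _ 3 y y3) /lie_expn !big_ord_recr big_ord0 /=.
by rewrite !factS fact0 !muln1 !invr1 !scale1r add0r.
Qed.

Let exp2 (x : L) (x_nilp : locally_nilpotent x) y :
  {[x, {[x, y]}]} = 0 -> lie_exp x_nilp y = y + {[x, y]}.
Proof. by move=> y2; rewrite exp3 y2 ?lbr0r // scaler0 addr0. Qed.

Let exp1 (x : L) (x_nilp : locally_nilpotent x) y :
  {[x, y]} = 0 -> lie_exp x_nilp y = y.
Proof. by move=> y1; rewrite exp2 y1 ?lbr0r // addr0. Qed.

Let half2 (y : L) : 2%:R^-1 *: (2%:R *: y) = y.
Proof. by rewrite scalerA mulVf ?scale1r // pnatr_eq0. Qed.

Let exp_h : lie_exp e_nilp h = h - 2%:R *: e.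
Proof. by rewrite exp2 eh ?lbrNr ?lbrZr ?lbrxx ?scaler0 ?oppr0. Qed.

Let exp_f : lie_exp e_nilp f = f + h - e.
Proof.
rewrite exp3 ef eh ?lbrNr ?lbrZr ?lbrxx ?scaler0 ?oppr0 //.
by rewrite scalerN half2.
Qed.

Let expN_e : lie_exp locally_nilpotentN e = e + h - f.
Proof.
rewrite exp3 !lbrNl ?fe ?lbrNr ?opprK ?fh ?lbrNr ?lbrNl ?lbrZr ?lbrxx ?scaler0 ?oppr0 //.
by rewrite scalerN half2.
Qed.

Lemma reflection_e : s e = - f.
Proof.
have [eD eZ _] := lie_exp_hom e_nilp.
rewrite /s (@exp1 _ _ e) ?lbrxx // expN_e -scaleN1r !eD eZ exp1 ?lbrxx //.
rewrite exp_h exp_f !scaleN1r scaler_nat mulr2n [e + _]addrCA.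
by rewrite [- (e + e)]opprD [e + _]addrA subrr add0r -[f + h - e]addrA opprD
  addrCA subrr addr0.
Qed.

Lemma reflection_f : s f = - e.
Proof.
have f2 : lowest f h 2 f by split; rewrite ?lbrxx.
rewrite (reflection_lowest _ f2) //= ef eh scalerN.
by rewrite half2.
Qed.

Lemma reflection_cartan x (c : K) :
  {[x, e]} = c *: e -> {[x, f]} = - c *: f -> s x = x - c *: h.
Proof.
have [eD eZ _] := lie_exp_hom e_nilp.
have [fD fZ _] := lie_exp_hom locally_nilpotentN.
move=> xe xf; have ex : {[e, x]} = - c *: e by rewrite lbrC xe scaleNr.
have fx : {[f, x]} = c *: f by rewrite lbrC xf scaleNr opprK.
have expx : lie_exp e_nilp x = x - c *: e.
  by rewrite exp2 ex ?lbrZr ?lbrxx ?scaler0 // scaleNr.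
have expNx : lie_exp locally_nilpotentN x = x - c *: f.
  by rewrite exp2 !lbrNl fx ?lbrNr ?lbrZr ?lbrxx ?scaler0 ?oppr0.
rewrite /s expx -scaleNr fD fZ expN_e expNx.
have -> : x - c *: f + - c *: (e + h - f) = x + - c *: (e + h).
  rewrite (scalerDr _ (e + h)) (_ : - c *: - f = c *: f); last first.
    by rewrite scalerN scaleNr opprK.
  by rewrite -addrA [- (c *: f) + _]addrC addrK.
rewrite eD eZ eD expx exp1 ?lbrxx // exp_h [e + _]addrCA scaler_nat mulr2n.
rewrite [- (e + e)]opprD [e + _]addrA subrr add0r scalerDr scalerN !scaleNr opprK.
by rewrite -addrA [- (c *: e) + _]addrC addrK.
Qed.

Lemma reflection_h : s h = - h.
Proof. by rewrite (@reflection_cartan _ 2%:R) // scaler_nat mulr2n opprD addrA subrr add0r. Qed.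

(** Reduced to the lowest vector [u = f^m v], of which [v] is a multiple of [e^m u]. The sign comes
    from [s e = - f]. *)
Lemma reflection_highest m v : (m <= 3)%N -> lowest e (- h) m v ->
  s v = ((- 1) ^+ m / m`!%:R) *: iter m (lbr f) v.
Proof.
move=> m3 vm; have fe_sl2 := sl2_tripleC efh.
pose u := iter m (lbr f) v.
have nz : m`!%:R != 0 :> K by rewrite pnatr_eq0 -lt0n fact_gt0.
have mu : iter m (lbr e) u = (m`!%:R ^+ 2) *: v :=  (lowest_fm_em fe_sl2 vm).
have um : lowest f h m u.
  split; first by rewrite -iterS; apply: (lowest_nilp fe_sl2 f_nilp vm).
  have [_ hv] := vm; have := sl2_h_iter fe_sl2 m hv.
  rewrite lbrNl => /eqP; rewrite eqr_oppLR -scaleNr => /eqP ->.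
  by congr (_ *: _); rewrite -muln2 natrM; ring.
have -> : v = (m`!%:R ^+ 2)^-1 *: iter m (lbr e) u.
  by rewrite mu scalerA mulVf ?scale1r // expf_neq0.
rewrite reflectionZ reflection_iter reflection_e (reflection_lowest m3 um) mu.
rewrite -scaleN1r iter_lbrZl !iter_lbrZ !scalerA; congr (_ *: _).
by field.
Qed.

Lemma reflection_lowest_iter m v a : (a <= m <= 3)%N -> lowest f h m v ->
  exists2 c : K, c != 0 &
    s (iter a (lbr e) v) = c *: iter (m - a) (lbr e) v.
Proof.
move=> /andP[am m3] vm.
rewrite reflection_iter reflection_e (reflection_lowest m3 vm) iter_lbrZ.
rewrite -scaleN1r iter_lbrZl (lowest_fa_em efh vm am) !scalerA.
eexists; last by [].
rewrite !mulf_neq0 ?invr_eq0 ?expf_neq0 ?oppr_eq0 ?oner_eq0 //;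
  by rewrite pnatr_eq0 -lt0n ?fact_gt0 // ffact_gt0.
Qed.

Lemma reflection_highest_iter m v a : (a <= m <= 3)%N -> lowest e (- h) m v ->
  exists2 c : K, c != 0 &
    s (iter a (lbr f) v) = c *: iter (m - a) (lbr f) v.
Proof.
move=> /andP[am m3] vm; have fe_sl2 := sl2_tripleC efh.
rewrite reflection_iter reflection_f (reflection_highest m3 vm) iter_lbrZ.
rewrite -scaleN1r iter_lbrZl (lowest_fa_em fe_sl2 vm am) !scalerA.
eexists; last by [].
rewrite !mulf_neq0 ?invr_eq0 ?expf_neq0 ?oppr_eq0 ?oner_eq0 //;
  by rewrite pnatr_eq0 -lt0n ?fact_gt0 // ffact_gt0.
Qed.

Lemma reflection_fix x : {[e, x]} = 0 -> {[f, x]} = 0 -> s x = x.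
Proof.
by move=> ex fx; rewrite /s (@exp1 _ _ x) // exp1 ?exp1 // lbrNl fx oppr0.
Qed.

End Reflection.

(** * Chordless paths and cycles *)

Section ChordlessPaths.
Variables (T : eqType) (adj : rel T).

Fixpoint chordless_path (s : seq T) : bool :=
  if s is x :: s' then
    (if s' is y :: s'' then adj x y && all (fun z => ~~ adj x z) s'' else true)
      && chordless_path s'
  else true.

Lemma chordless_path_cons x y s : uniq (y :: s) ->
  chordless_path (x :: y :: s) =
  all (fun z => adj x z == (z == y)) (y :: s) && chordless_path (y :: s).
Proof.
move=> /andP[ys _] /=; congr (_ && _); rewrite eqxx eqb_id; congr (_ && _).
apply: eq_in_all => z zs; case: (z =P y) ys => [<-|_ _]; first by rewrite zs.
by case: (adj x z).
Qed.

Lemma chordless_path_catr s1 s2 :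
  chordless_path (s1 ++ s2) -> chordless_path s2.
Proof. by elim: s1 => //= x s1 IH /andP[_]. Qed.

Lemma chordless_path_split s1 x s2 y : uniq (s1 ++ x :: s2) ->
  chordless_path (s1 ++ x :: s2) -> y \in s2 -> adj x y = (y == head x s2).
Proof.
rewrite cat_uniq => /and3P[_ _ u2] /chordless_path_catr.
case: s2 u2 => // z s2 /andP[_ uz]; rewrite chordless_path_cons //.
by case/andP=> /allP + _ => /[apply] /eqP.
Qed.

End ChordlessPaths.

Lemma eq_in_chordless_path (T : eqType) (adj adj' : rel T) s :
  {in s &, adj =2 adj'} -> chordless_path adj s = chordless_path adj' s.
Proof.
elim: s => //= x s IH Hs; rewrite IH; last first.
  by move=> y z ys zs; apply: Hs; rewrite inE ?ys ?zs orbT.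
congr (_ && _); case: s Hs {IH} => // y s Hs.
rewrite Hs ?mem_head ?inE ?eqxx ?orbT //; congr (_ && _).
by apply: eq_in_all => z zs; rewrite Hs ?mem_head // !inE zs !orbT.
Qed.

Lemma next_cat_uniq (T : eqType) (k x : T) s1 s2 :
  uniq (k :: s1 ++ x :: s2) -> next (k :: s1 ++ x :: s2) x = head k s2.
Proof.
move=> u; rewrite next_nth inE mem_cat mem_head !orbT.
rewrite -cat_cons index_cat /= eqxx addn0.
have -> : (x \in k :: s1) = false.
  apply/negbTE; apply: contraL u; rewrite inE.
  case/orP=> [/eqP->|xs]; first by rewrite /= mem_cat mem_head orbT.
  by rewrite cons_uniq cat_uniq /= xs /= !andbF.
by rewrite nth_cat ltnNge leqnSn /= subSnn /= nth0.
Qed.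

Lemma next_eq_last (T : eqType) (k j : T) s v : uniq (k :: j :: s) -> v \in s ->
  (k == next (k :: j :: s) v) = (v == last j s).
Proof.
move=> u vs; have kjs : k \notin j :: s by case/andP: u.
case/splitPr: vs u kjs => t1 t2; rewrite -cat_cons => u kjs.
rewrite next_cat_uniq // last_cat /=.
case: t2 u kjs => [|z t2] u kjs /=; first by rewrite !eqxx.
have -> : (k == z) = false.
  by apply: contraNF kjs => /eqP->; rewrite !(inE, mem_cat) eqxx !orbT.
apply/esym/negbTE; move: u; rewrite cons_uniq cat_uniq => /and4P[_ _ _].
by case/andP=> + _; apply: contraNneq => ->; rewrite mem_last.
Qed.

Section ChordlessCycles.
Variables (n : nat) (C : 'M[int]_n).
Let adj : rel 'I_n := fun i j => C i j != 0.
Hypothesis adjC : symmetric adj.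

Lemma chordless_cycle_rot m s : chordless_cycle C s -> chordless_cycle C (rot m s).
Proof.
case=> us s3 cs; split; rewrite ?rot_uniq ?size_rot // => i j.
by rewrite !mem_rot !(next_rot m us); apply: cs.
Qed.

Lemma chordless_cycle_rev s : chordless_cycle C s -> chordless_cycle C (rev s).
Proof.
case=> us s3 cs; split; rewrite ?rev_uniq ?size_rev // => i j.
rewrite !mem_rev !(next_rev us) => si sj ij.
rewrite (cs i j) // orbC; congr (_ || _).
  by apply/eqP/eqP => ->; rewrite ?prev_next ?next_prev.
by apply/eqP/eqP => ->; rewrite ?prev_next ?next_prev.
Qed.

Lemma chordless_cycle_cat s1 s2 :
  chordless_cycle C (s1 ++ s2) -> chordless_cycle C (s2 ++ s1).
Proof. by move/(chordless_cycle_rot (size s1)); rewrite rot_size_cat. Qed.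

(** The working form of the notion: without its first vertex [k], a chordless cycle is a chordless
    path, and [k] is joined exactly to its two ends. Nonemptiness of [s] makes the ends distinct. *)
Lemma chordless_cycleP k j s : chordless_cycle C (k :: j :: s) <->
  [/\ uniq (k :: j :: s), s != [::], chordless_path adj (j :: s), adj k j &
      {in s, forall v, adj k v = (v == last j s)}].
Proof.
split.
- case=> u s3 cs; have sn : s != [::] by case: (s) s3.
  have kjs : k \notin j :: s by case/andP: u.
  have adjE s1 x s2 y : j :: s = s1 ++ x :: s2 -> y \in s2 ->
      adj x y = (y == head k s2).
    move=> E ys; move: u kjs cs; rewrite {}E => u kjs cs.
    have [t1 [t2 E2]] : exists t1 t2, s2 = t1 ++ y :: t2.
      by case/splitPr: ys => t1 t2; exists t1, t2.
    have xk : x != k.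
      by apply: contraNneq kjs => <-; rewrite mem_cat mem_head orbT.
    have xs2 : x \notin s2.
      by move: u; rewrite cons_uniq cat_uniq /= => /and5P[].
    rewrite /adj (cs x y); first last.
    + by apply: contraNneq xs2 => ->.
    + by rewrite inE mem_cat inE ys !orbT.
    + by rewrite inE mem_cat inE eqxx !orbT.
    rewrite (next_cat_uniq u).
    have -> : k :: s1 ++ x :: s2 = k :: (s1 ++ x :: t1) ++ y :: t2.
      by rewrite E2 -catA.
    rewrite next_cat_uniq; last by rewrite -catA /= -E2.
    case: (x =P head k t2) => [xt|_]; last by rewrite orbF.
    case: t2 E2 xt => [_ /eqP|z t2 E2 /= xz]; first by rewrite (negbTE xk).
    by case/negP: xs2; rewrite E2 xz mem_cat !inE eqxx !orbT.
  split => //.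
  + suff H s1 s2 : j :: s = s1 ++ s2 -> chordless_path adj s2 by exact: (H [::]).
    move: s1; elim: s2 => // x s2 IH s1 E.
    have ux2 : uniq s2.
      by move: u; rewrite E cons_uniq cat_uniq /= => /and5P[].
    case: s2 IH E ux2 => // y s2 IH E ux2; rewrite chordless_path_cons //.
    rewrite (IH (rcons s1 x)) ?cat_rcons // andbT; apply/allP => z zs.
    by rewrite (adjE _ _ _ _ E zs).
  + rewrite /adj cs ?inE ?eqxx ?orbT //=.
      by rewrite !eqxx.
    by move: kjs; rewrite inE negb_or => /andP[].
  + move=> v vs; rewrite /adj cs ?inE ?eqxx ?vs ?orbT //; last first.
      by apply: contraNneq kjs => ->; rewrite inE vs orbT.
    rewrite next_eq_last // [next _ k]/= eqxx; case: (v =P j) => // vj.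
    by move: u; rewrite -vj /= vs !andbF.
- case=> u sn cp kj ks; split=> //; first by case: (s) sn.
  have kjs : k \notin j :: s by case/andP: u.
  have adjk v : v \in j :: s -> adj k v =
      (v == next (k :: j :: s) k) || (k == next (k :: j :: s) v).
    rewrite inE [next _ k]/= eqxx; case: (v =P j) => [-> _|_ /= vs].
      by rewrite kj.
    by rewrite ks // next_eq_last.
  have adjE s1 x s2 y : j :: s = s1 ++ x :: s2 -> y \in s2 -> adj x y =
      (y == next (k :: j :: s) x) || (x == next (k :: j :: s) y).
    move=> E ys; move: u kjs cp {ks kj adjk}; rewrite {}E => u kjs cp.
    have [t1 [t2 E2]] : exists t1 t2, s2 = t1 ++ y :: t2.
      by case/splitPr: ys => t1 t2; exists t1, t2.
    have xk : x != k.
      by apply: contraNneq kjs => <-; rewrite mem_cat mem_head orbT.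
    have xs2 : x \notin s2.
      by move: u; rewrite cons_uniq cat_uniq /= => /and5P[].
    rewrite (next_cat_uniq u) (chordless_path_split _ cp ys); last first.
      by case/andP: u.
    have -> : k :: s1 ++ x :: s2 = k :: (s1 ++ x :: t1) ++ y :: t2.
      by rewrite E2 -catA.
    rewrite next_cat_uniq; last by rewrite -catA /= -E2.
    have -> : head k s2 = head x s2 by case: (s2) ys.
    case: (x =P head k t2) => [xt|_]; last by rewrite orbF.
    case: t2 E2 xt => [_ /eqP|z t2 E2 /= xz]; first by rewrite (negbTE xk).
    by case/negP: xs2; rewrite E2 xz mem_cat !inE eqxx !orbT.
  move=> x y; rewrite [x \in _]inE [y \in _]inE.
  case: (x =P k) => [->|_]; case: (y =P k) => [->|_] //=; first by rewrite eqxx.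
  + by move=> _ ys _; rewrite -[LHS]/(adj k y) adjk.
  + by move=> xs _ _; rewrite -[LHS]/(adj x k) adjC adjk // orbC.
  move=> xs ys xy; rewrite -[LHS]/(adj x y).
  have [s1 [s2 E]] : exists s1 s2, j :: s = s1 ++ x :: s2.
    by case/splitPr: xs => s1 s2; exists s1, s2.
  move: ys; rewrite {1}E mem_cat inE eq_sym (negbTE xy) /=.
  case/orP=> ys; last exact: (adjE s1 x s2).
  have [t1 [t2 E1]] : exists t1 t2, s1 = t1 ++ y :: t2.
    by case/splitPr: ys => t1 t2; exists t1, t2.
  rewrite adjC (adjE t1 y (t2 ++ x :: s2)) ?mem_cat ?mem_head ?orbT //.
    by rewrite orbC.
  by rewrite E E1 -catA.
Qed.

End ChordlessCycles.

(** * Positive definite quasi-Cartan matrices *)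

Record quasi_cartan (R : rcfType) (n : nat) (C : 'M[int]_n) (d : 'I_n -> R) :
    Prop := QuasiCartan {
  qc_diag : forall i, C i i = 2;
  qc_gt0 : forall i, 0 < d i;
  qc_sym : forall i j, d i * (C i j)%:~R = d j * (C j i)%:~R;
  qc_pos : forall x : 'I_n -> R, (exists i, x i != 0) ->
    0 < \sum_i \sum_j d i * (C i j)%:~R * x i * x j
}.

Definition pair_bounded : seq (int * int) :=
  [:: (1, 1); (1, 2); (2, 1); (1, 3); (3, 1);
      (-1, -1); (-1, -2); (-2, -1); (-1, -3); (-3, -1)].

Lemma pair_boundedP (a b : int) : 0 < a * b < 4 -> (a, b) \in pair_bounded.
Proof.
move=> /andP[ab0 ab4].
have ab : (0 < `|a| * `|b| < 4)%N by rewrite -abszM; lia.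
have [a3 b3] : (`|a| <= 3)%N /\ (`|b| <= 3)%N.
  by move: ab; move: `|a|%N `|b|%N => x y /andP[]; rewrite muln_gt0 => /andP[]; split; nia.
have : a \in [:: -3; -2; -1; 0; 1; 2; 3] by rewrite !inE; lia.
have : b \in [:: -3; -2; -1; 0; 1; 2; 3] by rewrite !inE; lia.
rewrite !inE => /or4P[|||/or4P[]] /eqP Eb /or4P[|||/or4P[]] /eqP Ea;
  by move: ab0 ab4; rewrite Ea Eb.
Qed.

(** The entries in both directions along the edges i j, j k, k i of a triangle. The premises are
    symmetrizability around the triangle and a positive determinant. The last clause says that the
    three vertices are not all long. A finite check settles all cases. *)
Definition triangle_ok (p q r : int * int) : bool :=
  let: ((a, a'), (b, b'), (c, c')) := (p, q, r) in
  (a * b * c == a' * b' * c') &&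
  (0 < 8%:Z - 2%:Z * (a * a' + b * b' + c * c') + 2%:Z * a * b * c) ==>
  [&& 0 < a * b * c, `|a| <= `|c' * b'|,
      (a != c' * b') ==> [|| [&& `|a| == 1, `|a'| == 1, `|b| == 1, `|b'| == 2, `|c| == 2 & `|c'| == 1]
        | [&& `|a| == 1, `|a'| == 1, `|b| == 2, `|b'| == 1, `|c| == 1 & `|c'| == 2] ] &
     ~~ [&& (`|a| > `|a'|) || (`|c'| > `|c|), (`|a'| > `|a|) || (`|b| > `|b'|) & (`|b'| > `|b|) || (`|c| > `|c'|)]].

Lemma triangle_okP p q r : p \in pair_bounded -> q \in pair_bounded ->
  r \in pair_bounded -> triangle_ok p q r.
Proof.
have /allP H : all (fun p => all (fun q => all (triangle_ok p q) pair_bounded)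
  pair_bounded) pair_bounded by vm_compute.
by move=> /H /allP + qP => /(_ _ qP) /allP; apply.
Qed.

Section QuasiCartan.
Variables (R : rcfType) (n : nat) (C : 'M[int]_n) (d : 'I_n -> R).
Hypothesis qc : quasi_cartan C d.

Let adj : rel 'I_n := fun i j => C i j != 0.

Lemma qc_sgz i j : sgz (C i j) = sgz (C j i).
Proof.
have := congr1 (fun x : R => sgz x) (qc_sym qc i j).
by rewrite !sgzM !(gtr0_sgz (qc_gt0 qc _)) !mul1r !sgz_int.
Qed.

Lemma qc_adjC : symmetric adj.
Proof. by move=> i j; rewrite /adj -[C i j == 0]sgz_eq0 qc_sgz sgz_eq0. Qed.

Lemma qc_sign i j : sign_of (C i j) = sign_of (C j i).
Proof. by rewrite /sign_of -[C i j < 0]sgz_lt0 qc_sgz sgz_lt0. Qed.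

Lemma qc_wt_gt0 i j : adj i j -> 0 < C i j * C j i.
Proof.
by move=> ij; rewrite -sgz_gt0 sgzM (qc_sgz j) -sgzM sgz_gt0 -expr2 exprn_even_gt0.
Qed.

(** When [C i j] is 2 (a_i, a_j) / (a_i, a_i) for roots a_i, with [d i] proportional to (a_i, a_i),
    these are the scalar products of the roots rescaled to squared length 2. The rescaling makes the
    matrix symmetric, with [g_ij^2 = c_ij c_ji]. *)
Definition gram i j : R := (C i j)%:~R * (Num.sqrt (d i) / Num.sqrt (d j)).

Let r_gt0 i : 0 < Num.sqrt (d i). Proof. by rewrite sqrtr_gt0 (qc_gt0 qc). Qed.
Let r_neq0 i : Num.sqrt (d i) != 0. Proof. by rewrite gt_eqF. Qed.
Let rr i : Num.sqrt (d i) * Num.sqrt (d i) = d i.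
Proof. by rewrite -expr2 sqr_sqrtr // ltW // (qc_gt0 qc). Qed.

Lemma gramC i j : gram i j = gram j i.
Proof.
rewrite /gram !mulrA; apply/eqP; rewrite eqr_div // -!mulrA !rr.
by rewrite mulrC (qc_sym qc i j) mulrC.
Qed.

Lemma gram_diag i : gram i i = 2%:R.
Proof. by rewrite /gram (qc_diag qc) divff ?mulr1. Qed.

Lemma gramM i j : gram i j ^+ 2 = (C i j * C j i)%:~R.
Proof.
rewrite expr2 {2}gramC /gram intrM mulrACA -[RHS]mulr1; congr (_ * _).
by rewrite mulrA divfK // divff.
Qed.

Lemma gramM3 i j k :
  gram i j * gram j k * gram k i = (C i j * C j k * C k i)%:~R.
Proof.
rewrite /gram !intrM; field.
by rewrite !r_neq0.
Qed.

Lemma gram_eq0 i j : (gram i j == 0) = ~~ adj i j.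
Proof.
by rewrite /gram mulf_eq0 mulf_eq0 invr_eq0 !(negbTE (r_neq0 _)) !orbF intr_eq0 negbK.
Qed.

Lemma gram_lt0 i j : (gram i j < 0) = sign_of (C i j).
Proof. by rewrite /gram pmulr_llt0 ?divr_gt0 // ltrz0. Qed.

Definition gram_form (s : seq 'I_n) (y : 'I_n -> R) : R :=
  \sum_(i <- s) \sum_(j <- s) gram i j * y i * y j.

Lemma gram_form_gt0 s y : uniq s -> (exists2 i, i \in s & y i != 0) ->
  0 < gram_form s y.
Proof.
move=> us [i0 si0 yi0].
pose x i := if i \in s then y i / Num.sqrt (d i) else 0.
suff -> : gram_form s y = \sum_i \sum_j d i * (C i j)%:~R * x i * x j.
  apply: (qc_pos qc); exists i0; rewrite /x si0.
  by rewrite mulf_neq0 // invr_eq0.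
rewrite /gram_form big_uniq //= [RHS](bigID (mem s)) /= [X in _ + X]big1 ?addr0.
  apply: eq_bigr => i si; rewrite big_uniq //= [RHS](bigID (mem s)) /=.
  rewrite [X in _ + X]big1 ?addr0.
    apply: eq_bigr => j sj; rewrite /x si sj /gram -{2}(rr i).
    by field; rewrite !r_neq0.
  by move=> j /negbTE sj; rewrite /x sj mulr0.
by move=> i /negbTE si; rewrite big1 // => j _; rewrite /x si mulr0 mul0r.
Qed.

Lemma gram_form_cons u s y : gram_form (u :: s) y =
  2%:R * y u ^+ 2 + 2%:R * y u * (\sum_(j <- s) gram u j * y j) + gram_form s y.
Proof.
rewrite /gram_form !big_cons gram_diag.
under [X in _ + X = _]eq_bigr do rewrite big_cons.
rewrite big_split /= addrA; congr (_ + _).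
have -> : \sum_(i <- s) gram i u * y i * y u = y u * \sum_(j <- s) gram u j * y j.
  by rewrite mulr_sumr; apply: eq_bigr => i _; rewrite gramC; ring.
have -> : \sum_(j <- s) gram u j * y u * y j = y u * \sum_(j <- s) gram u j * y j.
  by rewrite mulr_sumr; apply: eq_bigr => i _; ring.
by ring.
Qed.

Lemma gram_form_eq s y y' : {in s, y =1 y'} -> gram_form s y = gram_form s y'.
Proof.
move=> yy; rewrite /gram_form big_seq [RHS]big_seq; apply: eq_bigr => i si.
by rewrite big_seq [RHS]big_seq; apply: eq_bigr => j sj; rewrite !yy.
Qed.

(** The form takes the value [8 - 2 g_ij^2] at [(2, - g_ij)]. *)
Lemma qc_wt_lt4 i j : i != j -> C i j * C j i < 4.
Proof.
move=> ij; pose y v := if v == i then 2%:R else - gram i j.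
have : 0 < gram_form [:: i; j] y.
  apply: gram_form_gt0; first by rewrite /= inE ij.
  by exists i; rewrite ?mem_head // /y eqxx pnatr_eq0.
rewrite !gram_form_cons /gram_form !big_cons !big_nil /y eqxx eq_sym (negbTE ij).
have gg := gramM i j => h; have : (C i j * C j i)%:~R < 4 :> R by nra.
by rewrite -(ltr_int R).
Qed.

Lemma qc_pair i j : i != j -> adj i j -> (C i j, C j i) \in pair_bounded.
Proof.
by move=> ij aij; rewrite pair_boundedP // qc_wt_gt0 //= qc_wt_lt4.
Qed.

(** The test vector is a column of the adjugate, so the form takes there the value of the
    determinant times the minor [4 - g_ij^2], which is positive by [qc_wt_lt4]. *)
Lemma qc_det3 i j k : uniq [:: i; j; k] ->
  0 < 8%:Z - 2%:Z * (C i j * C j i + C j k * C k j + C k i * C i k)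
      + 2%:Z * C i j * C j k * C k i.
Proof.
move=> u; have [ij ik jk] : [/\ i != j, i != k & j != k].
  by move: u; rewrite /= !inE !negb_or andbT => /andP[/andP[-> ->] ->].
pose y v := if v == k then 4%:R - gram i j ^+ 2 else
  if v == i then gram i j * gram j k - 2%:R * gram k i else
  gram i j * gram k i - 2%:R * gram j k.
have w : (C i j * C j i)%:~R < 4 :> R by rewrite (ltr_int _ _ 4) qc_wt_lt4.
have : 0 < gram_form [:: i; j; k] y.
  apply: gram_form_gt0 => //; exists k; rewrite ?inE ?eqxx ?orbT //.
  by rewrite /y eqxx subr_eq0 gt_eqF // gramM.
rewrite !gram_form_cons /gram_form !big_cons !big_nil /y eqxx.
rewrite (negbTE ik) (negbTE jk) !eqxx [j == i]eq_sym (negbTE ij).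
rewrite (gramC i k) => h.
have : 0 < (4 - gram i j ^+ 2) * (8 - 2 * (gram i j ^+ 2 + gram j k ^+ 2 + gram k i ^+ 2) + 2 * (gram i j * gram j k * gram k i)).
  by move: h; congr (_ < _); ring.
rewrite !gramM gramM3 pmulr_rgt0 ?subr_gt0 //.
rewrite -(ltr_int R) !(rmorphD, rmorphB, rmorphM) /=.
by congr (_ < _); ring.
Qed.

Lemma qc_triangle i j k : uniq [:: i; j; k] -> adj i j -> adj j k -> adj k i ->
  triangle_ok (C i j, C j i) (C j k, C k j) (C k i, C i k) /\
  C i j * C j k * C k i = C j i * C k j * C i k.
Proof.
move=> u aij ajk aki.
have [ij ik jk] : [/\ i != j, i != k & j != k].
  by move: u; rewrite /= !inE !negb_or andbT => /andP[/andP[-> ->] ->].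
split; first by rewrite triangle_okP ?qc_pair // eq_sym.
apply/(@intr_inj R); rewrite -gramM3 gramC [gram j k]gramC [gram k i]gramC.
by rewrite mulrAC gramM3; congr (_%:~R); ring.
Qed.

Lemma qc_path3 i j k : uniq [:: i; j; k] -> ~~ adj i j -> adj j k -> adj k i ->
  C j k * C k j + C k i * C i k < 4.
Proof.
move=> u; rewrite negbK => /eqP ij0 _ _; have := qc_det3 u.
by rewrite ij0; lia.
Qed.

End QuasiCartan.

(** * Positivity along chordless paths and cycles *)

Lemma chordless_path_catl (T : eqType) (adj : rel T) s1 s2 :
  chordless_path adj (s1 ++ s2) -> chordless_path adj s1.
Proof.
elim: s1 => //= x s1 IH /andP[+ /IH ->]; rewrite andbT.
by case: s1 {IH} => //= y s1; rewrite all_cat => /and3P[-> ->].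
Qed.

(* The signs [eta] make the entry [C u v] negative. *)
Definition compat n (C : 'M[int]_n) (eta : 'I_n -> bool) : rel 'I_n :=
  fun u v => sign_of (C u v) (+) eta u (+) eta v.

(** Signs propagate along a sequence without repetition. Hence the sign rule of the cycle relations
    amounts to compatibility with a function [eta] on vertices, a form that does not refer to a
    starting point. *)
Lemma ex_potential n (C : 'M[int]_n) b u s : uniq (u :: s) ->
  exists2 eta, eta u = b & path (compat C eta) u s.
Proof.
elim: s u b => [|v s IH] u b; first by exists (fun _ => b).
rewrite cons_uniq => /andP[us uv].
have [eta etav etaP] := IH v (~~ (sign_of (C u v) (+) b)) uv.
exists (fun w => if w == u then b else eta w); rewrite ?eqxx //=.
have vu : v != u by apply: contraNneq us => <-; rewrite mem_head.
rewrite {1}/compat eqxx (negbTE vu) etav; apply/andP; split.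
  by case: (sign_of _); case: b {etav}.
rewrite (@eq_in_path _ (mem (v :: s)) _ (compat C eta)) //; last exact/allP.
have wu w : w \in v :: s -> w == u = false.
  by move=> ws; apply: contraNF us => /eqP <-.
by move=> x y xs ys; rewrite /compat !wu.
Qed.

Section Cycles.
Variables (R : rcfType) (n : nat) (C : 'M[int]_n) (d : 'I_n -> R).
Hypothesis qc : quasi_cartan C d.

Let adj : rel 'I_n := fun i j => C i j != 0.
Local Notation g := (gram C d).
Local Notation form := (gram_form C d).

Let adjC : symmetric adj. Proof. exact: qc_adjC qc. Qed.

Lemma compatC eta : symmetric (compat C eta).
Proof. by move=> u v; rewrite /compat (qc_sign qc) -!addbA [eta u (+) _]addbC. Qed.

Lemma gram_norm_ge1 u v : adj u v -> 1 <= `|g u v|.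
Proof.
move=> uv; rewrite -(@ler_pXn2r _ 2) ?nnegrE // expr1n.
by rewrite real_normK ?num_real // (gramM qc) ler1z; have := qc_wt_gt0 qc uv; lia.
Qed.

Lemma gram_norm_ge2 u v : adj u v -> C u v * C v u != 1 -> 2 <= `|g u v| ^+ 2.
Proof.
move=> uv w1; rewrite real_normK ?num_real // (gramM qc) (ler_int _ 2).
by have := qc_wt_gt0 qc uv; lia.
Qed.

Lemma gram_compat (eta : 'I_n -> bool) u v :
  g u v * (-1) ^+ eta u * (-1) ^+ eta v = (-1) ^+ compat C eta u v * `|g u v|.
Proof.
rewrite /compat !signr_addb -(gram_lt0 qc) {1}(realEsign (num_real (g u v))).
by ring.
Qed.

Lemma gram_sum1 s u v y : uniq s -> v \in s ->
  {in s, forall z, adj u z = (z == v)} ->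
  \sum_(z <- s) g u z * y z = g u v * y v.
Proof.
move=> us vs uE; rewrite (bigD1_seq v) //= big_seq_cond big1 ?addr0 // => z.
case/andP=> zs zv; have := gram_eq0 qc u z.
by rewrite -[C u z != 0]/(adj u z) uE // zv => /eqP->; rewrite mul0r.
Qed.

Lemma gram_path_cons u v s y : uniq (u :: v :: s) ->
  chordless_path adj (u :: v :: s) ->
  form (u :: v :: s) y = 2%:R * y u ^+ 2 + 2%:R * (g u v * y u * y v) + form (v :: s) y.
Proof.
rewrite cons_uniq => /andP[us uv].
rewrite chordless_path_cons // => /andP[/allP uE _].
rewrite (gram_form_cons qc) (@gram_sum1 _ _ v) ?mem_head //; first by ring.
by move=> z /uE /eqP.
Qed.

Lemma gram_form1 u y : form [:: u] y = 2%:R * y u ^+ 2.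
Proof.
by rewrite (gram_form_cons qc) big_nil mulr0 addr0 /gram_form big_nil addr0.
Qed.

(** Each vertex contributes 2, each compatible edge at most -2, and there is one edge fewer than
    vertices. *)
Lemma gram_form_path (eta : 'I_n -> bool) u s : uniq (u :: s) ->
  chordless_path adj (u :: s) -> path (compat C eta) u s ->
  form (u :: s) (fun v => (-1) ^+ eta v) <= 2%:R.
Proof.
elim: s u => [|v s IH] u us cp.
  by move=> _; rewrite gram_form1 sqrr_sign mulr1.
move=> /= /andP[cuv pv]; rewrite gram_path_cons //.
have uvs : uniq (v :: s) by case/andP: us.
move: (cp) => /= /andP[/andP[auv _] cv].
have := IH v uvs cv pv; rewrite sqrr_sign gram_compat // cuv.
have := gram_norm_ge1 auv; lra.
Qed.

(** If the closing edge were compatible too, there would be as many edges, each contributing at most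
    -2, as vertices, each contributing 2, and the form would be nonpositive at a vector of signs.
    Equivalently, the number of positive entries around a chordless cycle is odd. *)
Lemma chordless_cycle_parity eta k j s : chordless_cycle C (k :: j :: s) ->
  path (compat C eta) k (j :: s) -> ~~ compat C eta (last j s) k.
Proof.
case/(chordless_cycleP adjC) => u sn cp kj ks /= /andP[ckj pj].
apply/negP => clk; set l := last j s in clk.
have ls : l \in s by rewrite /l; case: (s) sn => //= x s' _; apply: mem_last.
have := @gram_form_gt0 _ _ _ _ qc (k :: j :: s) (fun v => (-1) ^+ eta v) u.
have nz : exists2 i, i \in k :: j :: s & (-1) ^+ eta i != 0 :> R.
  by exists k; rewrite ?mem_head // signr_eq0.
move=> /(_ nz); apply/negP; rewrite -leNgt (gram_form_cons qc) big_cons.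
have us : uniq s by case/and3P: u.
rewrite (@gram_sum1 _ _ l) //.
have ujs : uniq (j :: s) by case/andP: u.
have := gram_form_path ujs cp pj.
have akl : adj k l by rewrite /adj ks // eqxx.
have := gram_compat eta k j; have := gram_compat eta k l.
rewrite ckj compatC clk !expr1.
have := gram_norm_ge1 kj; have := gram_norm_ge1 akl.
by rewrite sqrr_sign; lra.
Qed.

(* Assigning [sqrt 2] along a chordless path up to its first multiple edge and
   1 to the end of this edge keeps the form at most 2. *)
Lemma gram_form_multiple u s : uniq (u :: s) -> chordless_path adj (u :: s) ->
  ~~ path (fun a b => C a b * C b a == 1) u s ->
  exists2 y, y u ^+ 2 = 2 & form (u :: s) y <= 2.
Proof.
elim: s u => // v s IH u us cp.
have uvs : uniq (v :: s) by case/andP: us.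
have vu : v != u by apply: contraTneq us => ->; rewrite /= mem_head.
have uvsF w : w \in v :: s -> w == u = false.
  by move=> ws; apply: contraTF us => /eqP <-; rewrite /= ws.
have [auv cv] : adj u v /\ chordless_path adj (v :: s).
  by move: cp => /= /andP[/andP[-> _] ->].
have s2 : Num.sqrt 2 ^+ 2 = 2 :> R by rewrite sqr_sqrtr.
have sg2 : Num.sg (g u v) ^+ 2 = 1.
  by rewrite sqr_sg (gram_eq0 qc) negbK -[C u v != 0]/(adj u v) auv.
have gsg : g u v * Num.sg (g u v) = `|g u v| by rewrite normrEsg mulrC.
rewrite [path _ _ _]/= negb_and; case/orP=> [w1|/(IH v uvs cv)[y yv fy]].
  pose y w := if w == u then Num.sqrt 2 else if w == v then - Num.sg (g u v) else 0.
  exists y; first by rewrite /y eqxx.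
  rewrite gram_path_cons // (@gram_form_eq _ _ _ _ (v :: s) y (fun w => if w == v then - Num.sg (g u v) else 0)); last first.
    by move=> w /uvsF ws; rewrite /y ws.
  rewrite (gram_form_cons qc) eqxx big_seq big1; last first.
    move=> w ws; have : w != v by apply: contraTneq uvs => <-; rewrite /= ws.
    by move/negbTE=> ->; rewrite mulr0.
  have -> : form s (fun w => if w == v then - Num.sg (g u v) else 0) = 0.
    rewrite /gram_form big_seq big1 // => w ws; rewrite big1 // => w' _.
    have : w != v by apply: contraTneq uvs => <-; rewrite /= ws.
    by move/negbTE=> ->; rewrite mulr0 mul0r.
  rewrite {1 2}/y eqxx /y (negbTE vu) eqxx s2 sqrrN sg2.
  have := gram_norm_ge2 auv w1; rewrite -gsg => h.
  have h1 : 2 <= Num.sqrt 2 * `|g u v|.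
    rewrite -(@ler_pXn2r _ 2) ?nnegrE ?mulr_ge0 ?sqrtr_ge0 // exprMn s2.
    by have := gram_norm_ge2 auv w1; lra.
  by rewrite -gsg in h1; nra.
pose y' w := if w == u then - Num.sg (g u v) * y v else y w.
exists y'; first by rewrite /y' eqxx exprMn sqrrN sg2 yv mul1r.
rewrite gram_path_cons // (@gram_form_eq _ _ _ _ (v :: s) y' y); last first.
  by move=> w /uvsF ws; rewrite /y' ws.
rewrite /y' eqxx (negbTE vu) exprMn sqrrN sg2 yv.
have -> : g u v * (- Num.sg (g u v) * y v) * y v = - (g u v * Num.sg (g u v)) * y v ^+ 2.
  by ring.
by rewrite gsg yv; have := gram_norm_ge1 auv; lra.
Qed.

(** Two multiple edges would give a nonpositive vector, as for the affine diagrams with a double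
    edge at each end: the vector of [gram_form_multiple] has value at most 2, and putting a suitable
    sign at [u] adds [2 - 2 sqrt 2 |g_uv|], which is at most -2. *)
Lemma path_one_multiple u v s : uniq (u :: v :: s) ->
  chordless_path adj (u :: v :: s) -> C u v * C v u != 1 ->
  path (fun a b => C a b * C b a == 1) v s.
Proof.
move=> us cp w1; apply/negPn/negP => /gram_form_multiple H.
have uvs : uniq (v :: s) by case/andP: us.
move: (cp) => /= /andP[/andP[auv _] cv].
have [y yv fy] := H uvs cv.
have vu : v != u by apply: contraTneq us => ->; rewrite /= mem_head.
have s2 : Num.sqrt 2 ^+ 2 = 2 :> R by rewrite sqr_sqrtr.
have s20 : Num.sqrt 2 != 0 :> R by rewrite sqrtr_eq0 -ltNge.
have sg2 : Num.sg (g u v) ^+ 2 = 1.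
  by rewrite sqr_sg (gram_eq0 qc) negbK -[C u v != 0]/(adj u v) auv.
have gsg : g u v * Num.sg (g u v) = `|g u v| by rewrite normrEsg mulrC.
pose z w := if w == u then - Num.sg (g u v) * (y v / Num.sqrt 2) else y w.
have z2 : z u ^+ 2 = 1 by rewrite /z eqxx exprMn sqrrN sg2 expr_div_n yv s2; lra.
have : 0 < form (u :: v :: s) z.
  apply: (gram_form_gt0 qc) => //; exists u; first exact: mem_head.
  by apply: contra_eqN z2 => /eqP->; rewrite expr0n /= eq_sym oner_eq0.
apply/negP; rewrite -leNgt gram_path_cons // z2.
rewrite (@gram_form_eq _ _ _ _ (v :: s) z y); last first.
  move=> w ws; rewrite /z; suff -> : w == u = false by [].
  by apply: contraTF us => /eqP <-; rewrite /= ws.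
have -> : g u v * z u * z v = - (`|g u v| * Num.sqrt 2).
  rewrite /z eqxx (negbTE vu) -gsg.
  have -> : g u v * (- Num.sg (g u v) * (y v / Num.sqrt 2)) * y v =
    - (g u v * Num.sg (g u v)) * (y v ^+ 2 / Num.sqrt 2) by ring.
  by rewrite yv -{1}s2 expr2 mulfK // mulNr.
have h1 : 2 <= `|g u v| * Num.sqrt 2.
  rewrite -(@ler_pXn2r _ 2) ?nnegrE ?mulr_ge0 ?sqrtr_ge0 // exprMn s2.
  by have := gram_norm_ge2 auv w1; lra.
lra.
Qed.

End Cycles.

Section Cycles2.
Variables (R : rcfType) (n : nat) (C : 'M[int]_n) (d : 'I_n -> R).
Hypothesis qc : quasi_cartan C d.

Let adj : rel 'I_n := fun i j => C i j != 0.
Local Notation g := (gram C d).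
Local Notation form := (gram_form C d).

Let adjC : symmetric adj. Proof. exact: qc_adjC qc. Qed.

Let ccP k j s : chordless_cycle C (k :: j :: s) <->
  [/\ uniq (k :: j :: s), s != [::], chordless_path adj (j :: s), adj k j &
      {in s, forall v, adj k v = (v == last j s)}].
Proof. exact: chordless_cycleP adjC k j s. Qed.

Lemma qc_wt1 u v : C u v * C v u = 1 -> d u = d v.
Proof.
move=> w1; have /eqP := congr1 absz w1.
rewrite abszM muln_eq1 => /andP[/eqP a1 /eqP b1].
have E : C u v = C v u by move: w1 a1 b1; move: (C u v) (C v u) => a b; nia.
have nz : (C v u)%:~R != 0 :> R by rewrite intr_eq0 -absz_eq0 b1.
by apply: (mulIf nz); rewrite -{1}E (qc_sym qc).
Qed.

(** The larger of the two entries of an edge sits in the row with the smaller [d], so the long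
    vertices of the cycle relations are those of small [d]. *)
Lemma qc_long u v : adj u v -> (`|C v u| < `|C u v|) = (d u < d v).
Proof.
move=> uv; have vu : adj v u by rewrite adjC.
have := congr1 Num.norm (qc_sym qc u v).
rewrite !normrM !(gtr0_norm (qc_gt0 qc _)) -!intr_norm => E.
have p0 : 0 < `|C u v|%:~R :> R by rewrite ltr0z normr_gt0.
have q0 : 0 < `|C v u|%:~R :> R by rewrite ltr0z normr_gt0.
rewrite -(ltr_int R); move: E p0 q0 (qc_gt0 qc u) (qc_gt0 qc v).
move: (_%:~R) (_%:~R) (d u) (d v) => p q x y E p0 q0 x0 y0.
by apply/idP/idP => h; nra.
Qed.

Lemma qc_wt1_path u s : path (fun a b => C a b * C b a == 1) u s ->
  d (last u s) = d u.
Proof.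
elim: s u => //= v s IH u /andP[/eqP/qc_wt1 -> /IH //].
Qed.

(** By [path_one_multiple], all edges after [k j] are simple on the chordless path that leaves out
    the last vertex [i], and so is [k i]. Since [d] differs at [k] and [j], the remaining edge [l i]
    must be multiple. In a cycle of length at least 5, [l, i, k, j] would be a chordless path with
    two multiple edges; hence the cycle is a square. *)
Lemma chordless_cycle_d k j s : chordless_cycle C (k :: j :: s) ->
  (2 <= size s)%N -> d k != d j ->
  exists l i, [/\ s = [:: l; i], d i = d k & d l = d j].
Proof.
case/ccP; case: (lastP s) => // s' i {s}.
rewrite last_rcons -rcons_cons => u _ cp kj ks; rewrite size_rcons ltnS => s1 dkj.
have wkj : C k j * C j k != 1 by apply: contra_neq dkj => /qc_wt1.
move: (u); rewrite -rcons_cons rcons_uniq !inE !negb_or => /andP[/and3P[ik ij is'] u'].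
have cpj : chordless_path adj (j :: s').
  by have := @chordless_path_catl _ adj (j :: s') [:: i]; rewrite cats1; apply.
have cpk : chordless_path adj (k :: j :: s').
  rewrite chordless_path_cons; last by case/andP: u'.
  rewrite cpj andbT; apply/allP => z; rewrite inE; case/orP=> [/eqP->|zs].
    by rewrite kj eqxx.
  rewrite ks ?mem_rcons ?inE ?zs ?orbT //.
  have -> : (z == i) = false by apply: contraNF is' => /eqP <-.
  have -> : (z == j) = false; last by [].
  by apply: contraTF u' => /eqP <-; rewrite /= zs !andbF.
have dl := qc_wt1_path (path_one_multiple qc u' cpk wkj).
have kjs : (k != j) && (k \notin s').
  by move: u'; rewrite /= inE negb_or => /andP[].
have js' : j \notin s' by move: u'; rewrite /= => /and3P[].
have aki : adj k i by rewrite ks ?mem_rcons ?mem_head // eqxx.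
have aji : ~~ adj j i.
  have us : uniq (rcons s' i) by move: u => /and3P[].
  have := @chordless_path_split _ adj [::] j (rcons s' i) i _ cp.
  rewrite mem_rcons mem_head => -> //; last by case/andP: u.
  by case: (s') s1 is' => // x t _; rewrite inE negb_or => /andP[].
have dik : d i = d k.
  suff: path (fun a b => C a b * C b a == 1) k [:: i].
    by move=> /= /andP[/eqP/qc_wt1].
  apply: (@path_one_multiple _ _ _ _ qc j); last by rewrite mulrC.
    by rewrite /= !inE negb_or [j == k]eq_sym [j == i]eq_sym ij [k == i]eq_sym ik;
      case/andP: kjs => ->.
  change (chordless_path adj [:: j; k; i]).
  by rewrite /= [adj j k]adjC kj aki aji.
case: (lastP s') s1 is' js' kjs aji dl u u' cpk cp ks cpj => // s2 l {s'}.
rewrite last_rcons mem_rcons inE negb_or => _ /andP[il is2] js' kjs aji dl u u' cpk cp ks cpj.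
case: s2 is2 js' kjs aji u u' cpk cp ks cpj dl => [|x s2] is2 js' kjs aji u u' cpk cp ks cpj dl.
  by exists l, i.
exfalso; case/andP: kjs => kj' /=; rewrite inE mem_rcons !inE !negb_or => /and3P[kx kl ks2].
have ali : adj l i.
  have ucp : uniq (j :: rcons (rcons (x :: s2) l) i) by case/andP: u.
  have := @chordless_path_split _ adj (j :: x :: s2) l [:: i] i.
  rewrite -cat_rcons cats1 rcons_cons mem_head eqxx => -> //.
have lj : l != j by apply: contraNneq js' => <-; rewrite mem_rcons mem_head.
have lx : l != x.
  by apply: contraTneq u' => <-; rewrite /= mem_rcons mem_head /= !andbF.
have alj : ~~ adj l j.
  have ujl : uniq (j :: rcons (x :: s2) l) by case/andP: u'.
  rewrite adjC; have := @chordless_path_split _ adj [::] j (rcons (x :: s2) l) l ujl cpj.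
  by rewrite mem_rcons mem_head => -> //=.
have alk : ~~ adj l k.
  rewrite adjC ks ?mem_rcons ?inE ?mem_rcons ?inE ?eqxx ?orbT //.
  by rewrite eq_sym.
have wli : C l i * C i l != 1.
  by apply: contra_neq dkj => /qc_wt1; rewrite dl dik => ->.
suff: path (fun a b => C a b * C b a == 1) i [:: k; j].
  by move=> /= /and3P[_ + _]; rewrite (negbTE wkj).
apply: (@path_one_multiple _ _ _ _ qc l) => //.
  by rewrite /= !inE !negb_or [l == i]eq_sym il [l == k]eq_sym kl lj ik ij kj'.
change (chordless_path adj [:: l; i; k; j]).
rewrite /= ali alk alj [adj i k]adjC aki [adj i j]adjC aji.
by rewrite kj.
Qed.

(* With all cycle vertices weighted 1 and [k] weighted [sqrt 2], suitably
   signed, the form is not positive. *)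
Lemma no_double_triangle_on_cycle i j k s :
  chordless_cycle C (i :: j :: s) -> k \notin i :: j :: s ->
  {in s, forall v, ~~ adj k v} ->
  C i j * C j i = 1 -> C k i * C i k = 2 -> C k j * C j k = 2 -> False.
Proof.
move=> cs kijs ks wij wki wkj.
case/ccP: (cs) => u sn cp aij is_.
pose l := last j s.
have ls : l \in s by rewrite /l; case: (s) sn => //= x s' _; apply: mem_last.
have ujs : uniq (j :: s) by case/andP: u.
have us : uniq s by case/andP: ujs.
have [eta _ etaP] := ex_potential C true ujs.
have [ki kj ks'] : [/\ k != i, k != j & k \notin s].
  by move: kijs; rewrite !inE !negb_or => /and3P[].
have [ijn is'] : i != j /\ i \notin s.
  by move: u; rewrite /= inE negb_or => /andP[/andP[]].
have js' : j \notin s by case/andP: ujs.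
have ail : adj i l by rewrite is_ // eqxx.
pose a : R := (-1) ^+ (~~ sign_of (C i l) (+) eta l).
pose b : R := (-1) ^+ eta j.
pose y v : R := if v == i then a else (-1) ^+ eta v.
have ys v : v \in j :: s -> y v = (-1) ^+ eta v.
  move=> vs; rewrite /y; case: (v =P i) vs => // ->.
  by rewrite inE (negbTE ijn) (negbTE is').
have a2 : a ^+ 2 = 1 by rewrite sqrr_sign.
have b2 : b ^+ 2 = 1 by rewrite sqrr_sign.
have fjs : form (j :: s) y <= 2.
  by rewrite (@gram_form_eq _ _ _ _ _ _ _ ys) (gram_form_path qc).
have gil : g i l * a * y l = - `|g i l|.
  rewrite ys ?inE ?ls ?orbT // /a signr_addb mulrA -mulrA -expr2 sqrr_sign mulr1.
  rewrite -(gram_lt0 qc) {1}(realEsign (num_real (g i l))).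
  rewrite mulrAC -signr_addb; case: (g i l < 0); rewrite /= ?expr1 ?expr0; ring.
have yj : y j = b by rewrite ys ?mem_head.
have fijs : form (i :: j :: s) y <= 2 + 2 * (g i j * a * b).
  rewrite (gram_form_cons qc) big_cons yj (@gram_sum1 _ _ _ _ qc _ _ l) //.
  have -> : y i = a by rewrite /y eqxx.
  have := gram_norm_ge1 qc ail.
  have -> : 2 * a * (g i j * b + g i l * y l) = 2 * (g i j * a * b) + 2 * (g i l * a * y l) by ring.
  by rewrite gil a2; lra.
have fpos : 0 < form (i :: j :: s) y.
  apply: (gram_form_gt0 qc) => //; exists i; rewrite ?mem_head // /y eqxx.
  by rewrite signr_eq0.
have gij2 : g i j ^+ 2 = 1 by rewrite (gramM qc) wij.
(* Positivity on the cycle forces the edge [i j] to be incompatible with the chosen signs. *)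
have gab : g i j * a * b = 1.
  have : (g i j * a * b) ^+ 2 = 1 by rewrite 2!exprMn gij2 a2 b2 !mul1r.
  move/eqP; rewrite sqrf_eq1 => /orP[/eqP //|/eqP E].
  by move: fijs; rewrite E; lra.
have [aki akj] : adj k i /\ adj k j.
  split; rewrite /adj.
    by apply: contra_eqN wki => /eqP->; rewrite mul0r.
  by apply: contra_eqN wkj => /eqP->; rewrite mul0r.
have uijk : uniq [:: i; j; k].
  by rewrite /= !inE negb_or ijn ![_ == k]eq_sym ki kj.
have [tr _] := qc_triangle qc uijk aij (etrans (adjC _ _) akj) aki.
have prod_gt0 : 0 < C i j * C j k * C k i.
  by move: tr; rewrite /triangle_ok; have := qc_det3 qc uijk; have [_ ->] := qc_triangle qc uijk aij (etrans (adjC _ _) akj) aki; rewrite eqxx => -> /= /and4P[].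
have h3 : g i j * g j k * g k i = 2.
  have g2 : (C i j * C j k * C k i) ^+ 2 = 4.
    transitivity ((C i j * C j i) * (C j k * C k j) * (C k i * C i k)).
      rewrite expr2 {2}(_ : C i j * C j k * C k i = C j i * C k j * C i k).
        by ring.
      by have [_ ->] := qc_triangle qc uijk aij (etrans (adjC _ _) akj) aki.
    by rewrite wij wki [C j k * _]mulrC wkj.
  rewrite (gramM3 qc) (_ : _ * _ = 2) //.
  move/eqP: g2; rewrite (_ : 4 = 2 ^+ 2) // eqf_sqr => /orP[/eqP //|/eqP E].
  by rewrite E in prod_gt0.
have gki2 : g k i ^+ 2 = 2 by rewrite (gramM qc) wki.
have gkj2 : g k j ^+ 2 = 2 by rewrite (gramM qc) wkj.
(* Once [g_kj b = g_ki a], of square 2, the vertex [k] contributes 4 - 8 on top of at most 4 from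
   the cycle. *)
pose z v : R := if v == k then - (g k i * a) else y v.
have zs v : v \in i :: j :: s -> z v = y v.
  by move=> vs; rewrite /z; case: (v =P k) vs => // ->; rewrite (negbTE kijs).
have : 0 < form (k :: i :: j :: s) z.
  apply: (gram_form_gt0 qc); first by rewrite cons_uniq kijs.
  by exists i; rewrite ?inE ?eqxx ?orbT // zs ?mem_head // /y eqxx signr_eq0.
apply/negP; rewrite -leNgt (gram_form_cons qc) (@gram_form_eq _ _ _ _ _ _ _ zs) !big_cons.
rewrite [X in _ + (_ + X)]big_seq big1 ?addr0; last first.
  move=> v vs; have := gram_eq0 qc k v; rewrite -[C k v != 0]/(adj k v) ks //.
  by move/eqP=> ->; rewrite mul0r.
have -> : z k = - (g k i * a) by rewrite /z eqxx.
rewrite !zs ?mem_head ?inE ?eqxx ?orbT // yj.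
have -> : y i = a by rewrite /y eqxx.
have gkj : g k j * b = g k i * a.
  rewrite [g j k](gramC qc) in h3.
  have E : (g i j * a * b) * (g i j * g k j * g k i) = (g i j) ^+ 2 * (g k j * b) * (g k i * a).
    by ring.
  move: E; rewrite gab h3 gij2 !mul1r => E.
  have E2 : (g k i * a) ^+ 2 = 2 by rewrite exprMn gki2 a2 mulr1.
  have nz : g k i * a != 0 by apply: contra_eqN E2 => /eqP->; rewrite expr0n /= eq_sym pnatr_eq0.
  by apply: (mulIf nz); rewrite -E -expr2 E2.
rewrite gkj sqrrN exprMn gki2 a2.
have E2 : (g k i * a) ^+ 2 = 2 by rewrite exprMn gki2 a2 mulr1.
have -> : 2 * - (g k i * a) * (g k i * a + g k i * a) = - 4 * (g k i * a) ^+ 2 by ring.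
by move: fijs; rewrite E2 gab; lra.
Qed.

End Cycles2.

(** * Mutation of orientations and Cartan counterparts *)

Lemma chordless_cycle_eq n (C C' : 'M[int]_n) s :
  {in s &, forall i j, i != j -> (C i j != 0) = (C' i j != 0)} ->
  chordless_cycle C s -> chordless_cycle C' s.
Proof.
by move=> CC [us s3 cs]; split=> // i j si sj ij; rewrite -CC // cs.
Qed.

(* The Cartan counterpart after mutation at [k], where [I] is the set of
   vertices with an arrow to [k]: the Gram matrix of the basis in which the
   vectors of [I] are reflected in the [k]-th one. *)
Definition cartan_mutation n (k : 'I_n) (I : pred 'I_n) (C : 'M[int]_n) :
    'M[int]_n :=
  \matrix_(i, j) (C i j - if I i (+) I j then C i k * C k j else 0).

(** The new form at [x] is the old one at [y], where [y] differs from [x] only at [k], by the sum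
    [a] of the [C k j * x j] over [j] in [I]. As [k] is not in [I], this substitution is
    invertible. *)
Lemma cartan_mutation_quasi_cartan (R : rcfType) n (C : 'M[int]_n)
    (d : 'I_n -> R) k (I : pred 'I_n) :
  quasi_cartan C d -> ~~ I k -> quasi_cartan (cartan_mutation k I C) d.
Proof.
move=> qc kI; split.
- by move=> i; rewrite mxE addbb subr0 (qc_diag qc).
- exact: qc_gt0 qc.
- move=> i j; rewrite !mxE !rmorphB /= !mulrBr (qc_sym qc i j); congr (_ - _).
  rewrite [I j (+) _]addbC; case: (_ (+) _); rewrite ?mulr0 // !intrM.
  by rewrite mulrA (qc_sym qc i k) mulrAC (qc_sym qc k j); ring.
move=> x [i0 xi0]; pose f j := (C k j)%:~R * x j : R.
pose u j := if I j then f j else 0; pose v j := if I j then 0 else f j.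
pose a := \sum_j u j; pose y i := x i - (if i == k then a else 0).
have fuv j : f j = u j + v j by rewrite /u /v; case: (I j); rewrite ?addr0 ?add0r.
have -> : \sum_i \sum_j d i * (cartan_mutation k I C i j)%:~R * x i * x j =
    \sum_i \sum_j d i * (C i j)%:~R * y i * y j.
  have dE i j : d i * (C i k)%:~R * (C k j)%:~R * x i * x j = d k * (f i * f j).
    by rewrite (qc_sym qc i k) /f; ring.
  transitivity (\sum_i \sum_j d i * (C i j)%:~R * x i * x j -
      d k * (\sum_i \sum_j (u i * v j + v i * u j))).
    rewrite mulr_sumr -sumrB; apply: eq_bigr => i _.
    rewrite mulr_sumr -sumrB; apply: eq_bigr => j _.
    rewrite mxE rmorphB /= mulrBr !mulrBl; congr (_ - _).
    case: ifP => [h|h]; rewrite ?mulr0 ?mul0r /u /v.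
      rewrite intrM !mulrA dE.
      by move: h; case: (I i); case: (I j) => // _; ring.
    by move: h; case: (I i); case: (I j) => // _; rewrite ?(mulr0, mul0r, addr0).
  have -> : \sum_i \sum_j (u i * v j + v i * u j) = 2%:R * a * \sum_j v j.
    transitivity (\sum_i (u i * (\sum_j v j) + v i * a)).
      by apply: eq_bigr => i _; rewrite big_split /= !mulr_sumr.
    by rewrite big_split /= -!mulr_suml -/a; ring.
  have aS : \sum_j f j = a + \sum_j v j.
    by rewrite -big_split /=; apply: eq_bigr => j _.
  have -> : \sum_i \sum_j d i * (C i j)%:~R * y i * y j =
     \sum_i \sum_j (d i * (C i j)%:~R * x i * x j
       - (if j == k then a * (d k * f i) else 0)
       - (if i == k then a * (d k * f j) else 0)
       + (if i == k then if j == k then 2%:R * d k * a ^+ 2 else 0 else 0)).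
    apply: eq_bigr => i _; apply: eq_bigr => j _; rewrite /y.
    case: (i =P k) => [->|_]; case: (j =P k) => [->|_].
    + by rewrite /f (qc_diag qc); ring.
    + by rewrite /f; ring.
    + by rewrite (qc_sym qc i k) /f; ring.
    + by ring.
  rewrite [RHS](eq_bigr (fun i => \sum_j d i * (C i j)%:~R * x i * x j
     - a * (d k * f i) - (if i == k then a * d k * \sum_j f j else 0)
     + (if i == k then 2%:R * d k * a ^+ 2 else 0))); last first.
    move=> i _; rewrite big_split /= !sumrB.
    rewrite -big_mkcond big_pred1_eq; congr (_ - _ + _).
      case: ifP => _; last by rewrite big1.
      by rewrite mulr_sumr; apply: eq_bigr => j _; ring.
    case: ifP => _; last by rewrite big1.
    by rewrite -big_mkcond big_pred1_eq.
  rewrite [RHS]big_split /= !sumrB -!big_mkcond !big_pred1_eq.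
  by rewrite -!mulr_sumr aS; ring.
apply: (qc_pos qc); apply/existsP; apply: contraTT isT => /existsPn y0.
have x0 i : i != k -> x i = 0.
  by move=> ik; have := y0 i; rewrite /y (negbTE ik) subr0 negbK => /eqP.
have a0 : a = 0.
  rewrite /a big1 // => j _; rewrite /u; case: ifP => // Ij.
  by rewrite /f x0 ?mulr0 //; apply: contraNneq kI => <-.
have := y0 k; rewrite /y eqxx a0 subr0 negbK => /eqP xk0.
by move: xi0; case: (eqVneq i0 k) => [->|/x0 ->]; rewrite ?xk0 eqxx.
Qed.

(** The invariant carried along mutations: it holds for Dynkin quivers and is all that the
    construction of the isomorphism uses about the quiver. *)
Record good_orientation (R : rcfType) n (o : rel 'I_n) (C : 'M[int]_n)
    (d : 'I_n -> R) : Prop := GoodOrientation {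
  good_qc : quasi_cartan C d;
  good_arr : forall i j, i != j -> (C i j != 0) = o i j || o j i;
  good_asym : forall i j, o i j -> ~~ o j i;
  good_cycle : forall s, chordless_cycle C s ->
    cycle o s || cycle (fun x y => o y x) s
}.

(** For i -> k -> j the test is the nonvanishing of the mutated entry. An arrow j -> i between such
    vertices either disappears or is reversed. *)
Definition arrow_mutation n (k : 'I_n) (o : rel 'I_n) (C : 'M[int]_n) : rel 'I_n :=
  fun i j => if (i == k) || (j == k) then o j i
  else if o i k && o k j then C i j != C i k * C k j
  else if o j k && o k i then false
  else o i j.

Section Mutation.
Variables (R : rcfType) (n : nat) (o : rel 'I_n) (C : 'M[int]_n) (d : 'I_n -> R).
Hypothesis G : good_orientation o C d.
Variable k : 'I_n.

Let qc := good_qc G.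
Let C' := cartan_mutation k (o^~ k) C.
Let adj : rel 'I_n := fun i j => C i j != 0.
Let adj' : rel 'I_n := fun i j => C' i j != 0.

Lemma good_irr i : o i i = false.
Proof. by apply/negbTE/negP => oi; have := good_asym G oi; rewrite oi. Qed.

Lemma good_arr_neq i j : o i j -> i != j.
Proof. by apply: contraTneq => ->; rewrite good_irr. Qed.

Lemma good_arr_adj i j : o i j -> adj i j.
Proof. by move=> oij; rewrite /adj (good_arr G) ?oij // good_arr_neq. Qed.

Lemma good_arr_adjr i j : o i j -> adj j i.
Proof. by move=> /good_arr_adj; rewrite [adj i j](qc_adjC qc). Qed.

Lemma good_arr_asym i j : o i j -> o j i = false.
Proof. by move=> oij; apply/negbTE/(good_asym G). Qed.

Lemma qc' : quasi_cartan C' d.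
Proof. by apply: cartan_mutation_quasi_cartan => //; rewrite good_irr. Qed.

Lemma mutation_k i : i != k -> C' k i = if o i k then - C k i else C k i.
Proof.
by move=> ik; rewrite mxE good_irr /= (qc_diag qc); case: (o i k); ring.
Qed.

Lemma mutation_rk i : i != k -> C' i k = if o i k then - C i k else C i k.
Proof.
by move=> ik; rewrite mxE good_irr addbF (qc_diag qc); case: (o i k); ring.
Qed.

Lemma mutation_in_out i j : o i k -> o k j -> C' i j = C i j - C i k * C k j.
Proof. by move=> oik okj; rewrite mxE oik (good_arr_asym okj). Qed.

Lemma mutation_out_in i j : o i k -> o k j -> C' j i = C j i - C j k * C k i.
Proof. by move=> oik okj; rewrite mxE oik (good_arr_asym okj). Qed.

Lemma mutation_other i j : i != k -> j != k -> ~~ (o i k && o k j) ->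
  ~~ (o j k && o k i) -> C' i j = C i j.
Proof.
move=> ik jk; rewrite mxE.
have Ck : C k j != 0 -> o k j || o j k by rewrite -(good_arr G) // eq_sym.
have Ci : C i k != 0 -> o i k || o k i by rewrite -(good_arr G).
case: ifP => [|_ _ _]; last by rewrite subr0.
case: (eqVneq (C k j) 0) => [->|/Ck]; first by rewrite mulr0 subr0.
case: (eqVneq (C i k) 0) => [->|/Ci]; first by rewrite mul0r subr0.
by case: (o i k); case: (o j k); case: (o k j); case: (o k i).
Qed.

Lemma mutation_adjk i : adj' k i = adj k i.
Proof.
rewrite /adj' /adj; have [->|ik] := eqVneq i k.
  by rewrite (qc_diag qc') (qc_diag qc).
by rewrite mutation_k //; case: ifP; rewrite ?oppr_eq0.
Qed.

Lemma mutation_adj i j : i != k -> j != k -> ~~ (o i k && o k j) ->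
  ~~ (o j k && o k i) -> adj' i j = adj i j.
Proof. by move=> *; rewrite /adj' mutation_other. Qed.

Lemma mutation_adj_same s : ~~ (has (o^~ k) s && has (o k) s) ->
  {in s &, forall i j, adj' i j = adj i j}.
Proof.
move=> io i j si sj; have [->|ik] := eqVneq i k; first exact: mutation_adjk.
have [->|jk] := eqVneq j k.
  rewrite [adj' i k](qc_adjC qc') [adj i k](qc_adjC qc); exact: mutation_adjk.
have nio u v : u \in s -> v \in s -> ~~ (o u k && o k v).
  move=> su sv; apply: contra io => /andP[uk kv].
  by apply/andP; split; apply/hasP; [exists u|exists v].
by rewrite mutation_adj ?nio.
Qed.

Lemma mutation_cycle_same s : ~~ (has (o^~ k) s && has (o k) s) ->
  chordless_cycle C' s <-> chordless_cycle C s.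
Proof.
move=> /mutation_adj_same H; split; apply: chordless_cycle_eq => i j si sj _.
  exact: H.
by rewrite -[RHS]/(adj' i j) H.
Qed.

Lemma in_out_triangle i j : o i k -> o k j -> adj i j ->
  [/\ o j i, uniq [:: i; j; k], adj j k, adj k i & chordless_cycle C [:: k; j; i]].
Proof.
move=> oik okj aij; have ij : i != j.
  by apply: contraTneq oik => ->; rewrite (good_arr_asym okj).
have [ik kj] := (good_arr_neq oik, good_arr_neq okj).
have u : uniq [:: i; j; k] by rewrite /= !inE negb_or ij ik eq_sym kj.
have ccc : chordless_cycle C [:: k; j; i].
  apply/(chordless_cycleP (qc_adjC qc)); split=> //=.
  - by rewrite !inE negb_or kj eq_sym ik eq_sym ij.
  - by rewrite -[_ != 0]/(adj j i) [adj j i](qc_adjC qc) [C i j != 0]aij.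
  - exact: good_arr_adj.
  - by move=> v; rewrite inE => /eqP->; rewrite eqxx; apply: good_arr_adjr.
split=> //; [|exact: good_arr_adjr|exact: good_arr_adjr].
have := good_cycle G ccc; rewrite /= !andbT.
by case/orP=> /and3P[] //; rewrite (good_arr_asym okj).
Qed.

(** Read off from [triangle_ok]. An edge that persists between an in- and an out-neighbour of [k] is
    simple, and then both edges at [k] are double. *)
Lemma in_out_ok i j : o i k -> o k j -> adj i j ->
  [/\ 0 < C i j * C j k * C k i,
   `|C i j| <= `|C i k * C k j| &
   adj' i j -> [/\ C i j * C j i = 1, C k i * C i k = 2 & C k j * C j k = 2]].
Proof.
move=> oik okj aij; have [_ u ajk aki _] := in_out_triangle oik okj aij.
have [tr E] := qc_triangle qc u aij ajk aki.
move: tr; rewrite /triangle_ok E eqxx -E (qc_det3 qc u) => /and4P[-> -> + _].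
move=> /implyP H; split=> //; rewrite /adj' mutation_in_out // subr_eq0 => /H.
have w1 := qc_wt_gt0 qc aij; have w2 := qc_wt_gt0 qc ajk.
have w3 := qc_wt_gt0 qc aki.
have absM (a b : int) : 0 < a * b -> a * b = `|a| * `|b|.
  by move=> ab; rewrite -normrM gtr0_norm.
rewrite (absM _ _ w1) (absM _ _ w3) [C k j * _]mulrC (absM _ _ w2).
by case/orP=> /and5P[/eqP-> /eqP-> /eqP-> /eqP-> /andP[/eqP-> /eqP->]].
Qed.

End Mutation.

(** * Chordless cycles before and after a mutation *)

Lemma next_nth_mod (T : eqType) (x0 : T) s a : uniq s -> (a < size s)%N ->
  next s (nth x0 s a) = nth x0 s (a.+1 %% size s).
Proof.
move=> us sa; rewrite next_nth mem_nth //; case: s us sa => // y s us sa.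
rewrite index_uniq //; move: (sa); rewrite /= ltnS leq_eqVlt => /orP[/eqP E|lt].
  by rewrite E modnn /= nth_default.
by rewrite modn_small //=; apply: set_nth_default.
Qed.

Lemma nth_mod_eq (T : eqType) (x0 : T) s a b : uniq s -> (0 < size s)%N ->
  (nth x0 s (a %% size s) == nth x0 s (b %% size s)) = (a == b %[mod size s]).
Proof. by move=> us s0; rewrite nth_uniq ?ltn_mod. Qed.

Section MutationCycles.
Variables (R : rcfType) (n : nat) (o : rel 'I_n) (C : 'M[int]_n) (d : 'I_n -> R).
Hypothesis G : good_orientation o C d.
Variable k : 'I_n.

Let qc := good_qc G.
Let C' := cartan_mutation k (o^~ k) C.
Let adj : rel 'I_n := fun i j => C i j != 0.
Let adj' : rel 'I_n := fun i j => C' i j != 0.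
Let qc1 : quasi_cartan C' d. Proof. exact: qc' G k. Qed.
Let adjC : symmetric adj. Proof. exact: qc_adjC qc. Qed.
Let adjC' : symmetric adj'. Proof. exact: qc_adjC qc1. Qed.

Let ccP j i s : chordless_cycle C (j :: i :: s) <->
  [/\ uniq (j :: i :: s), s != [::], chordless_path adj (i :: s), adj j i &
      {in s, forall v, adj j v = (v == last i s)}].
Proof. exact: chordless_cycleP adjC j i s. Qed.

Let ccP' j i s : chordless_cycle C' (j :: i :: s) <->
  [/\ uniq (j :: i :: s), s != [::], chordless_path adj' (i :: s), adj' j i &
      {in s, forall v, adj' j v = (v == last i s)}].
Proof. exact: chordless_cycleP adjC' j i s. Qed.

Let adjk i : adj' k i = adj k i. Proof. exact: mutation_adjk G k i. Qed.

Lemma not_adj_arr i : i != k -> ~~ adj' k i -> (o i k = false) * (o k i = false).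
Proof.
move=> ik; rewrite adjk /adj (good_arr G) 1?eq_sym // negb_or.
by case/andP=> /negbTE-> /negbTE->.
Qed.

(** The two neighbours of [k] on a cycle of length at least 4 are not adjacent in [C']. As exactly
    one of them is an in-neighbour, the vanishing of their mutated entry says that the old entry is
    the product of those at [k], hence nonzero: in [C] this edge closes the cycle without [k]. *)
Lemma mutation_cycle_delete j s : chordless_cycle C' (k :: j :: s) ->
  (2 <= size s)%N -> o j k (+) o (last j s) k ->
  chordless_cycle C (j :: s) /\ C j (last j s) = C j k * C k (last j s).
Proof.
move=> /ccP'[u sn cp kj ks] s2 io; pose i := last j s.
have is_ : i \in s by rewrite /i; case: (s) sn => //= y t _; apply: mem_last.
have ki : adj' k i by rewrite ks.
have [kjn kin] : k != j /\ k != i.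
  move: u; rewrite cons_uniq inE negb_or => /andP[/andP[-> ks'] _].
  by split=> //; apply: contraNneq ks' => ->.
have nk v : v \in s -> v != i -> (o v k = false) * (o k v = false).
  move=> vs vi; apply: not_adj_arr; last by rewrite ks.
  by apply: contraTneq u => vk; rewrite /= -vk inE vs orbT.
have adj_s : {in s &, forall v w, adj' v w = adj v w}.
  apply: (mutation_adj_same G); apply/negP => /andP[/hasP[v vs ov] /hasP[w ws ow]].
  have vi : v = i by apply/eqP; apply: contraTT ov => /(nk _ vs) ->.
  have wi : w = i by apply/eqP; apply: contraTT ow => /(nk _ ws) ->.
  by move: ov; rewrite vi -wi (good_arr_asym G ow).
have cps : chordless_path adj s.
  by rewrite -(eq_in_chordless_path adj_s); case: (s) cp => //= y t /andP[].
have us : uniq s by case/and3P: u.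
have ji : adj' j i = false.
  have ujs : uniq (j :: s) by case/andP: u.
  have := @chordless_path_split _ adj' [::] j s i ujs cp is_; move=> ->.
  rewrite /i; case: (s) s2 us => //= y [//|z t] _ /andP[yzt _].
  by apply/negbTE; apply: contraNneq yzt => /= <-; rewrite mem_last.
have Cji : C j i = C j k * C k i.
  by move/negbFE: ji; rewrite mxE io subr_eq0 => /eqP.
split=> //; have iE : last j s = i by []; clearbody i; clear io.
case: s s2 us u sn cp ks is_ nk adj_s cps iE => // y t s2 us u sn cp ks is_ nk adj_s cps /= iE.
have jk v : v != i -> v \in y :: t -> adj j v = adj' j v.
  move=> vi vs; have vk : v != k.
    by apply: contraTneq u => vk; rewrite cons_uniq inE -vk vs orbT.
  have jnk : j != k by rewrite eq_sym.
  rewrite /adj' (mutation_other G jnk vk) //.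
  - by rewrite (nk _ vs vi).2 andbF.
  - by rewrite (nk _ vs vi).1.
have ujs : uniq (j :: y :: t) by case/andP: u.
have adjj v : v \in y :: t -> adj' j v = (v == y).
  by move=> vs; have := @chordless_path_split _ adj' [::] j (y :: t) v ujs cp vs.
have yt : y \notin t by case/andP: us.
have it : i \in t by rewrite -iE; case: (t) s2 => //= z t' _; apply: mem_last.
have iy : i != y by apply: contraNneq yt => <-.
apply/ccP; split=> //.
- by case: (t) s2.
- by rewrite jk ?mem_head 1?eq_sym // adjj ?mem_head // eqxx.
- move=> v vt; have vy : v != y by apply: contraNneq yt => <-.
  case: (v =P last y t) => [->|/eqP vi].
    have [kj1 ki1] : adj k j /\ adj k i by rewrite -!adjk.
    by rewrite /adj iE Cji mulf_neq0 ?eqxx //; rewrite -/(adj j k) adjC.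
  have vyt : v \in y :: t by rewrite inE vt orbT.
  by rewrite (jk v) -?iE // adjj // (negbTE vy).
Qed.

Let in_nb v : o v k -> adj' k v.
Proof. by move=> /(good_arr_adjr G); rewrite adjk. Qed.

Let out_nb v : o k v -> adj' k v.
Proof. by move=> /(good_arr_adj G); rewrite adjk. Qed.

Section Avoiding.
Variable P : seq 'I_n.
Hypotheses (cP : chordless_cycle C' P) (kP : k \notin P).
Let p := size P.
(** The vertices of [P] are numbered periodically by all natural numbers, so that arcs may pass
    through the starting point. *)
Let x (q : nat) := nth k P (q %% p).

Let p3 : (3 <= p)%N. Proof. by case: cP. Qed.
Let p0 : (0 < p)%N. Proof. exact: leq_trans p3. Qed.
Let uP : uniq P. Proof. by case: cP. Qed.
Let xP q : x q \in P. Proof. by rewrite mem_nth // ltn_mod. Qed.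
Let xk q : x q != k. Proof. by apply: contraNneq kP => <-. Qed.
Let x_period q : x (q + p) = x q. Proof. by rewrite /x modnDr. Qed.

Let x_eq q q' : (q < q' < q + p)%N -> (x q == x q') = false.
Proof.
move=> /andP[qq' q'p]; rewrite /x nth_mod_eq //; apply/negbTE.
rewrite -(subnKC (ltnW qq')) -[q in q == _ %[mod _]]addn0 eqn_modDl mod0n.
by rewrite -/p modn_small; lia.
Qed.

Let x_adj q q' : (q < q' < q + p)%N ->
  adj' (x q) (x q') = (q' == q.+1) || (q'.+1 == (q + p)%N).
Proof.
move=> qq'p; have /andP[qq' q'p] := qq'p.
rewrite /adj'; have [_ _ ->] := cP; rewrite ?xP ?x_eq //.
rewrite /x !next_nth_mod ?ltn_mod //.
have modS a : (a %% p).+1 = a.+1 %[mod p] by rewrite -addn1 modnDml addn1.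
rewrite !nth_mod_eq // -/p; congr (_ || _).
  rewrite modS -(subnKC (ltnW qq')) -addn1 eqn_modDl eqn_add2l.
  by rewrite !modn_small //; lia.
rewrite modS -(subnKC (ltnW qq')) -addnS -[q in q == _ %[mod _]]addn0 eqn_modDl.
rewrite mod0n eqn_add2l; case: (ltngtP (q' - q).+1 p) => h; last 1 first.
- by rewrite h modnn eqxx.
- by rewrite modn_small //; lia.
- lia.
Qed.

Let arc a m := [seq x q | q <- iota a m.+1].

Let arc_cons a m : arc a m = x a :: [seq x q | q <- iota a.+1 m].
Proof. by []. Qed.

Let arc_uniq a m : (m < p)%N -> uniq (arc a m).
Proof.
move=> mp; rewrite map_inj_in_uniq ?iota_uniq // => q q'.
rewrite !mem_iota => h h' /eqP; case: (ltngtP q q') => // lt.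
  by rewrite x_eq //; lia.
by rewrite eq_sym x_eq //; lia.
Qed.

Let arc_last a m : last (x a) [seq x q | q <- iota a.+1 m] = x (a + m)%N.
Proof.
by rewrite last_map; congr x; elim: m a => [|m IH] a; rewrite ?addn0 //= IH addSnnS.
Qed.

Let arc_path a m : (m.+2 <= p)%N -> chordless_path adj' (arc a m).
Proof.
elim: m a => // m IH a mp; rewrite arc_cons [map _ _]arc_cons.
rewrite chordless_path_cons; last by apply: arc_uniq; lia.
rewrite -arc_cons IH ?andbT; last by lia.
apply/allP => _ /mapP[q + ->]; rewrite mem_iota => h.
rewrite x_adj; last by lia.
have [->|qa] := eqVneq q a.+1; first by rewrite !eqxx.
rewrite (_ : (q.+1 == _) = false) /=; last by lia.
by rewrite [x q == _]eq_sym x_eq //; lia.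
Qed.

(** An arc of [P] between consecutive neighbours of [k], which closes through [k] to a chordless
    cycle. The bound [m.+2 <= p] keeps its ends from being joined by the rest of [P]. *)
Definition clear_arc a m := [/\ (0 < m)%N, (m.+2 <= p)%N, adj' k (x a),
  adj' k (x (a + m)) & forall q, (a < q < a + m)%N -> ~~ adj' k (x q)].

Let arc_cycle a m : clear_arc a m -> chordless_cycle C' (k :: arc a m).
Proof.
case=> m0 mp ka kam kq; rewrite arc_cons; apply/ccP'; split=> //.
- rewrite cons_uniq arc_uniq ?andbT; last by lia.
  by rewrite -arc_cons; apply/negP => /mapP[q _ E]; have := xk q; rewrite -E eqxx.
- by rewrite -size_eq0 size_map size_iota -lt0n.
- exact: arc_path.
rewrite arc_last => _ /mapP[q + ->]; rewrite mem_iota => h.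
have [->|qa] := eqVneq q (a + m)%N; first by rewrite kam eqxx.
by rewrite x_eq; [apply/negbTE/kq|]; lia.
Qed.

(** Signs propagated along [P] so that every step is compatible. By parity one full turn reverses
    them ([theta_p]). *)
Fixpoint theta q := if q is q'.+1 then
  ~~ (sign_of (C' (x q') (x q)) (+) theta q') else false.

Let arc_compat a m (eta : 'I_n -> bool) :
  (forall t, (t <= m)%N -> eta (x (a + t)) = theta (a + t)) ->
  path (compat C' eta) (x a) [seq x q | q <- iota a.+1 m].
Proof.
elim: m a => // m IH a eE /=.
have e0 := eE 0 (leq0n _); have e1 := eE 1 (ltn0Sn _); rewrite addn0 in e0.
rewrite addn1 in e1; rewrite {1}/compat e0 e1 /=.
rewrite (IH a.+1) => [|t tm]; last by rewrite addSnnS eE.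
by rewrite andbT; case: (sign_of _); case: (theta a).
Qed.

Let arc_index a m t : (m < p)%N -> (t <= m)%N -> index (x (a + t)) (arc a m) = t.
Proof.
move=> mp tm; have -> : x (a + t) = nth k (arc a m) t.
  by rewrite (nth_map 0) ?size_iota // nth_iota.
by rewrite index_uniq ?arc_uniq // size_map size_iota.
Qed.

Let gamma q := sign_of (C' k (x q)) (+) theta q.

Let arc_parity a m : clear_arc a m -> gamma a != gamma (a + m).
Proof.
move=> am; have cc := arc_cycle am; have [m0 mp _ _ _] := am.
pose ek := ~~ (sign_of (C' k (x a)) (+) theta a).
pose eta v := if v == k then ek else theta (a + index v (arc a m)).
have etaE t : (t <= m)%N -> eta (x (a + t)) = theta (a + t).
  by move=> tm; rewrite /eta (negbTE (xk _)) arc_index //; lia.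
have := chordless_cycle_parity qc1 (eta := eta) cc.
rewrite arc_last /= (arc_compat etaE) andbT /compat.
have := etaE 0 (leq0n _); rewrite addn0 => ->; rewrite etaE //.
rewrite {1}/eta eqxx /ek [sign_of (C' (x (a + m)) k)](qc_sign qc1) /gamma /eta eqxx /ek.
by do 2!case: (sign_of _); do 2!case: (theta _) => //=; apply.
Qed.

Let theta_p : theta p.
Proof.
have PE : P = arc 0 p.-1.
  have sz : size (arc 0 p.-1) = p by rewrite size_map size_iota prednK.
  apply: (@eq_from_nth _ k); rewrite ?sz // => q qp.
  by rewrite (nth_map 0) ?size_iota ?prednK // nth_iota ?prednK // add0n /x modn_small.
pose eta v := theta (index v P).
have etaE t : (t <= p.-1)%N -> eta (x (0 + t)) = theta (0 + t).
  by move=> tm; rewrite /eta PE arc_index ?add0n // prednK.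
have cc : chordless_cycle C' (arc 0 p.-1) by rewrite -PE.
move: cc; have := arc_last 0 p.-1; have := arc_compat etaE.
rewrite arc_cons; case: (p.-1) (prednK p0) etaE => [|m] pE etaE; first by lia.
move=> pth lst cc; have := chordless_cycle_parity qc1 (eta := eta) cc pth.
rewrite [last _ _]lst /compat etaE // (etaE 0) // add0n => h.
rewrite -pE /=; rewrite -[m.+2]add0n pE x_period; move: h.
by rewrite /= addbF.
Qed.

(** With both ends on the same side of [k], the cycle through [k] would already be chordless in [C],
    hence cyclically oriented, with one arrow into [k] and one out of it. *)
Let arc_label a m : clear_arc a m -> o (x a) k != o (x (a + m)) k.
Proof.
move=> am; have cc := arc_cycle am; have [m0 mp ka kam kq] := am.
apply/negP => /eqP lab.
have nb q : adj' k (x q) -> o k (x q) = ~~ o (x q) k.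
  rewrite adjk /adj (good_arr G) 1?eq_sym // => /orP[okx|oxk].
    by rewrite okx (good_arr_asym G okx).
  by rewrite oxk (good_arr_asym G oxk).
have : ~~ (has (o^~ k) (k :: arc a m) && has (o k) (k :: arc a m)).
  rewrite [has _ _]/= [X in _ && X]/= !(good_irr G) /=.
  have H q : q \in iota a.+1 m ->
      ((o (x q) k == false) && (o k (x q) == false)) || (o (x q) k == o (x a) k) && (o k (x q) == ~~ o (x a) k).
    rewrite mem_iota => h; have [->|qa] := eqVneq q (a + m)%N.
      by rewrite lab (nb _ kam) !eqxx orbT.
    have := kq q; rewrite (_ : (_ < _ < _)%N = true); last by lia.
    by move=> /(_ isT) /(not_adj_arr (xk q)) [-> ->].
  rewrite (nb a ka); case oa: (o (x a) k) H => H /=.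
    apply/negP => /hasP[_ /mapP[q /H qP ->]].
    by move: qP; case: (o (x q) k); case: (o k (x q)).
  rewrite andbT; apply/negP => /hasP[_ /mapP[q /H qP ->]].
  by move: qP; case: (o (x q) k); case: (o k (x q)).
move=> /(mutation_cycle_same G)/(fun h => proj1 h cc).
move/(good_cycle G); rewrite arc_cons /= !rcons_path !arc_last !nb //.
by rewrite -lab; case: (o (x a) k); rewrite ?andbF.
Qed.

Let mem_x v : v \in P -> exists2 q, (q < p)%N & v = x q.
Proof.
move=> vP; exists (index v P); first by rewrite index_mem.
by rewrite /x modn_small ?index_mem // nth_index.
Qed.

(** Along a clear arc both [gamma] (by parity) and the direction of the arrow at [k] (by
    [arc_label]) change, so their sum [tau] does not; but one turn around [P] changes [theta], hence
    [tau]. So some arc between consecutive neighbours of [k] is not clear. As [k] has at least two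
    neighbours on [P], this arc covers all of [P] but one edge. Since [x 0] is a neighbour, the edge
    starts or ends there, whence [m <= 1]. *)
Lemma cycle_two_neighbours : adj' k (x 0) -> has (o^~ k) P -> has (o k) P ->
  exists2 m, (m <= 1)%N & [/\ adj' k (x m), adj' k (x (m + p.-1)) &
    forall q, (m < q < m + p.-1)%N -> ~~ adj' k (x q)].
Proof.
move=> nb0 /hasP[vi viP oi] /hasP[vj vjP oj].
pose nb q := adj' k (x q).
have nbp : nb p by rewrite /nb -[p]add0n x_period.
have [/andP[n1 /allP n2]|not0] :=
  boolP (nb p.-1 && all (fun q => ~~ nb q) (iota 1 p.-2)).
  exists 0 => //; split=> // q qp; apply: n2; rewrite mem_iota; clear -qp p3; lia.
have [/andP[n1 /allP n2]|not1] :=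
  boolP (nb 1 && all (fun q => ~~ nb q) (iota 2 p.-2)).
  exists 1 => //; split=> //; first by rewrite add1n prednK.
  by move=> q qp; apply: n2; rewrite mem_iota; clear -qp p3; lia.
exfalso; pose tau q := gamma q (+) o (x q) k.
have prev b : (0 < b)%N -> exists2 a, (a < b)%N &
    nb a /\ forall q, (a < q < b)%N -> ~~ nb q.
  elim: b => // b IH _; have [nbb|nnb] := boolP (nb b).
    by exists b => //; split=> // q; rewrite ltnS => /andP[/ltn_geF->].
  case: b IH nnb => [|b] IH nnb; first by rewrite /nb nb0 in nnb.
  have [a ab [na nq]] := IH isT; exists a; first by clear -ab; lia.
  split=> // q qb; have [->//|qnb] := eqVneq q b.+1; apply: nq; clear -qb qnb; lia.
have tauE b : (b <= p)%N -> nb b -> tau b = tau 0.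
  elim/ltn_ind: b => -[//|b] IH bp nbb.
  have [a ab [na nq]] := prev b.+1 isT.
  rewrite -(IH a) //; last by clear -ab bp; lia.
  have [far|near] := leqP p (b.+1 - a).+1.
    have ab1 : (a = 0 /\ b.+1 = p.-1) \/ (a = 1 /\ b.+1 = p) \/ (a = 0 /\ b.+1 = p).
      by clear -far ab bp p3; lia.
    case: ab1 => [[a0 bE]|[[a1 bE]|[a0 bE]]].
    - case/negP: not0; rewrite -bE nbb; apply/allP => q; rewrite mem_iota => h.
      by apply: nq; clear -h a0 bE p3; lia.
    - case/negP: not1; rewrite -a1 na; apply/allP => q; rewrite mem_iota => h.
      by apply: nq; clear -h a1 bE p3; lia.
    have only0 v : v \in P -> adj' k v -> v = x 0.
      move=> /mem_x[q qp ->] nbq; have [->//|q0] := eqVneq q 0.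
      by exfalso; move: nbq; apply/negP/nq; clear -qp q0 a0 bE; lia.
    have := good_asym G oi.
    by rewrite (only0 _ viP (in_nb oi)) -(only0 _ vjP (out_nb oj)) oj.
  have am : clear_arc a (b.+1 - a).
    by split; rewrite ?subnKC ?(ltnW ab) //; clear -near ab; lia.
  have := arc_parity am; have := arc_label am; rewrite /tau subnKC 1?ltnW //.
  by case: (gamma a); case: (gamma b.+1); case: (o (x a) k); case: (o (x b.+1) k).
have := tauE p (leqnn p) nbp; rewrite /tau /gamma -[p in x p]add0n x_period.
by rewrite theta_p /=; case: (sign_of _); case: (o _ k).
Qed.

Lemma rot_arc m : (m <= 1)%N -> rot m P = arc m p.-1.
Proof.
have PE : P = arc 0 p.-1.
  have sz : size (arc 0 p.-1) = p by rewrite size_map size_iota prednK.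
  apply: (@eq_from_nth _ k); rewrite ?sz // => q qp.
  by rewrite (nth_map 0) ?size_iota ?prednK // nth_iota ?prednK // add0n /x modn_small.
case: m => [|[|//]] _; first by rewrite rot0.
rewrite PE arc_cons rot1_cons /arc -[p.-1.+1]addn1 iotaD map_cat cats1.
by rewrite add1n prednK // -[p in iota p]add0n /= -[p]add0n x_period.
Qed.

End Avoiding.

(** By [cycle_two_neighbours] the neighbours of [k] on [P] are the ends of one edge. Had this edge
    been present in [C], [P] would be chordless there, and the weights given by [in_out_ok] would
    contradict [no_double_triangle_on_cycle]. So the mutation creates the edge, and in [C] the cycle
    makes a detour through [k] instead. *)
Lemma mutation_cycle_avoid P : chordless_cycle C' P -> k \notin P ->
  has (o^~ k) P -> has (o k) P -> exists m i s, [/\ rot m P = i :: s,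
    o i k && o k (last i s) || o k i && o (last i s) k,
    C i (last i s) = 0 & chordless_cycle C (k :: i :: s)].
Proof.
move=> cP kP hin hout; have /hasP[v vP ov] := hin.
have kv : adj' k v by rewrite adjk; exact: (good_arr_adjr G ov).
pose P1 := rot (index v P) P.
have P1E : nth k P1 0 = v.
  by rewrite nth0 /P1 /rot (drop_nth k) ?index_mem //= nth_index.
have cP1 : chordless_cycle C' P1 by apply: chordless_cycle_rot.
have kP1 : k \notin P1 by rewrite mem_rot.
have hin1 : has (o^~ k) P1 by rewrite has_rot.
have hout1 : has (o k) P1 by rewrite has_rot.
have p3 : (3 <= size P1)%N by case: cP1.
have [|m m1 [km kl kq]] := cycle_two_neighbours cP1 kP1 _ hin1 hout1.
  by rewrite mod0n P1E.
pose x q := nth k P1 (q %% size P1).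
pose i := x m; pose s := [seq x q | q <- iota m.+1 (size P1).-1].
have P2E : rot m P1 = i :: s by rewrite (rot_arc cP1 m1).
have sP : size P1 = size P by rewrite size_rot.
have [M PM] : exists M, rot M P = i :: s.
  rewrite -P2E /P1 rot_add_mod ?index_size //; first by eexists.
  by rewrite (leq_trans m1) // -sP ltnW // ltnW.
have cP2 : chordless_cycle C' (i :: s) by rewrite -P2E; apply: chordless_cycle_rot.
have uP2 : uniq (i :: s) by case: cP2.
have sz : size s = (size P1).-1 by rewrite size_map size_iota.
have lE : last i s = x (m + (size P1).-1)%N.
  rewrite /i /s last_map; congr x; move: (_.-1) => N.
  by elim: N (m) => [|N IH] q; rewrite ?addn0 //= IH addSnnS.
pose l := last i s.
have ls : l \in s.
  by rewrite /l lE; apply/map_f; rewrite mem_iota; clear -p3; lia.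
have nkl u : u \in s -> u != l -> ~~ adj' k u.
  move=> /mapP[q + ->]; rewrite mem_iota => h ul.
  apply: kq; have qN : q != (m + (size P1).-1)%N.
    by apply: contraNneq ul => ->; rewrite /l lE.
  by clear -h qN; lia.
have memP2 u : (u \in i :: s) = (u \in P) by rewrite -PM mem_rot.
have uk u : u \in i :: s -> u != k.
  by rewrite memP2 => uP; apply: contraNneq kP => <-.
have nio u : u \in i :: s -> (o u k || o k u) -> (u == i) || (u == l).
  move=> us; rewrite -(good_arr G) ?uk // -[C u k != 0]/(adj u k) adjC -adjk.
  move: us; rewrite inE; case: eqP => //= _ us; apply: contraTT; exact: nkl.
have io : o i k && o k l || o k i && o l k.
  have /hasP[w wP ow] := hout.
  have iv : (v == i) || (v == l) by rewrite nio ?memP2 // ov.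
  have iw : (w == i) || (w == l) by rewrite nio ?memP2 // ow orbT.
  move: ov ow; case/orP: iv => /eqP->; case/orP: iw => /eqP-> ov' ow'.
  - by rewrite (good_arr_asym G ov') in ow'.
  - by rewrite ov' ow'.
  - by rewrite ov' ow' orbT.
  - by rewrite (good_arr_asym G ov') in ow'.
have il : i != l by apply: contraTneq uP2 => ->; rewrite /= ls.
have adj_il : adj' i l.
  rewrite adjC'; have : chordless_cycle C' (rcons s i).
    by rewrite -cats1; apply: chordless_cycle_cat.
  have : chordless_cycle C' (rev (rcons s i)).
    by apply: chordless_cycle_rev; rewrite -cats1; apply: chordless_cycle_cat.
  rewrite rev_rcons => + _; rewrite /l.
  case/lastP: (s) ls => // t y _; rewrite last_rcons rev_rcons.
  by case/ccP' => _ _ _ + _; rewrite adjC'.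
have adj_eq u w : u \in i :: s -> w \in i :: s ->
    ~~ ((u == i) && (w == l) || (u == l) && (w == i)) -> adj u w = adj' u w.
  move=> us ws uw; rewrite /adj' (mutation_other G) ?uk //.
    apply: contra uw => /andP[ou ow].
    have := nio u us; rewrite ou => /(_ isT) /orP[] /eqP E1;
    have := nio w ws; rewrite ow orbT => /(_ isT) /orP[] /eqP E2;
    rewrite E1 E2 !eqxx ?orbT //; move: ou ow; rewrite E1 E2 => ou;
    by rewrite (good_arr_asym G ou).
  apply: contra uw => /andP[ou ow].
  have := nio u us; rewrite ow orbT => /(_ isT) /orP[] /eqP E1;
  have := nio w ws; rewrite ou => /(_ isT) /orP[] /eqP E2;
  rewrite E1 E2 !eqxx ?orbT //; move: ou ow; rewrite E1 E2 => ou;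
  by rewrite (good_arr_asym G ou).
have Cil : C i l = 0.
  apply/eqP; apply: contraTT isT => Cil0.
  have Cil1 : C l i != 0 by rewrite -[_ != 0]/(adj l i) adjC.
  have cC : chordless_cycle C (i :: s).
    apply: chordless_cycle_eq cP2 => u w us ws uw.
    have [|nil] := boolP ((u == i) && (w == l) || (u == l) && (w == i)).
      case/orP=> /andP[/eqP-> /eqP->]; first by rewrite Cil0 [_ != 0]adj_il.
      by rewrite Cil1 -[C' l i != 0]/(adj' l i) adjC' adj_il.
    by rewrite -[LHS]/(adj' u w) -adj_eq.
  have [w1 w2 w3] : [/\ C i l * C l i = 1, C k i * C i k = 2 & C k l * C l k = 2].
    case/orP: io => /andP[o1 o2].
      by have [_ _ /(_ adj_il)] := in_out_ok G o1 o2 Cil0.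
    have [_ _ H] := in_out_ok G o2 o1 Cil1.
    have [] : [/\ C l i * C i l = 1, C k l * C l k = 2 & C k i * C i k = 2].
      by apply: H; rewrite -[_ != 0]/(adj' l i) adjC'.
    by rewrite mulrC.
  have [t sE] : exists t, s = rcons t l.
    by rewrite /l; case/lastP: (s) ls => // t y _; rewrite last_rcons; exists t.
  have cl : chordless_cycle C (l :: i :: t).
    by rewrite -[l :: _]cat1s; apply: chordless_cycle_cat; rewrite cats1 rcons_cons -sE.
  have mt u : (u \in l :: i :: t) = (u \in i :: s).
    by rewrite sE -rcons_cons mem_rcons.
  have ut : uniq (i :: rcons t l) by rewrite -sE.
  case: (no_double_triangle_on_cycle qc cl (k := k)) => //.
  - by rewrite mt memP2.
  - move=> u ut'; rewrite -[_ != 0]/(adj k u) -adjk; apply: nkl.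
      by rewrite sE mem_rcons inE ut' orbT.
    by apply: contraTneq ut => <-; rewrite /= rcons_uniq ut' andbF.
  - by rewrite mulrC.
exists M, i, s; split=> //.
have s2 : (2 <= size s)%N by rewrite sz -ltnS prednK // (leq_trans _ p3).
have lD : last i s = l by []; clearbody l; clear lE sz P2E PM kq kl km.
clearbody s i; have nks u : u \in s -> adj' k u = (u == l).
  move=> us; have [->|ul] := eqVneq u l; last exact/negbTE/nkl.
  by rewrite adjk; case/orP: io => /andP[o1 o2];
    [apply: (good_arr_adj G o2)|apply: (good_arr_adjr G o2)].
case: s s2 lD cP2 uP2 ls nkl memP2 uk nio adj_eq nks => // z [//|y t] _ lD cP2
  uP2 ls nkl memP2 uk nio adj_eq nks.
have /ccP'[u2 _ cp2 iz is_] := cP2.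
have zl : z != l.
  by apply: contraTneq uP2 => ->; rewrite -lD /= mem_last /= !andbF.
have usz : uniq (z :: y :: t) by case/andP: uP2.
have nis u : u \in z :: y :: t -> (u == i) = false.
  by move=> us; apply: contraTF uP2 => /eqP <-; rewrite cons_uniq us.
apply/ccP; split.
- rewrite cons_uniq uP2 andbT; apply/negP => kis; by have := uk k kis; rewrite eqxx.
- by [].
- have cps : chordless_path adj (z :: y :: t).
    rewrite (@eq_in_chordless_path _ adj adj') // => u w us ws.
    by rewrite adj_eq ?inE ?(nis u us) ?(nis w ws) ?andbF // -?in_cons ?us ?ws ?orbT.
  rewrite chordless_path_cons // cps andbT; apply/allP => u us.
  have [->|ul] := eqVneq u l; first by rewrite [l == z]eq_sym (negbTE zl) /adj Cil eqxx.
  have uis : u \in [:: i, z, y & t] by rewrite in_cons us orbT.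
  have -> : adj i u = adj' i u.
    by rewrite adj_eq ?mem_head // (negbTE ul) (nis u us) !andbF.
  move: us; rewrite in_cons; case: (u =P z) => [->|_] us; first by rewrite iz.
  by rewrite is_ // -[last _ _]/(last i [:: z, y & t]) lD (negbTE ul).
- by rewrite -adjk; case/orP: io => /andP[o1 o2]; [exact: in_nb|exact: out_nb].
by move=> u us; rewrite -adjk nks // lD.
Qed.

End MutationCycles.

(** * Mutation preserves good orientations *)

Lemma path_sub (T : eqType) (e e' : rel T) x s :
  (forall u v, u \in x :: s -> v \in s -> e u v -> e' u v) ->
  path e x s -> path e' x s.
Proof.
elim: s x => //= y s IH x H /andP[exy pys].
rewrite H ?mem_head //= IH // => u v us vs; apply: H; rewrite inE.
  by rewrite us orbT.
by rewrite vs orbT.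
Qed.

Section GoodMutation.
Variables (R : rcfType) (n : nat) (o : rel 'I_n) (C : 'M[int]_n) (d : 'I_n -> R).
Hypothesis G : good_orientation o C d.
Variable k : 'I_n.

Let qc := good_qc G.
Let C' := cartan_mutation k (o^~ k) C.
Let o' := arrow_mutation k o C.
Let adj : rel 'I_n := fun i j => C i j != 0.
Let adj' : rel 'I_n := fun i j => C' i j != 0.
Let qc1 : quasi_cartan C' d. Proof. exact: qc' G k. Qed.
Let adjC : symmetric adj. Proof. exact: qc_adjC qc. Qed.
Let adjC' : symmetric adj'. Proof. exact: qc_adjC qc1. Qed.
Let adjk i : adj' k i = adj k i. Proof. exact: mutation_adjk G k i. Qed.

Let ccP' j i s : chordless_cycle C' (j :: i :: s) <->
  [/\ uniq (j :: i :: s), s != [::], chordless_path adj' (i :: s), adj' j i &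
      {in s, forall v, adj' j v = (v == last i s)}].
Proof. exact: chordless_cycleP adjC' j i s. Qed.

Let ccP j i s : chordless_cycle C (j :: i :: s) <->
  [/\ uniq (j :: i :: s), s != [::], chordless_path adj (i :: s), adj j i &
      {in s, forall v, adj j v = (v == last i s)}].
Proof. exact: chordless_cycleP adjC j i s. Qed.

Lemma arrow_mutation_k j : o' k j = o j k.
Proof. by rewrite /o' /arrow_mutation eqxx. Qed.

Lemma arrow_mutation_rk j : o' j k = o k j.
Proof. by rewrite /o' /arrow_mutation eqxx orbT. Qed.

Lemma arrow_mutation_in_out i j : o i k -> o k j -> o' i j = adj' i j.
Proof.
move=> oi oj; have [ik kj] := (good_arr_neq G oi, good_arr_neq G oj).
rewrite /o' /arrow_mutation (negbTE ik) eq_sym (negbTE kj) oi oj /=.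
by rewrite /adj' /C' (mutation_in_out G) // subr_eq0.
Qed.

Lemma arrow_mutation_out_in i j : o i k -> o k j -> o' j i = false.
Proof.
move=> oi oj; have [ik kj] := (good_arr_neq G oi, good_arr_neq G oj).
rewrite /o' /arrow_mutation (negbTE ik) eq_sym (negbTE kj) oi oj /=.
by rewrite (good_arr_asym G oj).
Qed.

Lemma arrow_mutation_other i j : i != k -> j != k -> ~~ (o i k && o k j) ->
  ~~ (o j k && o k i) -> o' i j = o i j.
Proof.
move=> /negbTE ik /negbTE jk /negbTE h1 /negbTE h2.
by rewrite /o' /arrow_mutation ik jk h1 h2.
Qed.

Let io_dec i j : i != k -> j != k ->
  [\/ o i k && o k j, o j k && o k i |
      ~~ (o i k && o k j) /\ ~~ (o j k && o k i)].
Proof.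
move=> ik jk; case: (boolP (o i k && o k j)) => h1; first by constructor 1.
by case: (boolP (o j k && o k i)) => h2; [constructor 2|constructor 3].
Qed.

Let arr_adj' i j : i != j -> adj' i j = o' i j || o' j i.
Proof.
have Hk j0 : k != j0 -> adj' k j0 = o' k j0 || o' j0 k.
  move=> kj; rewrite arrow_mutation_k arrow_mutation_rk adjk.
  by rewrite /adj (good_arr G) // orbC.
move=> ij; have [ik|ik] := eqVneq i k; first by subst i; apply: Hk.
have [jk|jk] := eqVneq j k; first by subst j; rewrite adjC' orbC Hk // eq_sym.
case: (io_dec ik jk) => [/andP[oi oj]|/andP[oj oi]|[h1 h2]].
- by rewrite [o' i j]arrow_mutation_in_out // [o' j i]arrow_mutation_out_in // orbF.
- by rewrite [o' j i]arrow_mutation_in_out // [o' i j]arrow_mutation_out_in // adjC'.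
rewrite !arrow_mutation_other // /adj' (mutation_other G) //.
by rewrite (good_arr G).
Qed.

Let asym' i j : o' i j -> ~~ o' j i.
Proof.
have [ik|ik] := eqVneq i k.
  by subst i; rewrite arrow_mutation_k arrow_mutation_rk; apply: (good_asym G).
have [jk|jk] := eqVneq j k.
  by subst j; rewrite arrow_mutation_k arrow_mutation_rk; apply: (good_asym G).
case: (io_dec ik jk) => [/andP[oi oj]|/andP[oj oi]|[h1 h2]].
- by rewrite [o' j i]arrow_mutation_out_in.
- by rewrite arrow_mutation_out_in.
by rewrite !arrow_mutation_other //; apply: (good_asym G).
Qed.

(** If the neighbours of [k] on the cycle lie on one side only, the cycle is chordless in [C], with
    the same orientation up to reversal at [k]. Otherwise a cycle avoiding [k] comes from a longer
    one through [k] ([mutation_cycle_avoid]). A cycle through [k] either comes from a shorter one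
    without [k] ([mutation_cycle_delete]) or is a triangle, oriented by the definition of
    [arrow_mutation]. *)
Let cycle' s : chordless_cycle C' s -> cycle o' s || cycle (fun x y => o' y x) s.
Proof.
move=> cs; have [ks|ks] := boolP (k \in s); last first.
  have [/andP[hi ho]|hio] := boolP (has (o^~ k) s && has (o k) s); last first.
    have oo' : {in s &, forall u v, o u v = o' u v}.
      move=> u v us vs; have nk w : w \in s -> w != k.
        by move=> ws; apply: contraNneq ks => <-.
      rewrite arrow_mutation_other ?nk //; apply: contra hio => /andP[ou ov].
        by apply/andP; split; apply/hasP; [exists u|exists v].
      by apply/andP; split; apply/hasP; [exists v|exists u].
    have /(good_cycle G) := proj1 (mutation_cycle_same G hio) cs.
    by case/orP => h; apply/orP; [left|right];
      apply: (sub_in_cycle _ _ h) => [u v us vs|]; rewrite ?oo' //; apply/allP.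
  have [M [i [t [sE io Cl0 cc]]]] := mutation_cycle_avoid G cs ks hi ho.
  have cit : chordless_cycle C' (i :: t) by rewrite -sE; apply: chordless_cycle_rot.
  rewrite -(@rot_cycle M _ o') -(@rot_cycle M _ (fun x y => o' y x)) sE; pose l := last i t.
  have uk u : u \in i :: t -> u != k.
    by rewrite -sE mem_rot => us; apply: contraNneq ks => <-.
  have [ucc tn _ _ kt] := proj1 (ccP _ _ _) cc.
  have lt : l \in t by rewrite /l; case: (t) tn => //= z t' _; apply: mem_last.
  have il : i != l.
    by apply: contraTneq ucc => ->; rewrite /= lt andbF.
  have nio u : u \in i :: t -> (o u k || o k u) -> (u == i) || (u == l).
    move=> us; rewrite -(good_arr G) ?uk // -[C u k != 0]/(adj u k) adjC.
    move: us; rewrite inE; case: eqP => //= _ us; by rewrite kt.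
  have oo u v : u \in i :: t -> v \in i :: t -> o u v -> o' u v.
    move=> us vs ouv; case: (io_dec (uk u us) (uk v vs)) => [/andP[h1 h2]|/andP[h1 h2]|[h1 h2]]; last by rewrite (arrow_mutation_other (uk u us) (uk v vs)).
      exfalso; have := nio u us; rewrite h1 => /(_ isT) /orP[] /eqP E1;
      have := nio v vs; rewrite h2 orbT => /(_ isT) /orP[] /eqP E2;
      move: ouv h1 h2; rewrite E1 E2 ?(good_irr G) // => ouv h1 h2.
        by have := good_arr_adj G ouv; rewrite -/l Cl0 eqxx.
      by have := good_arr_adjr G ouv; rewrite -/l Cl0 eqxx.
    exfalso; have := nio u us; rewrite h2 orbT => /(_ isT) /orP[] /eqP E1;
    have := nio v vs; rewrite h1 => /(_ isT) /orP[] /eqP E2;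
    move: ouv h1 h2; rewrite E1 E2 ?(good_irr G) // => ouv h1 h2.
      by have := good_arr_adj G ouv; rewrite -/l Cl0 eqxx.
    by have := good_arr_adjr G ouv; rewrite -/l Cl0 eqxx.
  have adj_il : adj' i l.
    rewrite adjC'; have : chordless_cycle C' (rev (rcons t i)).
      by apply: chordless_cycle_rev; rewrite -cats1; apply: chordless_cycle_cat.
    rewrite rev_rcons /l.
    case/lastP: (t) lt => // t' y _; rewrite last_rcons rev_rcons.
    by case/ccP' => _ _ _ + _; rewrite adjC'.
  have := good_cycle G cc; rewrite /= !rcons_path -/l.
  case/orP => /and3P[oki pth olk]; apply/orP; [left|right].
    rewrite -?/l (path_sub _ pth) /= => [|u v us vs]; last first.
      by apply: oo => //; rewrite inE vs orbT.
    by rewrite arrow_mutation_in_out // adjC'.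
  rewrite -?/l (path_sub _ pth) /= => [|u v us vs]; last first.
    by apply: oo => //; rewrite inE vs orbT.
  by rewrite arrow_mutation_in_out.
have [M t sE] := rot_to ks.
have {cs} : chordless_cycle C' (k :: t) by rewrite -sE; apply: chordless_cycle_rot.
rewrite -(@rot_cycle M _ o') -(@rot_cycle M _ (fun x y => o' y x)) {}sE.
case: t => [[_ //]|j t cs]; have [u tn cp kj kt] := proj1 (ccP' _ _ _) cs.
pose i := last j t.
have it : i \in t by rewrite /i; case: (t) tn => //= z t' _; apply: mem_last.
have ki : adj' k i by rewrite kt.
have nk v : v \in j :: t -> v != k.
  by move=> vt; apply: contraTneq u => <-; rewrite cons_uniq vt.
have nio v : v \in j :: t -> (o v k || o k v) -> (v == j) || (v == i).
  move=> vt; rewrite -(good_arr G) ?nk // -[C v k != 0]/(adj v k) adjC -adjk.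
  move: vt; rewrite inE; case: eqP => //= _ vt; by rewrite kt.
have jt : j \notin t by case/and3P: u.
have ij : i != j by apply: contraNneq jt => <-.
have nb v : adj' k v -> v != k -> o k v = ~~ o v k.
  rewrite adjk /adj => + vk; rewrite (good_arr G) 1?eq_sym // => /orP[okx|oxk].
    by rewrite okx (good_arr_asym G okx).
  by rewrite oxk (good_arr_asym G oxk).
have jjt : j \in j :: t by rewrite mem_head.
have ijt : i \in j :: t by rewrite inE it orbT.
have [lab|lab] := eqVneq (o j k) (o i k).
  have hio : ~~ (has (o^~ k) (k :: j :: t) && has (o k) (k :: j :: t)).
    rewrite [has _ _]/= [X in _ && X]/= !(good_irr G) /= !nb ?nk //.
    case oj: (o j k) lab => lab /=.
      apply/negP => /hasP[v vt ov]; have := nio v; rewrite ov orbT inE vt orbT.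
      move=> /(_ isT isT) /orP[/eqP E|/eqP E]; first by rewrite -E vt in jt.
      by rewrite E nb ?nk // -lab in ov.
    rewrite andbT; apply/negP => /hasP[v vt ov]; have := nio v; rewrite ov inE vt orbT.
    move=> /(_ isT isT) /orP[/eqP E|/eqP E]; first by rewrite -E vt in jt.
    by rewrite E -lab in ov.
  have /(good_cycle G) := proj1 (mutation_cycle_same G hio) cs.
  rewrite /= !rcons_path -/i !nb ?nk // -lab.
  by case: (o j k); rewrite ?andbF.
have lab' : o j k (+) o i k by move: lab; case: (o j k); case: (o i k).
have okj := nb j kj (nk j jjt); have oki := nb i ki (nk i ijt).
have [small|big] := leqP (size t) 1.
  case: (t) tn small cp (erefl t) @i it ki ij ijt lab lab' oki {cs u kt nk nio jt jjt} => // z [|//] _ _.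
  rewrite /= !andbT => ajz _ _ _ _ _ lab lab' oki.
  rewrite !arrow_mutation_k !arrow_mutation_rk.
  case oj: (o j k) lab' okj oki; case oz: (o z k) => // _ okj oki.
    by rewrite arrow_mutation_in_out // ajz oki.
  by rewrite [o' z j]arrow_mutation_in_out // adjC' ajz okj orbT.
have [cC Cji] := mutation_cycle_delete G cs big lab'.
have Cji0 : C j i != 0.
  rewrite Cji mulf_neq0 //; last by rewrite -[_ != 0]/(adj k i) -adjk.
  by rewrite -[_ != 0]/(adj j k) adjC -adjk.
have := good_cycle G cC; rewrite /= !rcons_path -/i.
rewrite !arrow_mutation_k !arrow_mutation_rk okj oki.
have tk b : b \in t -> (b \in j :: t) * (b != k).
  move=> bt; have bjt : b \in j :: t by rewrite inE bt orbT.
  by rewrite bjt nk.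
have ti b : b \in t -> o b k || o k b -> b = i.
  move=> bt ob; have := nio b (tk b bt).1 ob.
  by case/orP=> /eqP // E; rewrite -E bt in jt.
case oj: (o j k) lab' okj oki; case oi: (o i k) => // _ okj oki.
  have [oij _ _ _ _] := in_out_triangle G oj oki Cji0.
  rewrite (good_arr_asym G oij) andbF orbF oij andbT => pth.
  rewrite (@path_sub _ o o') // => a b ajt bt oab.
  case: (io_dec (nk a ajt) (tk b bt).2) => [/andP[oa ob]|/andP[ob oa]|[h1 h2]].
  - have bi : b = i by apply: ti; rewrite // ob orbT.
    have aj : a = j.
      have := nio a ajt; rewrite oa => /(_ isT) /orP[] /eqP // E.
      by rewrite E oi in oa.
    by rewrite aj bi (good_arr_asym G oij) in oab.
  - have bi : b = i by apply: ti; rewrite // ob.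
    by rewrite bi oi in ob.
  - by rewrite (arrow_mutation_other (nk a ajt) (tk b bt).2).
have Cij0 : C i j != 0 by rewrite -[_ != 0]/(adj i j) adjC.
have [oji _ _ _ _] := in_out_triangle G oi okj Cij0.
rewrite (good_arr_asym G oji) andbF oji andbT => pth; apply/orP; right.
rewrite (@path_sub _ _ (fun x y => o' y x) _ _ _ pth) // => a b ajt bt oab.
case: (io_dec (nk a ajt) (tk b bt).2) => [/andP[oa ob]|/andP[ob oa]|[h1 h2]].
- have bi : b = i by apply: ti; rewrite // ob orbT.
  by rewrite bi oki in ob.
- have bi : b = i by apply: ti; rewrite // ob.
  have aj : a = j.
    have := nio a ajt; rewrite oa orbT => /(_ isT) /orP[] /eqP // E.
    by rewrite E oki in oa.
  by rewrite aj bi (good_arr_asym G oji) in oab.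
- by rewrite (arrow_mutation_other (tk b bt).2 (nk a ajt)).
Qed.

Lemma good_mutation : good_orientation o' C' d.
Proof. by split. Qed.

End GoodMutation.

(** * Opposite orientations, and Dynkin diagrams as the starting point *)

Lemma good_opposite (R : rcfType) n (o : rel 'I_n) (C : 'M[int]_n) (d : 'I_n -> R) :
  good_orientation o C d -> good_orientation (fun i j => o j i) C d.
Proof.
case=> qc arr asym cyc; split=> // [i j ij|i j|s /cyc]; last by rewrite orbC.
  by rewrite orbC arr.
exact: asym.
Qed.

Lemma cartan_mutationK n (k : 'I_n) (I : pred 'I_n) (C : 'M[int]_n) :
  C k k = 2 -> ~~ I k -> cartan_mutation k I (cartan_mutation k I C) = C.
Proof.
move=> Ck /negbTE kI; apply/matrixP => i j; rewrite !mxE kI Ck addbF /=.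
by case: (I i); case: (I j) => /=; ring.
Qed.

(* Completing squares: [2 |x_i x_j| <= (y_j / y_i) x_i^2 + (y_i / y_j) x_j^2]. *)
Lemma dominant_quasi_cartan (R : rcfType) n (C : 'M[int]_n) (d y : 'I_n -> R) :
  (forall i, C i i = 2) -> (forall i, 0 < d i) ->
  (forall i j, d i * (C i j)%:~R = d j * (C j i)%:~R) ->
  (forall i, 0 < y i) ->
  (forall i, \sum_(j | j != i) `|(C i j)%:~R| * y j < 2%:R * y i) ->
  quasi_cartan C d.
Proof.
move=> Cd d0 sym y0 dom; split=> // x [i0 xi0].
pose t i j := d i * `|(C i j)%:~R| * (y j / y i) * x i ^+ 2.
have tswap i j : d i * `|(C i j)%:~R| * (y i / y j) * x j ^+ 2 = t j i.
  have := congr1 Num.norm (sym i j); rewrite !normrM !(gtr0_norm (d0 _)) /t.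
  by move=> E; rewrite E.
have bound i j : - (t i j + t j i) / 2%:R <= d i * (C i j)%:~R * x i * x j.
  rewrite -[t j i]tswap /t; have [yi yj] := (y0 i, y0 j).
  set c : R := (C i j)%:~R; pose a := x i * y j; pose b := x j * y i.
  have -> : - (d i * `|c| * (y j / y i) * x i ^+ 2 + d i * `|c| * (y i / y j) * x j ^+ 2) / 2 =
     (d i / (y i * y j)) * (- `|c| * (a ^+ 2 + b ^+ 2) / 2).
    by rewrite /a /b; field; rewrite !gt_eqF.
  have -> : d i * c * x i * x j = (d i / (y i * y j)) * (c * (a * b)).
    by rewrite /a /b; field; rewrite !gt_eqF.
  rewrite ler_pM2l ?divr_gt0 ?mulr_gt0 //.
  have h1 : 0 <= (`|c| + c) * (a + b) ^+ 2.
    by rewrite mulr_ge0 ?sqr_ge0 // -lerBlDr sub0r -normrN ler_norm.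
  have h2 : 0 <= (`|c| - c) * (a - b) ^+ 2.
    by rewrite mulr_ge0 ?sqr_ge0 // subr_ge0 ler_norm.
  by move: h1 h2; rewrite !expr2; lra.
have lower i : d i * (C i i)%:~R * x i * x i - \sum_(j | j != i) (t i j + t j i) / 2%:R
    <= \sum_j d i * (C i j)%:~R * x i * x j.
  rewrite [leRHS](bigD1 i) //= lerD2l -sumrN; apply: ler_sum => j _.
  by rewrite -mulNr.
apply: lt_le_trans (ler_sum _ (fun i _ => lower i)).
have -> : \sum_i (d i * (C i i)%:~R * x i * x i - \sum_(j | j != i) (t i j + t j i) / 2%:R) =
    \sum_i (d i * x i ^+ 2 / y i * (2%:R * y i - \sum_(j | j != i) `|(C i j)%:~R| * y j)).
  rewrite sumrB.
  have -> : \sum_i \sum_(j | j != i) (t i j + t j i) / 2%:R =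
      \sum_i \sum_(j | j != i) t i j.
    transitivity (\sum_i ((\sum_(j | j != i) t i j) / 2%:R + (\sum_(j | j != i) t j i) / 2%:R)).
      by apply: eq_bigr => i _; rewrite -mulr_suml big_split /= mulrDl.
    have swap : \sum_i \sum_(j | j != i) t j i = \sum_i \sum_(j | j != i) t i j.
      rewrite (exchange_big_dep xpredT) //=; apply: eq_bigr => i _.
      by apply: eq_bigl => j; rewrite eq_sym.
    by rewrite big_split /= -!mulr_suml swap; field.
  rewrite -sumrB; apply: eq_bigr => i _; rewrite mulrBr Cd; congr (_ - _).
    by field; rewrite gt_eqF.
  rewrite mulr_sumr; apply: eq_bigr => j _; rewrite /t; field.
  by rewrite gt_eqF.
rewrite (bigD1 i0) //= ltr_pwDl //.
  rewrite mulr_gt0 ?subr_gt0 // divr_gt0 // mulr_gt0 //.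
  by rewrite exprn_even_gt0 //=.
apply: sumr_ge0 => i _; apply: mulr_ge0; last by rewrite subr_ge0 ltW.
apply: divr_ge0; last exact/ltW.
by apply: mulr_ge0; [exact/ltW|exact: sqr_ge0].
Qed.

(* In a chordless cycle the vertex of largest rank has two smaller neighbours. *)
Lemma no_chordless_cycle n (C : 'M[int]_n) (r : 'I_n -> nat) :
  symmetric (fun i j => C i j != 0) ->
  (forall i j l, C i j != 0 -> C i l != 0 -> (r j < r i)%N -> (r l < r i)%N -> j = l) ->
  injective r -> forall s, ~ chordless_cycle C s.
Proof.
move=> adjC r1 rI s cs; have s0 : s != [::] by case: cs => _; case: (s).
have [x0 x0s] : exists x0, x0 \in s by case: (s) s0 => // x t _; exists x; rewrite mem_head.
pose v := [arg max_(v > x0 | v \in s) r v].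
have [vs vmax] : v \in s /\ forall u, u \in s -> (r u <= r v)%N.
  by rewrite /v; case: arg_maxnP => // u us umax; split.
have [m t st] := rot_to vs.
have: chordless_cycle C (v :: t) by rewrite -st; apply: chordless_cycle_rot.
have mt u : u \in t -> u \in s by move=> ut; rewrite -(mem_rot m) st inE ut orbT.
case: t {st} mt => [|j t] mt; first by case.
case/(chordless_cycleP adjC) => u tn _ vj vt.
have lt : last j t \in t by case: (t) tn => //= z t' _; apply: mem_last.
have rlt w : w \in j :: t -> (r w < r v)%N.
  move=> ws; rewrite ltn_neqAle vmax ?mt // andbT.
  by apply: contraTneq u => /rI <-; rewrite cons_uniq ws.
have E := r1 v j (last j t) vj _ (rlt j (mem_head _ _)) (rlt _ _).
move: u; rewrite E ?vt ?inE ?lt ?orbT //=.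
by rewrite lt !andbF.
Qed.

Lemma leq_sum_support n (f : nat -> nat) (s : seq nat) (P : pred 'I_n) :
  (forall j : 'I_n, P j -> f j != 0%N -> nat_of_ord j \in s) ->
  (\sum_(j < n | P j) f j <= \sum_(u <- s) f u)%N.
Proof.
move=> fs.
have le1 (j : 'I_n) : P j -> (f j <= \sum_(u <- s) if u == j then f u else 0)%N.
  move=> Pj; have [->//|/(fs j Pj) js] := eqVneq (f j) 0%N.
  by rewrite (big_rem _ js) /= eqxx leq_addr.
apply: (@leq_trans (\sum_(j < n | P j) \sum_(u <- s) if u == j then f u else 0)%N).
  exact: leq_sum.
rewrite big_mkcond; apply: (@leq_trans (\sum_(j < n) \sum_(u <- s) if u == j then f u else 0)%N).
  by apply: leq_sum => j _; case: ifP.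
rewrite exchange_big /=; apply: leq_sum => u _.
have [un|nu] := ltnP u n; last first.
  by rewrite big1 // => j _; case: eqP (ltn_ord j) => // <-; rewrite ltnNge nu.
rewrite (bigD1 (Ordinal un)) //= eqxx big1 ?addn0 // => j jn.
by case: eqP => // E; case/eqP: jn; apply/val_inj; rewrite /= E.
Qed.

Section ValuedQuiver.
Variables (n : nat) (S : svquiver n).
Local Notation C := (cartan S).

Lemma cartan_diag i : C i i = 2.
Proof. by rewrite mxE eqxx. Qed.

Lemma cartan_out i j : arr S i j -> C i j = v1 S i j.
Proof.
by move=> ij; rewrite mxE ij; case: eqP ij => // ->; rewrite arr_irr.
Qed.

Lemma cartan_in i j : arr S i j -> C j i = v2 S i j.
Proof.
move=> ij; rewrite mxE ij (negbTE (arr_asym ij)).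
by case: eqP ij => // ->; rewrite arr_irr.
Qed.

Lemma cartan_arr i j : i != j -> (C i j != 0) = arr S i j || arr S j i.
Proof.
move=> ij; have [aij|aij] := boolP (arr S i j).
  by rewrite cartan_out // -sgr_eq0; case: (val_sign aij).
have [aji|aji] := boolP (arr S j i).
  by rewrite cartan_in // -sgr_eq0; case: (val_sign aji) => <-.
by rewrite mxE (negbTE ij) (negbTE aij) (negbTE aji) eqxx.
Qed.

Lemma cartan_sym : exists d : 'I_n -> nat, (forall i, (0 < d i)%N) /\
  forall i j, (d i)%:R * C i j = (d j)%:R * C j i.
Proof.
have [d [d0 dS]] := val_symm S; exists d; split=> // i j.
have [->//|ij] := eqVneq i j.
have [aij|aij] := boolP (arr S i j); first by rewrite (cartan_out aij) (cartan_in aij) dS.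
have [aji|aji] := boolP (arr S j i); first by rewrite (cartan_in aji) (cartan_out aji) dS.
by rewrite !mxE [j == i]eq_sym (negbTE ij) (negbTE aij) (negbTE aji) !mulr0.
Qed.

Lemma cartan_edges i j : i != j ->
  edges (unsigned_diagram S) i j = absz (C i j * C j i).
Proof.
move=> ij; have [aij|aij] := boolP (arr S i j).
  by rewrite /= aij (cartan_out aij) (cartan_in aij).
have [aji|aji] := boolP (arr S j i).
  by rewrite /= (negbTE aij) aji (cartan_in aji) (cartan_out aji) mulrC.
by rewrite /= !mxE [j == i]eq_sym (negbTE ij) (negbTE aij) (negbTE aji).
Qed.

Lemma cartan_larger i j : i != j ->
  larger (unsigned_diagram S) i j = (`|C i j| > `|C j i|).
Proof.
move=> ij; have [aij|aij] := boolP (arr S i j).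
  by rewrite /= aij (cartan_out aij) (cartan_in aij).
have [aji|aji] := boolP (arr S j i).
  by rewrite /= (negbTE aij) aji (cartan_in aji) (cartan_out aji).
by rewrite /= !mxE [j == i]eq_sym (negbTE ij) (negbTE aij) (negbTE aji) ltxx.
Qed.

(* [|C i j|] read off a diagram whose multiplicities are 0, 1 or prime. *)
Definition diagram_entry m (D : diagram m) i j : nat :=
  if larger D i j then edges D i j else (edges D i j != 0)%N.

Lemma cartan_entry (D : diagram n) (s : {perm 'I_n}) :
  (forall i j, (edges D i j <= 3)%N) ->
  (forall i j, edges (unsigned_diagram S) i j = edges D (s i) (s j) /\
               larger (unsigned_diagram S) i j = larger D (s i) (s j)) ->
  forall i j, i != j -> absz (C i j) = diagram_entry D (s i) (s j).
Proof.
move=> D3 Ds i j ij; have [eE lE] := Ds i j; have := D3 (s i) (s j).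
rewrite /diagram_entry -eE -lE cartan_edges // cartan_larger //.
have [d [d0 dS]] := cartan_sym.
have nz : (C i j == 0) = (C j i == 0).
  have dnz l : (d l)%:R != 0 :> int by rewrite pnatr_eq0 -lt0n.
  apply/idP/idP => /eqP h; have := dS i j; rewrite h mulr0 => /eqP.
    by rewrite eq_sym mulf_eq0 (negbTE (dnz _)).
  by rewrite mulf_eq0 (negbTE (dnz _)).
rewrite abszM -!abszE ltz_nat => {eE lE}.
have : (`|C i j|%N == 0%N) = (`|C j i|%N == 0%N) by rewrite !absz_eq0.
move: `|C i j|%N `|C j i|%N => a b ab h.
have [a0|a0] := posnP a; first by rewrite a0 mul0n.
have b0 : (0 < b)%N by rewrite lt0n -ab -lt0n.
case: ltnP => ba; last by nia.
by have -> : b = 1 by [nia]; rewrite muln1.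
Qed.

End ValuedQuiver.

(* [Y] witnesses positivity; for Dynkin diagrams it is proportional to the
   coefficients of the sum of the positive (co)roots, or close to it. *)
Definition tame_diagram n (D : diagram n) : Prop :=
  [/\ forall i j, (edges D i j <= 3)%N,
      exists Y : nat -> nat, (forall i : 'I_n, (0 < Y i)%N) /\
        forall i : 'I_n,
          (\sum_(j < n | j != i) diagram_entry D i j * Y j < 2 * Y i)%N &
      forall i j l, diagram_entry D i j != 0%N -> diagram_entry D i l != 0%N ->
        (j < i)%N -> (l < i)%N -> j = l].

(** The dominated vector gives positivity, and the ranking of the vertices excludes chordless
    cycles, so the condition on their orientation is void. *)
Lemma tame_good (R : rcfType) n (S : svquiver n) (D : diagram n) :
  tame_diagram D -> diagram_iso (unsigned_diagram S) D ->
  exists d : 'I_n -> R, good_orientation (arr S) (cartan S) d.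
Proof.
case=> D3 [Y [Y0 YD]] D1 [s Ds]; have [d [d0 dS]] := cartan_sym S.
have E := cartan_entry D3 Ds.
have nzE i j : i != j -> (cartan S i j != 0) = (diagram_entry D (s i) (s j) != 0%N).
  by move=> ij; rewrite -E // absz_eq0.
have qc : quasi_cartan (cartan S) (fun i => (d i)%:R : R).
  apply: (@dominant_quasi_cartan _ _ _ _ (fun i => (Y (s i))%:R)).
  - exact: cartan_diag.
  - by move=> i; rewrite ltr0n.
  - move=> i j; have := congr1 (fun z : int => z%:~R : R) (dS i j).
    by rewrite !intrM !natz.
  - by move=> i; rewrite ltr0n.
  move=> i; rewrite (eq_bigr (fun j => (diagram_entry D (s i) (s j) * Y (s j))%:R)).
    rewrite -natr_sum -natrM ltr_nat; have := YD (s i).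
    rewrite (reindex_inj (@perm_inj _ s)) /=.
    by rewrite (eq_bigl (fun j => j != i)) // => j; rewrite (inj_eq perm_inj).
  move=> j ji; rewrite natrM -E 1?eq_sym //; congr (_ * _).
  by rewrite -intr_norm -abszE.
exists (fun i => (d i)%:R); split=> //.
- exact: cartan_arr.
- exact: arr_asym.
move=> c cc; exfalso; move: cc.
apply: (@no_chordless_cycle _ _ (fun i => s i : nat)).
- exact: (qc_adjC qc).
- move=> i j l ij il ji li; apply: (@perm_inj _ s).
  have neq u : (s u < s i)%N -> i != u.
    by move=> ui; apply: contraTneq ui => ->; rewrite ltnn.
  by apply: (D1 (s i)) => //; rewrite -nzE // neq.
by move=> i j /val_inj/perm_inj.
Qed.

Lemma chain_entry n m a b (i j : 'I_n) : (0 < m)%N -> (a == b.+1) || (b == a.+1) ->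
  diagram_entry (chain_diagram n m a b) i j =
  if (i == a :> nat) && (j == b :> nat) then m else on_chain i j.
Proof.
rewrite /diagram_entry /= /on_edge /on_chain => m0 ab.
case: ifP => [-> //|ijab /=]; case: ifP => [|_]; last by case: (_ || _).
rewrite -lt0n m0 ijab /= => /andP[/eqP-> /eqP->].
by case/orP: ab => /eqP->; rewrite eqxx ?orbT.
Qed.

Lemma chain_tame n m a b (Y : nat -> nat) : (0 < m <= 3)%N ->
  (a == b.+1) || (b == a.+1) ->
  (forall i, (i < n)%N -> (0 < Y i)%N) ->
  (forall i, (i < n)%N ->
    ((if (i.+1 < n)%N then (if (i == a) && (i.+1 == b) then m else 1) * Y i.+1 else 0)
     + (if (0 < i)%N then (if (i == a) && (i.-1 == b) then m else 1) * Y i.-1 else 0)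
      < 2 * Y i)%N) ->
  tame_diagram (chain_diagram n m a b).
Proof.
move=> /andP[m0 m3] ab Y0 YD; split.
- move=> i j /=; case: ifP => // _; by case: (on_chain i j).
- exists Y; split=> [i|i]; first exact: Y0.
  apply: leq_ltn_trans (YD i (ltn_ord i)).
  pose f j := ((if (i == a :> nat) && (j == b :> nat) then m
    else (j == i.+1 :> nat) || (nat_of_ord i == j.+1)) * Y j)%N.
  rewrite (eq_bigr (fun j : 'I_n => f j)); last by move=> j _; rewrite chain_entry.
  pose s := (if (i.+1 < n)%N then [:: i.+1] else [::]) ++
            (if (0 < i)%N then [:: i.-1] else [::]).
  apply: (@leq_trans (\sum_(u <- s) f u)).
    apply: leq_sum_support => j ji; rewrite /f.
    have : (j == i.+1 :> nat) || (nat_of_ord i == j.+1) -> nat_of_ord j \in s.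
      case/orP=> /eqP E; rewrite /s mem_cat -?E.
        by rewrite ltn_ord mem_head.
      by rewrite E /= mem_head orbT.
    case: ifP => [/andP[/eqP-> /eqP->] H _|_ H].
      by apply: H; case/orP: ab => /eqP->; rewrite eqxx ?orbT.
    by case: (_ || _) H => // H _; apply: H.
  rewrite /s big_cat /=; apply: leq_add.
    case: ifP => _; rewrite ?big_nil // big_seq1 /f.
    by case: ifP => // _; rewrite eqxx.
  case: ifP => i0; rewrite ?big_nil // big_seq1 /f prednK //.
  by case: ifP => // _; rewrite eqxx orbT.
move=> i j l; rewrite !chain_entry // => hj hl ji li.
have nb (u : 'I_n) : (if (i == a :> nat) && (u == b :> nat) then m
    else on_chain i u) != 0%N -> (u < i)%N -> nat_of_ord i = u.+1.
  rewrite /on_chain; case: ifP => [/andP[/eqP-> /eqP->] _|_].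
    by case/orP: ab => /eqP-> //; rewrite ltnNge leqW.
  rewrite eqb0 negbK => /orP[/eqP->|/eqP //]; by rewrite ltnNge leqW.
by apply/val_inj/eq_add_S; rewrite -(nb j) // -(nb l).
Qed.

Lemma branch_tame n a (Y : nat -> nat) : (a < n.-1)%N ->
  (forall i, (i < n)%N -> (0 < Y i)%N) ->
  (forall i, (i < n.-1)%N ->
    ((if (i.+1 < n.-1)%N then Y i.+1 else 0)
     + ((if (0 < i)%N then Y i.-1 else 0) + (if i == a then Y n.-1 else 0))
      < 2 * Y i)%N) ->
  (Y a < 2 * Y n.-1)%N ->
  tame_diagram (branch_diagram n a).
Proof.
move=> an Y0 YD Ya.
have entry (i j : 'I_n) : diagram_entry (branch_diagram n a) i j =
    ([&& (i < n.-1)%N, (j < n.-1)%N & on_chain i j] || on_edge a n.-1 i j) :> nat.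
  by rewrite /diagram_entry /=; case: (_ || _).
split.
- by move=> i j /=; case: (_ || _).
- exists Y; split=> [i|i]; first exact: Y0.
  pose f (j : nat) := (([&& i < n.-1, j < n.-1 & (j == i.+1) || (nat_of_ord i == j.+1)]
    || ((nat_of_ord i == a) && (j == n.-1) || (nat_of_ord i == n.-1) && (j == a)) : bool) * Y j)%N.
  rewrite (eq_bigr (fun j : 'I_n => f j)); last by move=> j _; rewrite entry.
  have [ilt|ige] := ltnP i n.-1.
    apply: leq_ltn_trans (YD i ilt).
    pose s := (if (i.+1 < n.-1)%N then [:: i.+1] else [::]) ++
      (if (0 < i)%N then [:: i.-1] else [::]) ++ (if i == a :> nat then [:: n.-1] else [::]).
    apply: (@leq_trans (\sum_(u <- s) f u)).
      apply: leq_sum_support => j ji; rewrite /f ilt (ltn_eqF ilt) orbF.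
      rewrite muln_eq0 negb_or eqb0 negbK /= => /andP[+ _].
      case/orP=> [/andP[jn /orP[/eqP E|/eqP E]]|/andP[/eqP E1 /eqP E2]];
        rewrite /s !mem_cat.
      - by rewrite -E jn mem_head.
      - by rewrite E /= mem_head orbT.
      - by rewrite E1 E2 eqxx mem_head !orbT.
    rewrite /s !big_cat /=; apply: leq_add; last apply: leq_add.
    - by case: ifP => _; rewrite ?big_nil // big_seq1 /f; case: (_ || _); rewrite ?mul1n.
    - by case: ifP => _; rewrite ?big_nil // big_seq1 /f; case: (_ || _); rewrite ?mul1n.
    - by case: ifP => _; rewrite ?big_nil // big_seq1 /f; case: (_ || _); rewrite ?mul1n.
  have iE : nat_of_ord i = n.-1 by have := ltn_ord i; lia.
  rewrite [in ltnRHS]iE; apply: leq_ltn_trans Ya.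
  apply: (@leq_trans (\sum_(u <- [:: a]) f u)).
    apply: leq_sum_support => j ji; rewrite /f iE ltnn eqxx /= (gtn_eqF an) /=.
    by rewrite muln_eq0 negb_or eqb0 negbK inE => /andP[].
  by rewrite big_seq1 /f; case: (_ || _); rewrite ?mul1n.
move=> i j l; rewrite !entry !eqb0 !negbK => hj hl ji li.
have nb (u : 'I_n) : [&& (i < n.-1)%N, (u < n.-1)%N & on_chain i u]
    || on_edge a n.-1 i u -> (u < i)%N ->
    nat_of_ord u = if (i < n.-1)%N then i.-1 else a.
  rewrite /on_chain /on_edge; case: ltnP => ilt /=.
    case/orP=> [/andP[_ /orP[/eqP->|/eqP-> //]]|]; first by rewrite ltnNge leqW.
    by rewrite (ltn_eqF ilt) orbF => /andP[_ /eqP ->]; rewrite ltnNge ltnW.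
  case/orP=> /andP[/eqP E /eqP //]; by rewrite E in ilt; lia.
by apply/val_inj; rewrite /= (nb j) // (nb l).
Qed.

Lemma diagram_A_chain n : tame_diagram (chain_diagram n 1 1 0) ->
  tame_diagram (diagram_A n).
Proof.
have E (i j : 'I_n) : diagram_entry (diagram_A n) i j =
    diagram_entry (chain_diagram n 1 1 0) i j.
  rewrite chain_entry // /diagram_entry /=; case: ifP => [/andP[/eqP i1 /eqP j0]|_].
    by rewrite /on_chain i1 j0.
  by case: (on_chain i j).
case=> _ [Y [Y0 YD]] D1; split.
- by move=> i j /=; case: (on_chain i j).
- exists Y; split=> // i; under eq_bigr do rewrite E; exact: YD.
by move=> i j l; rewrite !E; apply: D1.
Qed.

(** For A and C the sequence [(i+1)(2n-i)] has second difference -2. For B it is doubled and halved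
    again at the last vertex; for D the same is done with [n-1] for [n], the small value serving
    both ends of the fork. The exceptional types use tables. *)
Lemma dynkin_tame n (D : diagram n) :
  is_dynkin_diagram D -> exists2 D', tame_diagram D' & diagram_iso D D'.
Proof.
case=> [n1|n2|n2|n4|n68|n4|n2] iso; eexists; try exact: iso; clear iso D.
- apply/diagram_A_chain/(@chain_tame _ _ _ _ (fun i => i.+1 * (2 * n - i))%N) => // i ilt.
    by rewrite muln_gt0 /=; lia.
  by rewrite !if_same; case: (ltnP i.+1 n) => h; case: i ilt h => [|i] /= ilt h; nia.
- apply: (@chain_tame _ _ _ _ (fun i =>
    if i == n.-1 then n * n.+1 else 2 * (i.+1 * (2 * n - i)))%N) => //.
  + by apply/orP; right; lia.
  + by move=> i ilt; case: eqP => _; rewrite !muln_gt0 /=; lia.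
  move=> i ilt; case: n n2 ilt => [|[|n]] // _ ilt.
  have [E1 E2] : (n.+2 - 1 = n.+1)%N /\ (n.+2 - 2 = n)%N by split; lia.
  rewrite -[n.+2.-1]/n.+1 ?E1 ?E2.
  have [->|i1] := eqVneq i n.+1.
    rewrite ltnn (gtn_eqF (ltnSn n)) -[n.+1.-1]/n (ltn_eqF (ltnSn n)) /= mul1n add0n.
    have -> : (2 * n.+2 - n = n + 4)%N by lia.
    by nia.
  have -> : (i.+1 < n.+2)%N by lia.
  have -> : (i.-1 == n.+1) = false by lia.
  rewrite andbF mul1n eqSS andbb.
  have [iE|ni] := eqVneq i n.
    subst i; have -> : (2 * n.+2 - n = n + 4)%N by lia.
    case: n {ilt i1 E1 E2} => [|n] //; rewrite -[n.+1.-1]/n ltn0Sn.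
    by have -> : (2 * n.+3 - n = n + 6)%N; [lia|nia].
  rewrite mul1n.
  have [k kE] : exists k, n = (i + k.+1)%N by exists (n - i.+1)%N; lia.
  rewrite {E1 E2}kE {ni ilt i1}.
  have -> : (2 * (i + k.+1).+2 - i.+1 = i + 2 * k + 5)%N by lia.
  have -> : (2 * (i + k.+1).+2 - i = i + 2 * k + 6)%N by lia.
  case: i => [|i]; first by rewrite ltnn; nia.
  rewrite ltn0Sn -[i.+1.-1]/i.
  by have -> : (2 * (i.+1 + k.+1).+2 - i = i + 2 * k + 8)%N; [lia|nia].
- apply: (@chain_tame _ _ _ _ (fun i => i.+1 * (2 * n - i))%N) => //.
  + by apply/orP; left; lia.
  + by move=> i ilt; rewrite muln_gt0 /=; lia.
  move=> i ilt; case: n n2 ilt => [|[|n]] // _ ilt.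
  have [E1 E2] : (n.+2 - 1 = n.+1)%N /\ (n.+2 - 2 = n)%N by split; lia.
  rewrite ?E1 ?E2.
  have [->|i1] := eqVneq i n.+1.
    rewrite ltnn -[n.+1.-1]/n eqxx ltn0Sn add0n.
    have -> : (2 * n.+2 - n = n + 4)%N by lia.
    have -> : (2 * n.+2 - n.+1 = n + 3)%N by lia.
    by rewrite /=; nia.
  have -> : (i.+1 < n.+2)%N by lia.
  rewrite !mul1n.
  have [k kE] : exists k, n = (i + k)%N by exists (n - i)%N; lia.
  rewrite {E1 E2}kE {ilt i1}.
  have -> : (2 * (i + k).+2 - i.+1 = i + 2 * k + 3)%N by lia.
  have -> : (2 * (i + k).+2 - i = i + 2 * k + 4)%N by lia.
  case: i => [|i]; first by rewrite ltnn; nia.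
  rewrite ltn0Sn -[i.+1.-1]/i.
  by have -> : (2 * (i.+1 + k).+2 - i = i + 2 * k + 6)%N; [lia|nia].
- apply: (@branch_tame _ _ (fun i =>
    if (i < n - 2)%N then 2 * (i.+1 * (2 * n.-1 - i)) else n.-1 * n)%N) => //.
  + by lia.
  + by move=> i ilt; case: ifP => _; rewrite !muln_gt0 /=; lia.
  + case: n n4 => [|[|[|[|n]]]] // _ i.
    have [E1 E2] : (n.+4 - 2 = n.+2)%N /\ (n.+4 - 3 = n.+1)%N by split; lia.
    rewrite -[n.+4.-1]/n.+3 ?E1 ?E2.
    move=> ilt.
    rewrite (_ : (n.+3 < n.+2)%N = false); last by lia.
    have [->|i1] := eqVneq i n.+2.
      rewrite !ltnn -[n.+2.-1]/n.+1 (gtn_eqF (ltnSn _)) ltnSn addn0 add0n.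
      have -> : (2 * n.+3 - n.+1 = n + 5)%N by lia.
      by nia.
    have ilt2 : (i < n.+2)%N by lia.
    rewrite ltnS ilt2 (leq_ltn_trans (leq_pred i) ilt2).
    have [->|i2] := eqVneq i n.+1.
      rewrite ltnn ltn0Sn -[n.+1.-1]/n.
      have -> : (2 * n.+3 - n.+1 = n + 5)%N by lia.
      have -> : (2 * n.+3 - n = n + 6)%N by lia.
      by nia.
    have -> : (i.+1 < n.+2)%N by lia.
    rewrite addn0.
    have [k kE] : exists k, n = (i + k)%N by exists (n - i)%N; lia.
    rewrite {E1 E2}kE {ilt i1 ilt2 i2}.
    have -> : (2 * (i + k).+3 - i.+1 = i + 2 * k + 5)%N by lia.
    have -> : (2 * (i + k).+3 - i = i + 2 * k + 6)%N by lia.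
    case: i => [|i]; first by rewrite ltnn; nia.
    rewrite ltn0Sn -[i.+1.-1]/i.
    by have -> : (2 * (i.+1 + k).+3 - i = i + 2 * k + 8)%N; [lia|nia].
  case: n n4 => [|[|[|[|n]]]] // _; have [E1 E2] : (n.+4 - 2 = n.+2)%N /\ (n.+4 - 3 = n.+1)%N by split; lia.
  rewrite -[n.+4.-1]/n.+3 ?E1 ?E2.
  rewrite ltnSn.
  rewrite (_ : (n.+3 < n.+2)%N = false); last by lia.
  by have -> : (2 * n.+3 - n.+1 = n + 5)%N; [lia|nia].
- have : n \in [:: 6; 7; 8]%N by rewrite !inE; lia.
  rewrite !inE => /or3P[] /eqP->.
  + apply: (@branch_tame _ _ (nth 0 [:: 16; 30; 42; 30; 16; 22]%N)) => //;
      by do 6?case=> //.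
  + apply: (@branch_tame _ _ (nth 0 [:: 34; 66; 96; 75; 52; 27; 49]%N)) => //;
      by do 7?case=> //.
  + apply: (@branch_tame _ _ (nth 0 [:: 92; 182; 270; 220; 168; 114; 58; 136]%N)) => //;
      by do 8?case=> //.
- subst n; apply: (@chain_tame _ _ _ _ (nth 0 [:: 11; 21; 15; 8]%N)) => //.
  + by do 4?case=> //.
  by do 4?case=> //.
- subst n; apply: (@chain_tame _ _ _ _ (nth 0 [:: 5; 3]%N)) => //.
  + by do 2?case=> //.
  by do 2?case=> //.
Qed.

(** * Evaluation at t = 1 and t = -1, and invertibility of signed mutation *)

Section Evaluation.
Variable a : int.
Hypothesis a2 : a * a = 1.

(** For [a] equal to 1 or -1 this is a ring homomorphism to the integers, since ['X^2 - 1] vanishes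
    at [a]. The value at 1 determines [sgt]; the value at -1 recovers the signs of arrows. *)
Definition zt_eval (x : Zt) : int := (x : {poly int}).[a].

Lemma zt_evalD x y : zt_eval (x + y) = zt_eval x + zt_eval y.
Proof. by rewrite /zt_eval -hornerD. Qed.

Lemma zt_evalN x : zt_eval (- x) = - zt_eval x.
Proof. by rewrite /zt_eval -hornerN. Qed.

Lemma zt_evalM x y : zt_eval (x * y) = zt_eval x * zt_eval y.
Proof.
rewrite /zt_eval -hornerM.
have hM : ('X^2 - 1 : {poly int}) \is monic by apply: monicXnsubC.
rewrite poly_of_qpolyM; move: ((x : {poly int}) * y) => p.
rewrite mk_monic_X2sub1 [in RHS](Pdiv.RingMonic.rdivp_eq hM p).
rewrite hornerD hornerM hornerD hornerN hornerXn hornerC.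
by rewrite [a ^+ 2]expr2 a2 subrr mulr0 add0r.
Qed.

Lemma zt_eval1 : zt_eval 1 = 1.
Proof. by rewrite /zt_eval (qpolyC_natr _ 1) hornerC. Qed.

Lemma zt_evalt : zt_eval t = a.
Proof. by rewrite /zt_eval /t qpolyXE ?size_XnsubC ?monicXnsubC // hornerX. Qed.

Lemma zt_eval0 : zt_eval 0 = 0.
Proof. exact: horner0. Qed.

Lemma zt_eval_nat (m : nat) : zt_eval m%:R = m%:R.
Proof.
by elim: m => [|m IH]; rewrite ?zt_eval0 // -!natr1 zt_evalD IH zt_eval1.
Qed.

Lemma zt_eval_int (m : int) : zt_eval m%:~R = m.
Proof.
case: m => m; first by rewrite -pmulrn zt_eval_nat natz.
by rewrite NegzE mulrNz zt_evalN -pmulrn zt_eval_nat natz.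
Qed.

End Evaluation.

Lemma sgtE x : sgt x = Num.sg (zt_eval 1 x).
Proof.
rewrite /sgt /zt_eval; congr Num.sg.
have sx : (size (x : {poly int}) <= 2)%N.
  apply: leq_trans (size_npoly x) _.
  by rewrite mk_monic_X2sub1 size_XnsubC.
by rewrite (horner_coef_wide _ sx) !big_ord_recr big_ord0 /= add0r !expr1n !mulr1.
Qed.

Lemma sgtM x y : sgt (x * y) = sgt x * sgt y.
Proof. by rewrite !sgtE zt_evalM ?mulr1 // sgrM. Qed.

Lemma sgtN x : sgt (- x) = - sgt x.
Proof. by rewrite !sgtE zt_evalN sgrN. Qed.

Lemma sgt_t x : sgt (t * x) = sgt x.
Proof. by rewrite sgtM !sgtE zt_evalt // sgr1 mul1r. Qed.

Lemma sgt_int (m : int) : sgt m%:~R = Num.sg m.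
Proof. by rewrite sgtE zt_eval_int. Qed.

Lemma mult (x : Zt) : t * (t * x) = x.
Proof. by rewrite mulrA t_square mul1r. Qed.

Lemma sgt_cases x : [\/ sgt x = 0, sgt x = 1 | sgt x = -1].
Proof.
rewrite sgtE; case: (sgrP (zt_eval 1 x)) => _; [constructor 1|constructor 2|constructor 3] => //.
Qed.

Section InverseMutation.
Variable n : nat.
Implicit Types B : 'M[Zt]_n.

(* Only the images of the entries under [t |-> 1] matter for the inverse of a
   mutation: skew-symmetrizability kills the diagonal there. *)
Definition sign_skew B := exists d : 'I_n -> nat, (forall i, (0 < d i)%N) /\
  forall i j, (d i)%:R * zt_eval 1 (B i j) = - ((d j)%:R * zt_eval 1 (B j i)).

Lemma gss_sign_skew B : is_gss B -> sign_skew B.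
Proof.
case=> d [d0 dB]; exists d; split=> // i j.
have := congr1 (zt_eval 1) (dB i j).
by rewrite zt_evalN !zt_evalM ?mulr1 // !zt_eval_nat.
Qed.

Lemma sign_skew_sgt B i j : sign_skew B -> sgt (B j i) = - sgt (B i j).
Proof.
case=> d [d0 dB]; have := congr1 Num.sg (dB i j).
have sd l : Num.sg ((d l)%:R : int) = 1 by rewrite gtr0_sg ?ltr0n.
by rewrite sgrN !sgrM !sgtE !sd !mul1r => ->; rewrite opprK.
Qed.

Lemma sign_skew_diag B i : sign_skew B -> sgt (B i i) = 0.
Proof. by move/(sign_skew_sgt i i); lia. Qed.

Lemma mutation_sgt k B i j : sign_skew B ->
  zt_eval 1 (mutation k B i j) =
  if (i == k) || (j == k) then - zt_eval 1 (B i j)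
  else if sgt (B i k * B k j) == 1
    then zt_eval 1 (B i j) + sgt (B i k) * zt_eval 1 (B i k) * zt_eval 1 (B k j)
  else zt_eval 1 (B i j).
Proof.
move=> skB; rewrite mxE.
have z0 : sgt (B i j) = 0 -> zt_eval 1 (B i j) = 0.
  by rewrite sgtE => /eqP; rewrite sgr_eq0 => /eqP.
have kk : sgt (B k k) = 0 by apply: sign_skew_diag.
have [ik|ik] := eqVneq i k; have [jk|jk] := eqVneq j k; rewrite /= ?andbF ?orbF.
- by subst; rewrite kk /= sgtM kk mulr0 /= z0.
- subst i; case: (sgt_cases (B k j)) => E; rewrite E /=.
  + by rewrite sgtM kk mul0r /= z0.
  + by rewrite zt_evalN.
  + by rewrite zt_evalN zt_evalM ?mulr1 // zt_evalt mul1r.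
- subst j; case: (sgt_cases (B i k)) => E; rewrite E /=.
  + by rewrite sgtM kk mulr0 /= z0.
  + by rewrite zt_evalN zt_evalM ?mulr1 // zt_evalt mul1r.
  + by rewrite zt_evalN.
case: ifP => // _; rewrite zt_evalM ?mulr1 // zt_evalt mul1r zt_evalD.
by rewrite !zt_evalM ?mulr1 // zt_eval_int.
Qed.

Lemma mutation_sign_skew k B : sign_skew B -> sign_skew (mutation k B).
Proof.
move=> skB; have [d [d0 dB]] := skB; exists d; split=> // i j.
rewrite !mutation_sgt // [(j == k) || _]orbC; case: ifP => _.
  by rewrite !mulrN dB.
have E : sgt (B i k * B k j) = sgt (B j k * B k i).
  rewrite !sgtM (sign_skew_sgt k i) // (sign_skew_sgt j k) //.
  by rewrite mulrNN mulrC.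
rewrite -E; case: ifP => // /eqP s1; rewrite !mulrDr opprD dB; congr (_ + _).
have s2 : sgt (B j k) = - sgt (B i k).
  move: s1; rewrite sgtM (sign_skew_sgt j k) //.
  case: (sgt_cases (B i k)) => ->; case: (sgt_cases (B j k)) => -> //.
have := dB k j; have := dB i k; rewrite s2; move: (sgt _) => s.
move: (zt_eval 1 (B i k)) (zt_eval 1 (B k i)) (zt_eval 1 (B k j)) (zt_eval 1 (B j k)).
move=> x y z w e1 e2.
have -> : (d i)%:R * (s * x * z) = s * z * ((d i)%:R * x) by ring.
have -> : s * z * ((d i)%:R * x) = - (s * y) * ((d k)%:R * z) by rewrite e1; ring.
by rewrite e2; ring.
Qed.

(** An entry of nonzero sign in row or column [k] is multiplied once by -1 and once by [-t], because
    its sign changes in between; the additions elsewhere cancel. As [t^2 = 1], the fourth power of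
    the mutation is the identity, so its cube is its inverse. *)
Lemma mutation_square k B i j : sign_skew B ->
  mutation k (mutation k B) i j =
  if ((i == k) (+) (j == k)) && (sgt (B i j) != 0) then t * B i j else B i j.
Proof.
move=> skB; have kk : sgt (B k k) = 0 by apply: sign_skew_diag.
have rowk l : l != k -> mutation k B k l =
    if sgt (B k l) == 1 then - B k l else if sgt (B k l) == -1 then - (t * B k l) else B k l.
  by move=> lk; rewrite mxE eqxx (negbTE lk) /= !orbF sgtM kk mul0r.
have colk l : l != k -> mutation k B l k =
    if sgt (B l k) == -1 then - B l k else if sgt (B l k) == 1 then - (t * B l k) else B l k.
  by move=> lk; rewrite mxE eqxx (negbTE lk) /= sgtM kk mulr0.
have kkE : mutation k B k k = B k k.
  by rewrite mxE eqxx kk /= sgtM kk mulr0.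
have kk' : sgt (mutation k B k k) = 0 by rewrite kkE.
rewrite [LHS]mxE; have [->|ik] := eqVneq i k; have [->|jk] := eqVneq j k; rewrite /= ?andbF ?orbF.
- by rewrite kk' /= sgtM kk' mulr0 /= kkE.
- rewrite sgtM kk' mul0r rowk //.
  case: (sgt_cases (B k j)) => E; rewrite !E /=.
  + by rewrite ?E.
  + by rewrite sgtN E /= mulrN opprK.
  + by rewrite sgtN sgt_t E /= opprK.
- rewrite sgtM kk' mulr0 colk //.
  case: (sgt_cases (B i k)) => E; rewrite !E /=.
  + by rewrite ?E.
  + by rewrite sgtN sgt_t E /= opprK.
  + by rewrite sgtN E /= mulrN opprK.
rewrite rowk // colk // mxE (negbTE ik) (negbTE jk) /=.
case: (sgt_cases (B i k)) => E1; case: (sgt_cases (B k j)) => E2;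
  rewrite ?sgtM ?E1 ?E2 /= ?sgtN ?sgt_t ?E1 ?E2 //=.
- rewrite mulrN1z mul1r mulN1r opprK mulrN -!mulrA -mulrBr addrK.
  exact: mult.
- rewrite opprK mulr1z mul1r mulrN1z !mulN1r mulrNN mulNr mulrCA -mulrDr subrK.
  exact: mult.
Qed.

Lemma mutation_inverse k B : sign_skew B ->
  mutations [:: k; k; k] (mutation k B) = B.
Proof.
move=> skB; apply/matrixP => i j /=.
rewrite mutation_square; last by do 2!apply: mutation_sign_skew.
rewrite !mutation_square //; case: ((i == k) (+) (j == k)) => //=.
by case s1: (sgt (B i j) != 0); rewrite ?sgt_t s1 ?mult.
Qed.

Lemma mutations_cat ks ks' B :
  mutations (ks ++ ks') B = mutations ks' (mutations ks B).
Proof. exact: foldl_cat. Qed.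

Lemma mutations_inverse ks B : sign_skew B ->
  exists ks', B = mutations ks' (mutations ks B).
Proof.
elim: ks B => [|k ks IH] B skB; first by exists [::].
have [ks' E] := IH _ (mutation_sign_skew k skB).
exists (ks' ++ [:: k; k; k]).
by rewrite mutations_cat -[mutations (k :: ks) B]/(mutations ks (mutation k B)) -E mutation_inverse.
Qed.

End InverseMutation.

(** * The signed matrix of an orientation and a Cartan counterpart *)

Definition zt (b : bool) (m : int) : Zt := (if b then t else 1) * m%:~R.

Lemma ztN b m : - zt b m = zt b (- m).
Proof. by rewrite /zt mulrNz mulrN. Qed.

Lemma ztt b m : t * zt b m = zt (~~ b) m.
Proof. by rewrite /zt mulrA; case: b; rewrite /= ?t_square ?mulr1. Qed.

Lemma ztD b m m' : zt b m + zt b m' = zt b (m + m').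
Proof. by rewrite /zt -mulrDr -intrD. Qed.

Lemma ztM b b' m m' : zt b m * zt b' m' = zt (b (+) b') (m * m').
Proof.
rewrite /zt mulrACA -intrM; congr (_ * _).
by case: b; case: b'; rewrite /= ?t_square ?mulr1 ?mul1r.
Qed.

Lemma zt0 b : zt b 0 = 0. Proof. by rewrite /zt mulr0. Qed.

Lemma sgt_zt b m : sgt (zt b m) = Num.sg m.
Proof. by rewrite /zt; case: b; rewrite ?sgt_t ?mul1r sgt_int. Qed.

Lemma zt_evalN1 b m : zt_eval (-1) (zt b m) = (-1) ^+ b * m.
Proof.
have e1 : (-1) * (-1) = 1 :> int by [].
rewrite /zt zt_evalM // zt_eval_int; congr (_ * _).
by case: b; rewrite ?zt_evalt ?zt_eval1.
Qed.

Section CartanMatrices.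
Variable n : nat.
Implicit Types (o : rel 'I_n) (C : 'M[int]_n).

Definition arrow_entry o C i j : int :=
  if o i j then `|C i j| else if o j i then - `|C i j| else 0.

Definition gss_mx o C : 'M[Zt]_n :=
  \matrix_(i, j) zt (sign_of (C i j)) (arrow_entry o C i j).

Lemma gss_ofE (S : svquiver n) : gss_of S = gss_mx (arr S) (cartan S).
Proof.
apply/matrixP => i j; rewrite !mxE /arrow_entry.
have [aij|aij] := boolP (arr S i j).
  have ij : i != j by apply: contraTneq aij => ->; rewrite arr_irr.
  rewrite mxE (negbTE ij) aij /arr_sign /sign_of; case: ltP => h.
    by rewrite ltr0_norm // /zt mulrNz mulrN.
  by rewrite ger0_norm // /zt mul1r.
have [aji|aji] := boolP (arr S j i); last by rewrite zt0.
have ij : i != j by apply: contraTneq aji => ->; rewrite arr_irr.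
rewrite mxE (negbTE ij) (negbTE aij) aji /arr_sign /sign_of.
have -> : (v1 S j i < 0) = (v2 S j i < 0).
  by have [E _] := val_sign aji; rewrite -sgr_lt0 E sgr_lt0.
case: ltP => h.
  by rewrite ltr0_norm // /zt opprK.
by rewrite ger0_norm // /zt mul1r mulrNz.
Qed.

Lemma sgr_arrow_entry o C i j :
  (forall i j, o i j -> ~~ o j i) ->
  (forall i j, i != j -> (C i j != 0) = o i j || o j i) ->
  Num.sg (arrow_entry o C i j) = if o i j then 1 else if o j i then -1 else 0.
Proof.
move=> asym arrC; have [->|ij] := eqVneq i j.
  have ojj : o j j = false by apply/negbTE/negP => h; have := asym _ _ h; rewrite h.
  by rewrite /arrow_entry ojj sgr0.
have := arrC i j ij; rewrite /arrow_entry.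
case: (o i j) => /= nz; first by rewrite gtr0_sg // normr_gt0.
case: (o j i) nz => /= nz; last by rewrite sgr0.
by rewrite sgrN gtr0_sg // normr_gt0.
Qed.

Lemma signed_arrow_entry o C i j :
  (forall i j, i != j -> (C i j != 0) = o i j || o j i) -> i != j ->
  (-1) ^+ sign_of (C i j) * arrow_entry o C i j =
  if o i j then C i j else - C i j.
Proof.
move=> arrC ij; have := arrC i j ij; rewrite /arrow_entry /sign_of.
case: (o i j) => /= nz; first by rewrite [RHS]realEsign ?num_real.
case: (o j i) nz => /= nz; first by rewrite mulrN -realEsign ?num_real.
by move/negbFE/eqP: nz => ->; rewrite mulr0 oppr0.
Qed.

(** At [t = 1] the sign of an entry tells the direction of the arrow. At [t = -1] the value is the
    Cartan entry, up to a sign that the direction determines. *)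
Lemma gss_mx_inj (R : rcfType) o C (d : 'I_n -> R) (S : svquiver n) :
  good_orientation o C d -> gss_of S = gss_mx o C ->
  arr S =2 o /\ cartan S = C.
Proof.
move=> G E; have eqs i j : zt (sign_of (cartan S i j)) (arrow_entry (arr S) (cartan S) i j) =
    zt (sign_of (C i j)) (arrow_entry o C i j).
  by have /matrixP/(_ i j) := etrans (esym (gss_ofE S)) E; rewrite !mxE.
have oE : arr S =2 o.
  move=> i j; have := congr1 sgt (eqs i j); rewrite !sgt_zt !sgr_arrow_entry //.
  - by case: (arr S i j); case: (o i j); case: (arr S j i); case: (o j i).
  - exact: good_asym G.
  - exact: good_arr G.
  - exact: arr_asym.
  - exact: cartan_arr.
split=> //; apply/matrixP => i j; have [->|ij] := eqVneq i j.
  by rewrite cartan_diag (qc_diag (good_qc G)).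
have := congr1 (zt_eval (-1)) (eqs i j); rewrite !zt_evalN1 !signed_arrow_entry //.
- by rewrite oE; case: ifP => // _ /oppr_inj.
- exact: good_arr G.
- exact: cartan_arr.
Qed.

Lemma sign_ofM (a b : int) : a != 0 -> b != 0 ->
  sign_of (a * b) = sign_of a (+) sign_of b.
Proof. move=> a0 b0; rewrite /sign_of -[a * b < 0]sgz_lt0 sgzM.
by case: (sgzP a) a0; case: (sgzP b) b0. Qed.

(** When [a] and [p] have the same sign and [|a| <= |p|], the difference [a - p] has absolute value
    [|p| - |a|] and, unless zero, the sign opposite to [p]. *)
Lemma zt_cancel (a p : int) : p != 0 -> `|a| <= `|p| ->
  (a != 0 -> sign_of a = sign_of p) ->
  zt (~~ sign_of p) (`|p| - `|a|) = zt (sign_of (a - p)) `|a - p|.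
Proof.
move=> p0 ap; have [-> _|a0 /(_ isT)] := eqVneq a 0.
  rewrite normr0 subr0 sub0r normrN; congr zt; rewrite /sign_of; lia.
have [->|apn] := eqVneq a p; first by rewrite !subrr normr0 !zt0.
by rewrite /sign_of => s; congr zt; lia.
Qed.

(** The substance is the case i -> k -> j. By [in_out_ok], [C i j] has the sign of [C i k * C k j]
    and at most its absolute value, and an arrow between [i] and [j] goes from [j] to [i]. So the
    two terms of the mutated entry carry the same power of [t] and opposite signs. The extra factor
    [t] accounts for the sign of [C i j - C i k * C k j]. The case j -> k -> i follows with the
    opposite orientation. *)
Lemma mutation_gss_mx (R : rcfType) o C (d : 'I_n -> R) k :
  good_orientation o C d ->
  mutation k (gss_mx o C) =
    gss_mx (arrow_mutation k o C) (cartan_mutation k (o^~ k) C).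
Proof.
move=> G; apply/matrixP => i j; pose o' := arrow_mutation k o C.
pose C' := cartan_mutation k (o^~ k) C.
have sE u v : sgt (gss_mx o C u v) = if o u v then 1 else if o v u then -1 else 0.
  rewrite mxE sgt_zt sgr_arrow_entry //; [exact: good_asym G|exact: good_arr G].
have asym u v : o u v -> o v u = false := @good_arr_asym _ _ _ _ _ G u v.
have kk : sgt (gss_mx o C k k) = 0 by rewrite sE (good_irr G).
have nz u v : o u v -> (C u v != 0) * (C v u != 0).
  by move=> ouv; rewrite (good_arr_adj G ouv) (good_arr_adjr G ouv).
rewrite [LHS]mxE [RHS]mxE -/o' -/C'.
have [->|ik] := eqVneq i k; have [->|jk] := eqVneq j k.
- rewrite kk /= sgtM kk mulr0 /= mxE /arrow_entry /o' arrow_mutation_k.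
  by rewrite (good_irr G) !zt0.
- rewrite !sE sgtM kk mul0r !orbF [gss_mx _ _ _ _]mxE /arrow_entry.
  rewrite /C' (mutation_k G) // /o' arrow_mutation_k arrow_mutation_rk.
  case okj: (o k j) => /=.
    by rewrite (asym _ _ okj) ztN.
  case ojk: (o j k) => /=; last by rewrite !zt0.
  by rewrite ztt ztN opprK normrN /sign_of oppr_lt0 -leNgt lt0r (nz _ _ ojk).
- rewrite !sE sgtM kk mulr0 [gss_mx _ _ _ _]mxE /arrow_entry.
  rewrite /C' (mutation_rk G) // /o' arrow_mutation_k arrow_mutation_rk /=.
  case oik: (o i k) => /=.
    rewrite (asym _ _ oik) ztt ztN normrN /sign_of oppr_lt0.
    by rewrite lt0r (nz _ _ oik) -leNgt.
  by case oki: (o k i) => /=; rewrite ?ztN ?opprK ?zt0.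
have gE u v : gss_mx o C u v = zt (sign_of (C u v)) (arrow_entry o C u v).
  by rewrite mxE.
rewrite /= sgtM !sE.
have Bij (o1 : rel 'I_n) : good_orientation o1 C d -> o1 i k -> o1 k j ->
    o1 i j = false /\ zt (sign_of (C i j)) (- `|C i j|) =
    zt (sign_of (C i k * C k j)) (- `|C i j|).
  move=> G1 oik okj; have oij : o1 i j = false.
    apply/negbTE/negP => h; have [oji _ _ _ _] := in_out_triangle G1 oik okj (good_arr_adj G1 h).
    by have := good_asym G1 h; rewrite oji.
  split=> //; have [->|C0] := eqVneq (C i j) 0; first by rewrite normr0 oppr0 !zt0.
  have [P _ _] := in_out_ok G1 oik okj C0.
  have [p1 p2] : C i k != 0 /\ C k j != 0.
    by split; [exact: (good_arr_adj G1 oik)|exact: (good_arr_adj G1 okj)].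
  have [q1 q2] : sign_of (C j k) = sign_of (C k j) /\ sign_of (C k i) = sign_of (C i k).
    by split; apply: (qc_sign (good_qc G1)).
  have [r1 r2] : C j k != 0 /\ C k i != 0.
    by split; [exact: (good_arr_adjr G1 okj)|exact: (good_arr_adjr G1 oik)].
  have : sign_of (C i j * C j k * C k i) = false by rewrite /sign_of ltNge ltW.
  rewrite !sign_ofM ?mulf_neq0 // q1 q2 => h; congr zt; move: h.
  by case: (sign_of (C i j)); case: (sign_of (C k j)); case: (sign_of (C i k)).
have cancel (o1 : rel 'I_n) : good_orientation o1 C d -> o1 i k -> o1 k j ->
    zt (~~ sign_of (C i k * C k j)) (`|C i k * C k j| - `|C i j|) =
    zt (sign_of (C i j - C i k * C k j)) `|C i j - C i k * C k j|.
  move=> G1 oik okj.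
  have p0 : C i k * C k j != 0.
    by rewrite mulf_neq0 //; [exact: (good_arr_adj G1 oik)|exact: (good_arr_adj G1 okj)].
  have [C0|C0] := eqVneq (C i j) 0; first by apply: zt_cancel; rewrite ?C0 ?normr0 ?eqxx.
  have [_ le _] := in_out_ok G1 oik okj C0.
  apply: zt_cancel => // _; have [_] := Bij _ G1 oik okj.
  move/(congr1 (zt_eval (-1))); rewrite !zt_evalN1.
  have n0 : - `|C i j| != 0 by rewrite oppr_eq0 normr_eq0.
  by move/(mulIf n0); case: (sign_of _); case: (sign_of _).
have inout_neq (o1 : rel 'I_n) : good_orientation o1 C d -> o1 i k -> o1 k j -> i != j.
  by move=> G1 oik; apply: contraTneq => <-; rewrite (good_arr_asym G1 oik).
have arrC u v : u != v -> (C u v != 0) = o u v || o v u := @good_arr _ _ _ _ _ G u v.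
have arrC' u v : u != v -> (C' u v != 0) = o' u v || o' v u :=
  @good_arr _ _ _ _ _ (good_mutation G k) u v.
have [/andP[oik okj]|h1] := boolP (o i k && o k j).
  have ij := inout_neq _ G oik okj.
  have [oij BE] := Bij _ G oik okj.
  rewrite oik okj mul1r /= mul1r !gE /arrow_entry oij oik okj.
  have -> : (if o j i then - `|C i j| else 0) = - `|C i j|.
    have := arrC i j ij; rewrite oij /=; case: (o j i) => // /negbFE/eqP->.
    by rewrite normr0 oppr0.
  rewrite BE ztM -normrM -sign_ofM ?(nz _ _ oik) ?(nz _ _ okj) // ztD ztt addrC.
  rewrite (cancel _ G oik okj) /C' (mutation_in_out G oik okj) /o'.
  rewrite (arrow_mutation_out_in G oik okj) (arrow_mutation_in_out G oik okj).
  rewrite (mutation_in_out G oik okj).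
  by have [->|//] := eqVneq (C i j - C i k * C k j) 0; rewrite normr0 !zt0.
have [/andP[ojk oki]|h2] := boolP (o j k && o k i).
  have Gop := good_opposite G.
  have ij := inout_neq _ Gop oki ojk.
  have [oji BE] := Bij _ Gop oki ojk; rewrite /= in oji.
  rewrite oki ojk (asym _ _ oki) (asym _ _ ojk) mulrNN mulr1 /= mulrN1z mulN1r.
  rewrite !gE /arrow_entry oji oki ojk (asym _ _ oki) (asym _ _ ojk).
  have -> : (if o i j then `|C i j| else 0) = `|C i j|.
    have := arrC i j ij; rewrite oji orbF; case: (o i j) => // /negbFE/eqP->.
    by rewrite normr0.
  rewrite ztN opprK ztM mulrN -normrM -sign_ofM ?(nz _ _ oki) ?(nz _ _ ojk) //.
  rewrite -[zt (sign_of (C i j)) _]opprK ztN BE ztN opprK ztD ztt.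
  rewrite -[`|C i j| - _]opprB -ztN (cancel _ Gop oki ojk) /C' (mutation_out_in G ojk oki) /o'.
  rewrite (arrow_mutation_out_in G ojk oki) (arrow_mutation_in_out G ojk oki).
  have -> : (cartan_mutation k (o^~ k) C j i != 0) = (C' i j != 0).
    exact: (qc_adjC (qc' G k)).
  rewrite /C' (mutation_out_in G ojk oki) ztN.
  by have [->|//] := eqVneq (C i j - C i k * C k j) 0; rewrite normr0 oppr0 !zt0.
rewrite (_ : _ == 1 = false); last first.
  move: h1 h2; case: (o i k) (asym i k) => [|_]; case: (o k i) => //; case: (o k j) (asym k j) => [|_];
    case: (o j k) => //; by do ?[move/(_ isT)].
rewrite /C' (mutation_other G ik jk h1 h2) [LHS]mxE /arrow_entry /o'.
rewrite (arrow_mutation_other _ ik jk h1 h2) (arrow_mutation_other _ jk ik h2 h1).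
by rewrite (mutation_other G ik jk h1 h2).
Qed.

End CartanMatrices.

(** Mutation equivalence allows sequences in both directions, but signed mutations are invertible,
    so the matrix is always reached from the Dynkin one; along the way the orientation stays
    good. *)
Theorem mutation_dynkin_good (R : rcfType) n (B : 'M[Zt]_n) :
  mutation_dynkin B -> exists (o : rel 'I_n) (C : 'M[int]_n) (d : 'I_n -> R),
    good_orientation o C d /\ B = gss_mx o C.
Proof.
case=> gssB [B0 [[gssB0 _ [S [SB0 dS]]] eqv]].
have [D tD isoD] := dynkin_tame dS.
have [d G0] := tame_good R tD isoD.
have [ks ->] : exists ks, B = mutations ks B0.
  case: eqv => ks [E|E]; last by exists ks.
  have [ks' E'] := mutations_inverse ks (gss_sign_skew gssB).
  by exists ks'; rewrite E -E'.
rewrite -SB0 gss_ofE; move: (arr S) (cartan S) G0 => o C.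
elim: ks o C => [|k ks IH] o C G; first by exists o, C, d.
rewrite -[mutations _ _]/(mutations ks (mutation k _)) (mutation_gss_mx k G).
exact: IH (good_mutation G k).
Qed.

(** * Long vertices on chordless cycles *)

Section LongVertices.
Variables (R : rcfType) (n : nat) (C : 'M[int]_n) (d : 'I_n -> R).
Hypothesis qc : quasi_cartan C d.
Let adj : rel 'I_n := fun i j => C i j != 0.
Let adjC : symmetric adj. Proof. exact: qc_adjC qc. Qed.
Let ccP j i s : chordless_cycle C (j :: i :: s) <->
  [/\ uniq (j :: i :: s), s != [::], chordless_path adj (i :: s), adj j i &
      {in s, forall v, adj j v = (v == last i s)}].
Proof. exact: chordless_cycleP adjC j i s. Qed.

Lemma long_in_cycleP s u :
  reflect (exists2 v, v \in s & adj u v /\ d u < d v) (long_in_cycle C s u).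
Proof.
apply: (iffP hasP) => [[v vs h]|[v vs [uv duv]]]; exists v => //.
  have uv : adj u v.
    rewrite /adj; apply: contraTneq h => uv0.
    have : C v u == 0 by have := adjC v u; rewrite /adj uv0 eqxx => /negbFE.
    by move/eqP->; rewrite uv0 ltxx.
  by rewrite -(qc_long qc uv).
by rewrite (qc_long qc uv).
Qed.

Lemma long_in_cycle_mem s s' u : s =i s' ->
  long_in_cycle C s u = long_in_cycle C s' u.
Proof. by move=> ss; apply: eq_has_r. Qed.

Lemma long_multiple_edge s u : u \in s -> long_in_cycle C s u ->
  cycle_has_multiple_edge C s.
Proof.
move=> us /long_in_cycleP[v vs [uv duv]]; apply/hasP; exists u => //.
apply/hasP; exists v => //; have nuv : u != v.
  by apply: contraTneq duv => ->; rewrite ltxx.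
rewrite nuv /=; have := qc_wt_gt0 qc uv; have := duv.
rewrite -(qc_long qc uv) => h w0.
have vu : adj v u by rewrite adjC.
have : 1 <= `|C v u| by rewrite -gtz0_ge1 normr_gt0.
have -> : C u v * C v u = `|C u v| * `|C v u| by rewrite -normrM gtr0_norm.
by move: h; move: (`|C u v|) (`|C v u|) => a b; nia.
Qed.

Lemma cycle_neighbours k j t i v : chordless_cycle C (k :: j :: rcons t i) ->
  v \in k :: j :: rcons t i -> adj k v -> v != k -> v = j \/ v = i.
Proof.
case/ccP=> u _ _ _ kt; rewrite !in_cons => vs kv vk.
move: vs; rewrite (negbTE vk) /= => /orP[/eqP|vt]; first by left.
by right; move: kv; rewrite kt // last_rcons => /eqP.
Qed.

Lemma chordless_cycle_swap k j t i :
  chordless_cycle C (k :: j :: rcons t i) -> chordless_cycle C (k :: i :: rcons (rev t) j).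
Proof.
move/chordless_cycle_rev.
rewrite !rev_cons rev_rcons -cats1 => /chordless_cycle_cat.
by rewrite cat1s rcons_cons.
Qed.

Lemma chordless_cycle_ends k j t i : chordless_cycle C (k :: j :: rcons t i) ->
  adj k j * adj k i.
Proof.
move=> cc; case/ccP: (cc) => _ _ _ -> _.
by case/chordless_cycle_swap/ccP: cc => _ _ _ -> _.
Qed.

(** The product of the two entries is less than 4, so if one exceeds 1 in absolute value, the other
    is 1 or -1. *)
Lemma entry_norm_gt1 u v : u != v -> adj u v -> `|C u v| != 1 -> d u < d v.
Proof.
move=> uv auv; rewrite -(qc_long qc auv) => c1.
have := qc_wt_lt4 qc uv; have := qc_wt_gt0 qc auv.
have vu : adj v u by rewrite adjC.
have : 1 <= `|C v u| by rewrite -gtz0_ge1 normr_gt0.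
have : 1 <= `|C u v| by rewrite -gtz0_ge1 normr_gt0.
have EM : `|C u v * C v u| = `|C u v| * `|C v u| by rewrite normrM.
move=> h1 h2 w0; rewrite -(gtr0_norm w0) EM => w4.
by move: c1 h1 h2 w4; move: (`|C u v|) (`|C v u|) => a b; nia.
Qed.

Lemma chordless_triangle_adj v w u : chordless_cycle C [:: v; w; u] -> adj w u.
Proof. by case/ccP=> _ _ /=; rewrite !andbT. Qed.

Lemma swap_mem (k j i : 'I_n) t : k :: j :: rcons t i =i k :: i :: rcons (rev t) j.
Proof. by move=> x; rewrite !inE !mem_rcons !inE mem_rev; case: (x == k) (x == j) (x == i) => [] [] []. Qed.

(** If [|C v u|] were larger than [|C v w|], then [v] would be long because of [u]. In a triangle,
    [|C v u| <= |C v w * C w u|] makes [w] long because of [u]. A longer cycle is the square of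
    [chordless_cycle_d], where [w] is long because of its other neighbour. *)
Lemma long_ends_le v w u t : chordless_cycle C (v :: w :: rcons t u) ->
  let s := v :: w :: rcons t u in
  ~~ (long_in_cycle C s v && long_in_cycle C s w) -> `|C v u| <= `|C v w|.
Proof.
move=> cc s; apply: contraR; rewrite -ltNge => lt_vw_vu.
have [avw avu] := chordless_cycle_ends cc.
have u1 : uniq (v :: w :: rcons t u) by case: cc.
move: u1; rewrite [uniq _]/= !inE !mem_rcons !inE !negb_or.
move=> /andP[/and3P[vw vu _] /andP[/andP[wu _] _]].
rewrite -/s.
have dvu : d v < d u.
  apply: entry_norm_gt1 => //; have : 1 <= `|C v w| by rewrite -gtz0_ge1 normr_gt0.
  by move: lt_vw_vu; case: eqP => [->|//]; move: (`|C v w|) => x; lia.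
have us : u \in s by rewrite !inE mem_rcons mem_head !orbT.
apply/andP; split; first by apply/long_in_cycleP; exists u.
apply/long_in_cycleP; have [t0|t0] := posnP (size t).
  exists u => //; move/eqP: t0 cc {us s}; rewrite size_eq0 => /eqP-> /= cc.
  have awu := chordless_triangle_adj cc; split=> //.
  apply: entry_norm_gt1 => //; apply: contraTneq lt_vw_vu => wu1.
  have u3 : uniq [:: v; u; w] by rewrite /= !inE negb_or vu vw eq_sym wu.
  have auw : adj u w by rewrite adjC.
  have awv : adj w v by rewrite adjC.
  have [tr E] := qc_triangle qc u3 avu auw awv; move: tr; rewrite /triangle_ok E eqxx -E (qc_det3 qc u3) /=.
  by case/and4P=> _; rewrite normrM wu1 mulr1 -leNgt.
have cc' := chordless_cycle_swap cc.
have [||l [x [E dx dl]]] := chordless_cycle_d qc cc'.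
- by rewrite size_rcons size_rev ltnS.
- by rewrite lt_eqF.
have [/(congr1 rev) tE wx] := @rcons_inj _ (rev t) [:: l] w x E.
move: tE; rewrite revK /= => tE {us}; subst t x.
exists l; first by rewrite /s !inE eqxx !orbT.
have /= ccw := chordless_cycle_cat (s1 := [:: v]) cc.
by rewrite dx dl; split=> //; case: (chordless_cycle_ends (t := [:: u]) ccw).
Qed.

(** In a triangle the third vertex has the largest [d]. A longer cycle is the square of
    [chordless_cycle_d], where [d] takes two values, each on two adjacent vertices, and the long
    vertices are the two with the smaller value. So at most one place to open a cycle is
    forbidden. *)
Lemma long_ends_only k j t i : chordless_cycle C (k :: j :: rcons t i) ->
  let s := k :: j :: rcons t i in
  long_in_cycle C s k -> long_in_cycle C s i ->
  {in j :: t, forall x, ~~ long_in_cycle C s x}.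
Proof.
move=> cc s lk li; rewrite {}/s in lk li *.
case: (posnP (size t)) cc lk li => [/eqP|t0 cc lk li x xt].
  rewrite size_eq0 => /eqP-> _ /long_in_cycleP[v + [_ +]] /long_in_cycleP[w + [_ +]] x.
  rewrite !inE => + + + + /eqP->; move=> /or3P[] /eqP-> dkv /or3P[] /eqP-> diw;
    apply/long_in_cycleP => -[y + [_]]; rewrite !inE => /or3P[] /eqP->;
    move: dkv diw; lra.
have /long_in_cycleP[v vs [kv dkv]] := lk.
have vk : v != k by apply: contraTneq dkv => ->; rewrite ltxx.
apply/long_in_cycleP => -[y ys [_ dxy]].
have [dkj|dkj] := eqVneq (d k) (d j).
  have dki : d k < d i.
    by have [E|E] := cycle_neighbours cc vs kv vk; subst v; rewrite // dkj ltxx in dkv.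
  have [||l [z [E dz dl]]] :=
    chordless_cycle_d qc (chordless_cycle_swap cc).
  - by rewrite size_rcons size_rev ltnS.
  - by rewrite lt_eqF.
  have [/(congr1 rev) tE wz] := @rcons_inj _ (rev t) [:: l] j z E.
  move: tE; rewrite revK /= => tE; subst t z.
  have /long_in_cycleP[w] := li; rewrite !inE => /or4P[] /eqP-> [_]; rewrite ?dl ?dz; lra.
have [||l [z [E dz dl]]] := chordless_cycle_d qc cc.
- by rewrite size_rcons ltnS.
- by [].
have [tE wz] := @rcons_inj _ t [:: l] i z E.
subst t z; have dkj1 : d k < d j.
  by have [Ev|Ev] := cycle_neighbours cc vs kv vk; subst v; rewrite // dz ltxx in dkv.
by move: dxy ys; move: xt; rewrite !inE => /orP[] /eqP-> dxy /or4P[] /eqP Ey; subst y;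
   move: dxy; rewrite ?dl ?dz; lra.
Qed.

End LongVertices.

Section LongMutation.
Variables (R : rcfType) (n : nat) (o : rel 'I_n) (C : 'M[int]_n) (d : 'I_n -> R).
Hypothesis G : good_orientation o C d.
Variable k : 'I_n.
Let C' := cartan_mutation k (o^~ k) C.
Let qc1 : quasi_cartan C' d. Proof. exact: qc' G k. Qed.

Lemma mutation_long_pair j t i : chordless_cycle C' (k :: j :: rcons t i) ->
  t != [::] -> d i < d j -> long_in_cycle C' (k :: j :: rcons t i) i.
Proof.
move=> cc t0 dij; have [_ aki] := chordless_cycle_ends qc1 cc.
have aik : C' i k != 0 by move: aki; rewrite -/(is_true _) (qc_adjC qc1).
apply/(long_in_cycleP qc1); have [dik|dki] := ltP (d i) (d k).
  by exists k; rewrite ?mem_head.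
have [||l [z [E dz dl]]] := chordless_cycle_d qc1 cc.
- by rewrite size_rcons ltnS lt0n size_eq0.
- by rewrite lt_eqF // (le_lt_trans dki).
have [tE wz] := @rcons_inj _ t [:: l] i z E; subst t z; exists l.
  by rewrite !inE eqxx !orbT.
split; last by rewrite dl.
have /= ccl := chordless_cycle_rot 2 cc; rewrite /rot /= in ccl.
have [_] := chordless_cycle_ends qc1 (chordless_cycle_rot 1 ccl : chordless_cycle C' (i :: k :: rcons [:: j] l)).
by [].
Qed.

Lemma mutation_long j t i u : chordless_cycle C' (k :: j :: rcons t i) ->
  t != [::] -> o j k (+) o i k -> u \in j :: rcons t i ->
  long_in_cycle C (j :: rcons t i) u -> long_in_cycle C' (k :: j :: rcons t i) u.
Proof.
move=> cc t0 io us /(long_in_cycleP (good_qc G))[v vs [uv duv]].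
have uniq_s : uniq (k :: j :: rcons t i) by case: cc.
have [us_k vs_k] : u != k /\ v != k.
  by move: uniq_s => /= /andP[ks _]; split; apply: contraNneq ks => <-.
have nb w : w \in j :: rcons t i -> o w k || o k w -> w = j \/ w = i.
  move=> ws ow; have wk : w != k.
    by move: uniq_s => /= /andP[ks _]; apply: contraNneq ks => <-.
  apply: (cycle_neighbours qc1 cc) => //; first by rewrite inE ws orbT.
  by rewrite (mutation_adjk G) (good_arr G) 1?eq_sym // orbC.
have adj'k w : w != k -> o w k || o k w -> C' k w != 0.
  by move=> wk ow; rewrite (mutation_adjk G) (good_arr G) 1?eq_sym // orbC.
have pair x y : x \in j :: rcons t i -> y \in j :: rcons t i -> o x k && o k y ->
    x = j /\ y = i \/ x = i /\ y = j.
  move=> xs ys /andP[ox oy].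
  have xy : x != y.
    by apply: contraTneq ox => ->; rewrite (good_arr_asym G oy).
  have := nb y ys; have := nb x xs; rewrite ox oy orbT => /(_ isT)[]ex /(_ isT)[]ey;
    by [auto|rewrite ex ey eqxx in xy].
have swapped : u = j /\ v = i \/ u = i /\ v = j -> long_in_cycle C' (k :: j :: rcons t i) u.
  case=> [] [E1 E2]; subst u v; last exact: mutation_long_pair.
  rewrite (long_in_cycle_mem _ _ (swap_mem k j i t)).
  apply: mutation_long_pair => //; first exact: chordless_cycle_swap.
  by rewrite -size_eq0 size_rev size_eq0.
case: (boolP (o u k && o k v)) => [/(pair _ _ us vs)|h1]; first exact: swapped.
case: (boolP (o v k && o k u)) => [/(pair _ _ vs us) E|h2].
  by apply: swapped; case: E => [] []; auto.
apply/(long_in_cycleP qc1); exists v; first by rewrite inE vs orbT.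
by split=> //; rewrite (mutation_adj G).
Qed.
End LongMutation.

(** * Induction on presented algebras, and right-normed brackets *)

Lemma pres_lie_ind (K : fieldType) (X : Type) (R : lterm K X -> lterm K X -> Prop)
    (P : pres_lie R -> Prop) :
  P 0 -> (forall x y, P x -> P y -> P (x + y)) ->
  (forall a x, P x -> P (a *: x)) -> (forall x y, P x -> P y -> P {[x, y]}) ->
  (forall x, P (pres_gen x)) -> forall x, P x.
Proof.
move=> P0 PD PZ PB Pg; elim/quotW=> u; elim: u => [x||u Pu v Pv|u Pu|a u Pu|u Pu v Pv].
- exact: Pg.
- exact: P0.
- by have := PD _ _ Pu Pv; congr (P _); exact: proj_add.
- by have := PZ (-1) _ Pu; rewrite scaleN1r; congr (P _); exact: proj_opp.
- by have := PZ a _ Pu; congr (P _); exact: proj_scale.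
- by have := PB _ _ Pu Pv; congr (P _); exact: proj_br.
Qed.

Section RightBracket.
Variables (K : fieldType) (L : lieType K).
Implicit Types (x y : L) (s : seq L).

Fixpoint rbr s : L :=
  match s with [::] => 0 | [:: x] => x | x :: s' => {[x, rbr s']} end.

Lemma rbr_cons x s : s != [::] -> rbr (x :: s) = {[x, rbr s]}.
Proof. by case: s. Qed.

Lemma rbrZ a s1 x s2 : rbr (s1 ++ a *: x :: s2) = a *: rbr (s1 ++ x :: s2).
Proof.
have nn (z : L) s : s ++ z :: s2 != [::] by case: s.
elim: s1 => [|y s1 IH]; first by case: s2 {nn} => //= z s2; rewrite lbrZl.
by rewrite !cat_cons !rbr_cons // IH lbrZr.
Qed.

Lemma rbr_comm0 x s : {in s, forall y, {[x, y]} = 0} -> {[x, rbr s]} = 0.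
Proof.
elim: s => [|y [|z s] IH] xs; first by rewrite lbr0r.
  by apply: xs; rewrite mem_head.
rewrite rbr_cons // lbr_comm ?IH ?lbr0r // => [w ws|]; apply: xs.
  by rewrite in_cons ws orbT.
exact: mem_head.
Qed.

(** A derivation that kills all entries but one acts on that entry alone. *)
Lemma iter_rbr x m s1 y s2 : {in s1 ++ s2, forall z, {[x, z]} = 0} ->
  iter m (lbr x) (rbr (s1 ++ y :: s2)) = rbr (s1 ++ iter m (lbr x) y :: s2).
Proof.
move=> xs; elim: s1 xs => [|z s1 IH] xs.
  case: s2 xs => [//|z s2] xs; rewrite !cat0s.
  have E w : rbr (w :: z :: s2) = lbr w (rbr (z :: s2)) by [].
  rewrite !{}E iter_lbr_comml //; exact: rbr_comm0.
have nn (w : L) s : s ++ w :: s2 != [::] by case: s.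
rewrite !cat_cons !rbr_cons // iter_lbr_comm; last by apply: xs; rewrite mem_head.
by rewrite IH // => w ws; apply: xs; rewrite in_cons ws orbT.
Qed.

Lemma rbr0_cat s1 s2 : s2 != [::] -> rbr s2 = 0 -> rbr (s1 ++ s2) = 0.
Proof.
move=> s2n s20; elim: s1 => //= x s1 IH; case E: (s1 ++ s2) => [|y s].
  by case: s1 s2 E s2n {IH s20} => [|? ?] [|? ?].
by rewrite -E IH lbr0r.
Qed.

Definition far_comm s : Prop :=
  forall i j, (i.+1 < j < size s)%N -> {[nth 0 s i, nth 0 s j]} = 0.

(** When entries that are not neighbours commute, Jacobi gives [x, [y, W]] = [[x, y], W], so
    right-normed and left-normed brackets agree. Reversal then costs only a sign ([rbr_rev]). *)
Lemma rbr_foldl x s : far_comm (x :: s) -> rbr (x :: s) = foldl lbr x s.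
Proof.
elim: s x => [|y s IH] x // fc; rewrite rbr_cons //.
case: s fc IH => [//|z s] fc IH; rewrite rbr_cons //.
rewrite lbr_comml; last first.
  apply: rbr_comm0 => w /(nthP 0)[j js <-].
  by have := fc 0%N j.+2; apply; rewrite /= !ltnS.
rewrite -rbr_cons // IH // => i j /andP[ij js].
case: i j ij js => [|i] [|j] //= ij js.
  have f0 : {[x, nth 0 (z :: s) j]} = 0 by apply: (fc 0%N j.+2); rewrite /= !ltnS.
  have f1 : {[y, nth 0 (z :: s) j]} = 0.
    by apply: (fc 1%N j.+2); rewrite /= !ltnS in ij js *; rewrite ij.
  rewrite lbrC lbrJ (lbr_eq0C f0) (lbr_eq0C f1).
  by rewrite lbr0l lbr0r addr0 oppr0.
by apply: (fc i.+2 j.+2); rewrite /= !ltnS in ij js *; rewrite ij.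
Qed.

Lemma rbr_rev s : far_comm s -> exists b : bool, rbr (rev s) = (-1) ^+ b *: rbr s.
Proof.
case: s => [|x s]; first by exists false; rewrite scaler0.
move=> fc; rewrite rbr_foldl // {fc}.
suff [b ->] : exists b : bool, rbr (rev (x :: s)) = (-1) ^+ b *: foldl lbr x s by exists b.
elim/last_ind: s => [|s y [b IH]]; first by exists false; rewrite expr0 scale1r.
exists (~~ b); rewrite -rcons_cons rev_rcons rbr_cons; last by rewrite -size_eq0 size_rev.
by rewrite IH foldl_rcons lbrC lbrZl -scaleNr signrN.
Qed.

End RightBracket.

Lemma rbr_hom (K : fieldType) (L M : lieType K) (f : L -> M) s :
  lie_hom f -> f (rbr s) = rbr (map f s).
Proof.
case=> fD fZ fB; elim: s => [|x [|y s] IH] //.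
  by have := fZ 0 0; rewrite !scale0r.
by rewrite rbr_cons // fB IH.
Qed.

(** * Chevalley systems and the cycle relations *)

Section System.
Variables (K : fieldType) (n : nat).
Implicit Types (C : 'M[int]_n).

(** Relations (R1) to (R3) and the commuting case of (R4). The remaining Serre relations are
    replaced by local nilpotency, which implies them ([cs_serre]) and is easily transported along
    automorphisms. *)
Record chevalley_system (L : lieType K) C (h : 'I_n -> L) (e : bool -> 'I_n -> L) : Prop := {
  cs_hh : forall i j, {[h i, h j]} = 0;
  cs_ee : forall i, {[e false i, e true i]} = h i;
  cs_he : forall i eps j,
    {[h i, e eps j]} = ((-1) ^+ eps * (C i j)%:~R) *: e eps j;
  cs_comm : forall i j eps delta, i != j ->
    (C i j == 0) || ~~ (sign_of (C i j) (+) eps (+) delta) ->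
    {[e eps i, e delta j]} = 0;
  cs_nilp : forall eps i, locally_nilpotent (e eps i)
}.

(** Relation (R5) for one starting point and one direction, with both choices of the first sign; the
    signs are given by a compatible [eta]. *)
Definition cycle_rel (L : lieType K) C (e : bool -> 'I_n -> L) s : Prop :=
  forall eta, sorted (compat C eta) s -> rbr [seq e (eta v) v | v <- s] = 0.

(** The proviso of (R5) for the cycle opened before its first vertex. A long vertex of the cycle
    already forces a multiple edge ([long_multiple_edge]). *)
Definition cut_ok C (s : seq 'I_n) : bool := if s is i :: s' then
  ~~ (long_in_cycle C s i && long_in_cycle C s (last i s')) else false.

Definition gen_val (L : lieType K) (h : 'I_n -> L) (e : bool -> 'I_n -> L) (x : lie_gen n) :=
  match x with GenH i => h i | GenE eps i => e eps i end.

End System.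

Lemma rbr_cat2 (K : fieldType) (L : lieType K) s (x y : L) :
  rbr (s ++ [:: x; y]) = rbr (s ++ [:: {[x, y]}]).
Proof.
by elim: s => //= z s; case: (s) => //= a s' ->.
Qed.

Lemma rbr_weight (K : fieldType) (L : lieType K) (I : Type) (x : L) (y : I -> L)
    (wt : I -> K) s : (forall v, {[x, y v]} = wt v *: y v) ->
  {[x, rbr (map y s)]} = (\sum_(v <- s) wt v) *: rbr (map y s).
Proof.
move=> xy; elim: s => [|v [|w s] IH]; first by rewrite lbr0r scaler0.
  by rewrite big_seq1 /= xy.
by rewrite big_cons map_cons rbr_cons // lbrJ xy IH lbrZl lbrZr -scalerDl.
Qed.

Lemma raise_weight (K : numFieldType) (c : int) (b : bool) : sign_of c (+) b ->
  (-1) ^+ b * c%:~R = - (`|c|%N)%:R :> K.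
Proof.
rewrite /sign_of natr_absz; case: ltP => c0; case: b => // _.
- by rewrite expr0 mul1r [`|c|%R]ltr0_norm // rmorphN opprK.
- by rewrite expr1 mulN1r [`|c|%R]ger0_norm.
Qed.

Section SystemTheory.
Variables (R : rcfType) (K : numFieldType) (n : nat) (C : 'M[int]_n) (d : 'I_n -> R).
Variables (L : lieType K) (h : 'I_n -> L) (e : bool -> 'I_n -> L).
Hypotheses (qc : quasi_cartan C d) (S : chevalley_system C h e).

Lemma cs_sl2 kappa i : sl2_triple (e kappa i) (e (~~ kappa) i) ((-1) ^+ kappa *: h i).
Proof.
have he eps (b : bool) : {[(-1) ^+ b *: h i, e eps i]} = ((-1) ^+ (b (+) eps) * 2%:R) *: e eps i.
  by rewrite lbrZl (cs_he S) (qc_diag qc) scalerA mulrA signr_addb.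
split; rewrite ?he ?addbb ?addbN ?addbb ?mul1r ?mulN1r //.
case: kappa; last by rewrite (cs_ee S) scale1r.
by rewrite lbrC (cs_ee S) scaleN1r.
Qed.

Lemma cs_weight (kappa : bool) i delta j : {[(-1) ^+ kappa *: h i, e delta j]} =
  ((-1) ^+ (kappa (+) delta) * (C i j)%:~R) *: e delta j.
Proof. by rewrite lbrZl (cs_he S) scalerA mulrA signr_addb. Qed.

Lemma cs_lowest (kappa : bool) i delta j : i != j ->
  (C i j == 0) || (sign_of (C i j) (+) kappa (+) delta) ->
  lowest (e (~~ kappa) i) ((-1) ^+ kappa *: h i) `|C i j|%N (e delta j).
Proof.
move=> ij hc; split.
  by apply: (cs_comm S) => //; move: hc; case: (_ == 0) (sign_of _) kappa delta => [] [] [] [].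
rewrite cs_weight; case/orP: hc => [/eqP->|hc]; first by rewrite mulr0 oppr0.
by rewrite raise_weight // addbA.
Qed.

Lemma cs_nilp_lowest (kappa : bool) i delta j : i != j ->
  (C i j == 0) || (sign_of (C i j) (+) kappa (+) delta) ->
  iter `|C i j|.+1 (lbr (e kappa i)) (e delta j) = 0.
Proof.
move=> ij hc.
by apply: (lowest_nilp (cs_sl2 kappa i)); [exact: cs_nilp S _ _|exact: cs_lowest].
Qed.

(** If the exponent exceeds 1 for [i] different from [j], then [e delta j] is a lowest weight vector
    for the triple at [i], and its weight gives the order of nilpotency. *)
Lemma cs_serre (eps : bool) i (delta : bool) j :
  iter (absz (Num.min 0 ((-1) ^+ eps * (-1) ^+ delta * C i j))).+1
            (lbr (e eps i)) (e delta j) = 0.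
Proof.
have [<-|ij] := eqVneq i j.
  rewrite (qc_diag qc); have [<-|ed] := eqVneq eps delta.
    by rewrite -signr_addb addbb; apply: (@iter_lbr_eq0 _ _ _ 1); rewrite //= lbrxx.
  have -> : delta = ~~ eps by case: eps delta ed => [] [].
  have [ef he _] := cs_sl2 eps i.
  rewrite -signr_addb addbN addbb /= /Num.min /=.
  by rewrite ef [lbr _ (_ *: h i)]lbrC he lbrNr lbrZr lbrxx scaler0 oppr0.
case: (boolP ((C i j == 0) || (sign_of (C i j) (+) eps (+) delta))) => hc.
  apply: iter_lbr_eq0 (cs_nilp_lowest ij hc); rewrite ltnS.
  case/orP: hc => [/eqP->|hc]; first by rewrite absz0.
  rewrite -signr_addb; move: hc; rewrite /sign_of; case: ltP => c0; case: eps delta => [] [] //= _; lia.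
apply: (@iter_lbr_eq0 _ _ _ 1) => //=; apply: (cs_comm S) => //.
by move: hc; rewrite negb_or => /andP[_ ->]; rewrite orbT.
Qed.

Let adj : rel 'I_n := fun i j => C i j != 0.
Let adjC : symmetric adj. Proof. exact: qc_adjC qc. Qed.

Lemma cycle_parity eta k s : chordless_cycle C (k :: s) ->
  path (compat C eta) k s -> ~~ compat C eta (last k s) k.
Proof.
case: s => [|j s]; first by case.
by move=> cc p; apply: (chordless_cycle_parity qc cc).
Qed.

(** Let [V] be the bracket over the cycle without [v]. By parity, the relation opened at [v] applies
    to the generator at [v] of the sign opposite to [eta v], which therefore kills [V]. The weight
    of [V] being nonnegative, the generator of sign [eta v] kills [V] as well. It commutes with all
    factors but the last, and so is absorbed at the other end. *)
Lemma cycle_rel_rot v w t u : chordless_cycle C (v :: w :: rcons t u) ->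
  `|C v u| <= `|C v w| -> cycle_rel C e (v :: w :: rcons t u) ->
  cycle_rel C e (rcons (w :: rcons t u) v).
Proof.
move=> cc le_uw rel eta p; rewrite /= in p.
have uniq_s : uniq (v :: w :: rcons t u) by case: cc.
move: uniq_s; rewrite 2!cons_uniq rcons_uniq => /and4P[vs _ ut _].
have vx x : x \in w :: rcons t u -> v != x by move=> xs; apply: contraNneq vs => ->.
have us' : u \in w :: rcons t u by rewrite inE mem_rcons mem_head orbT.
move: (p); rewrite rcons_path last_rcons => /andP[pwu cuv].
have ncvw : ~~ compat C eta v w.
  have cc1 := chordless_cycle_rot 1 cc; rewrite rot1_cons rcons_cons in cc1.
  by have := cycle_parity cc1 p; rewrite last_rcons.
pose eta' x := if x == v then ~~ eta v else eta x.
have eta'E x : x \in w :: rcons t u -> eta' x = eta x.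
  by move=> xs; rewrite /eta' eq_sym (negbTE (vx x xs)).
have p' : path (compat C eta') v (w :: rcons t u).
  have eta'v : eta' v = ~~ eta v by rewrite /eta' eqxx.
  rewrite /= {1}/compat eta'v eta'E ?mem_head //; apply/andP; split.
    by move: ncvw; rewrite /compat addbN -addbN -addNb; case: (sign_of _) (eta v) (eta w) => [] [] [].
  rewrite (@eq_in_path _ (mem (w :: rcons t u)) _ (compat C eta)) //; last exact/allP.
  by move=> x y xs ys; rewrite /compat !eta'E.
have := rel eta' p'; rewrite map_cons rbr_cons // {1}/eta' eqxx.
have -> : [seq e (eta' x) x | x <- w :: rcons t u] = [seq e (eta x) x | x <- w :: rcons t u].
  by apply/eq_in_map => x xs; rewrite eta'E.
set V := rbr _ => FV.
(* [V] has weight [|C v w| - |C v u|]: if positive, [V] is zero; if zero, [V] is invariant under the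
   triple at [v]. *)
have EV : {[e (eta v) v, V]} = 0.
  have sl2 := cs_sl2 (eta v) v.
  have nilp := cs_nilp S (eta v) v.
  have HV : {[(-1) ^+ eta v *: h v, V]} = (`|C v w| - `|C v u|)%:~R *: V.
    rewrite /V (rbr_weight (wt := fun x => (-1) ^+ (eta v (+) eta x) * (C v x)%:~R)); last first.
      by move=> x; rewrite cs_weight.
    congr (_ *: _); rewrite big_cons big_rcons /= big_seq big1 ?add0r => [|x xt]; last first.
      case/(chordless_cycleP adjC): cc => _ _ _ _ /(_ x); rewrite mem_rcons inE xt orbT last_rcons.
      move=> /(_ isT); have -> : (x == u) = false.
        by apply: contraTF xt => /eqP->.
      by move/negbFE/eqP->; rewrite mulr0.
    rewrite rmorphB /= [X in _ + X]raise_weight; last first.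
          by move: cuv; rewrite (compatC qc) /compat -addbA.
    rewrite natr_absz; congr (_ - _).
    have := @raise_weight K (C v w) (~~ (eta v (+) eta w)).
    rewrite signrN mulNr => /(_ _)/oppr_inj ->; first by rewrite natr_absz.
    by move: ncvw; rewrite /compat -addbA addbN.
  move: HV; have [m ->] : exists m : nat, `|C v w| - `|C v u| = m.
    by exists (absz (`|C v w| - `|C v u|)); rewrite gez0_abs // subr_ge0.
  case: m => [|m] HV; last by rewrite (highest_weight_ge0 sl2 nilp FV HV) lbr0r.
  by apply: (lowest_nilp (m := 0) sl2 nilp); split; rewrite // HV mulr0z oppr0.
move: EV; rewrite /V -[lbr _ _]/(iter 1 (lbr (e (eta v) v)) _).
rewrite -rcons_cons map_rcons -cats1 iter_rbr => [EV|x]; last first.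
  rewrite cats0 => /mapP[y yt ->]; apply: (cs_comm S).
    by apply: vx; rewrite -rcons_cons mem_rcons inE yt orbT.
  move: yt; rewrite inE => /orP[/eqP->|yt]; first by rewrite [~~ _]ncvw orbT.
  case/(chordless_cycleP adjC): cc => _ _ _ _ /(_ y); rewrite mem_rcons inE yt orbT last_rcons.
  move=> /(_ isT); have -> : (y == u) = false.
    by apply: contraTF yt => /eqP->.
  by move/negbFE/eqP->; rewrite eqxx.
rewrite !map_rcons -!cats1 -catA rbr_cat2 lbrC -scaleN1r rbrZ.
by rewrite [X in _ *: X]EV scaler0.
Qed.

End SystemTheory.

Section CutOk.
Variables (R : rcfType) (n : nat) (C : 'M[int]_n) (d : 'I_n -> R).
Hypothesis qc : quasi_cartan C d.

Lemma cut_ok_rev s : chordless_cycle C s -> cut_ok C (rev s) = cut_ok C s.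
Proof.
case: s => [|i s] // _; case/lastP: s => [|s j] //.
rewrite rev_cons rev_rcons rcons_cons /cut_ok !last_rcons andbC.
by rewrite !(@long_in_cycle_mem _ C (j :: rcons (rev s) i) (i :: rcons s j)) // => x;
  rewrite !inE !mem_rcons !inE mem_rev orbCA.
Qed.

(** By [long_ends_only] the only long vertices are then the two at the forbidden cut, and every
    other cut has at most one of them at its ends. *)
Lemma cut_ok_rot s c : chordless_cycle C s -> ~~ cut_ok C s -> (0 < c < size s)%N ->
  cut_ok C (rot c s).
Proof.
move=> cc nok /andP[c0 cs].
case: s cc nok cs => [|k s] cc; first by case: cc.
case: s cc => [|j s] cc; first by case: cc.
case/lastP: s cc => [|t i] cc; first by case: cc.
have lE : last k (j :: rcons t i) = i by rewrite /= last_rcons.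
rewrite /cut_ok lE negbK => /andP[lk li] cs.
have only := long_ends_only qc cc lk li.
set s := k :: j :: rcons t i in cs lk li only *.
have Emem x : long_in_cycle C (rot c s) x = long_in_cycle C s x.
  by apply: long_in_cycle_mem => y; rewrite mem_rot.
case: c c0 cs Emem => // -[|c] _ cs Emem.
  have E : rot 1 s = j :: rcons (rcons t i) k by rewrite rot1_cons.
  by rewrite E in Emem *; rewrite /cut_ok Emem (negbTE (only j _)) ?mem_head.
have E : rot c.+2 s = drop c.+2 s ++ k :: j :: take c (rcons t i) by [].
have ct : (c <= size t)%N by move: cs; rewrite /s /= size_rcons !ltnS.
have lrot : last k (rot c.+2 s) \in j :: t.
  rewrite E last_cat /= -cats1 takel_cat //.
  by have := mem_last j (take c t); rewrite !inE => /orP[->//|/mem_take->]; rewrite orbT.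
case Er: (rot c.+2 s) => [|x y]; first by move: (congr1 size Er); rewrite size_rot.
rewrite Er in lrot Emem *; rewrite /cut_ok negb_and orbC Emem.
by rewrite only.
Qed.
End CutOk.

Section Cycles.
Variables (R : rcfType) (K : numFieldType) (n : nat) (C : 'M[int]_n) (d : 'I_n -> R).
Variables (L : lieType K) (h : 'I_n -> L) (e : bool -> 'I_n -> L).
Hypotheses (qc : quasi_cartan C d) (S : chevalley_system C h e).

(** Entries that are not consecutive commute: either their vertices are not adjacent, or they are
    the two ends, whose edge is incompatible by parity. So [rbr_rev] applies. *)
Lemma cycle_rel_rev s : chordless_cycle C s -> cycle_rel C e s -> cycle_rel C e (rev s).
Proof.
move=> cc rel eta; rewrite rev_sorted => p.
have {}p : sorted (compat C eta) s.
  by move: p; rewrite (@eq_sorted _ _ (compat C eta)) // => x y; rewrite (compatC qc).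
have [us s3 cE] := cc.
case: s cc rel p us s3 cE => // k s cc rel p us s3 cE.
have pc := cycle_parity qc cc p.
rewrite map_rev; have [|b ->] := @rbr_rev _ _ [seq e (eta v) v | v <- k :: s]; last first.
  by rewrite rel ?scaler0.
move=> a b; rewrite size_map => /andP[ab bs].
have as_ : (a < size (k :: s))%N by apply: ltn_trans bs; apply: ltn_trans ab.
rewrite !(nth_map k) //; set x := nth k _ a; set y := nth k _ b.
have xy : x != y by rewrite nth_uniq // ltn_eqF // ltnW.
apply: (cs_comm S) => //; case: eqP => //= /eqP Cxy.
have := cE x y (mem_nth _ as_) (mem_nth _ bs) xy; rewrite Cxy => /esym.
rewrite !(next_nth_mod k) // nth_uniq ?ltn_mod // nth_uniq ?ltn_mod //.
rewrite modn_small; last by apply: ltn_trans bs.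
rewrite gtn_eqF //=; have [bl|bl] := ltnP b.+1 (size (k :: s)).
  by rewrite modn_small // => /eqP E; move: ab; rewrite E ltnNge -addn2 leq_addr.
have Eb : b.+1 = size (k :: s) by apply/eqP; rewrite eqn_leq bl bs.
rewrite Eb modnn => /eqP a0; move: pc; rewrite (last_nth k) -/(nth k (k :: s) (size s)).
have -> : size s = b by case: Eb.
by rewrite -/y (compatC qc) /x a0.
Qed.

Lemma cycle_rel_step s : chordless_cycle C s -> cut_ok C (rot 1 s) ->
  cycle_rel C e s -> cycle_rel C e (rot 1 s).
Proof.
case: s => [|v s] cc; first by case: cc.
case: s cc => [|w s] cc; first by case: cc.
case/lastP: s cc => [|t u] cc; first by case: cc.
rewrite rot1_cons rcons_cons /cut_ok last_rcons andbC => ok.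
apply: (cycle_rel_rot qc S) => //; apply: (long_ends_le qc cc).
by move: ok; rewrite !(@long_in_cycle_mem _ C (w :: rcons (rcons t u) v) (v :: w :: rcons t u)) //
  => x; rewrite !inE !mem_rcons !inE mem_rcons inE orbCA.
Qed.

Lemma cycle_rel_forward s b : chordless_cycle C s -> (b <= size s)%N ->
  (forall m, (0 < m <= b)%N -> cut_ok C (rot m s)) ->
  cycle_rel C e s -> cycle_rel C e (rot b s).
Proof.
move=> cc; elim: b => [|b IH] bs ok rel; first by rewrite rot0.
have Eb : rot b.+1 s = rot 1 (rot b s) by rewrite -rotD.
rewrite Eb; apply: cycle_rel_step; first exact: chordless_cycle_rot.
  by rewrite -Eb ok ?ltnS ?leqnn.
apply: IH => //; first exact: ltnW.
by move=> m /andP[m0 mb]; rewrite ok // m0 ltnW.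
Qed.

(* At most one cut is not allowed, so one of the two ways round the cycle
   avoids it. *)
Lemma cycle_rel_transfer s b : chordless_cycle C s -> (b <= size s)%N ->
  cut_ok C (rot b s) -> cycle_rel C e s -> cycle_rel C e (rot b s).
Proof.
move=> cc bs okb rel.
case: (boolP (all (fun m => cut_ok C (rot m s)) (iota 1 b))) => [/allP ok|].
  by apply: cycle_rel_forward => // m m0b; apply: ok; rewrite mem_iota add1n ltnS.
rewrite -has_predC => /hasP[m]; rewrite mem_iota add1n ltnS /= => /andP[m0 mb] nok.
have cr : chordless_cycle C (rev s) by apply: chordless_cycle_rev.
have rotE c : (c <= size s)%N -> rot c (rev s) = rev (rot (size s - c) s).
  by move=> cs; rewrite -rev_rotr /rotr.
suff : cycle_rel C e (rot (size s - b) (rev s)).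
  rewrite rotE ?leq_subr // subKn // => /(cycle_rel_rev (chordless_cycle_rev (chordless_cycle_rot b cc))).
  by rewrite revK.
apply: cycle_rel_forward => //; rewrite ?size_rev ?leq_subr //.
  move=> c /andP[c0 cb]; have cs : (c <= size s)%N by apply: leq_trans cb (leq_subr _ _).
  rewrite rotE // cut_ok_rev; last exact: chordless_cycle_rot.
  have [ms|sm] := ltnP m (size s - c).
    rewrite -(subnK (ltnW ms)) rotD; last by lia.
    apply: (cut_ok_rot qc) => //; first exact: chordless_cycle_rot.
    by rewrite size_rot; lia.
  have -> : (size s - c)%N = b by lia.
  by [].
exact: cycle_rel_rev.
Qed.

End Cycles.

(** * The presented algebra as a Chevalley system *)

Lemma leval_lbr_seq (K : fieldType) n (L : lieType K) (f : lie_gen n -> L) l :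
  leval f (lbr_seq l) = rbr (map (leval f) l).
Proof. by elim: l => [|x [|y l] IH] //; rewrite map_cons rbr_cons // -IH. Qed.

Lemma leval_iter (K : fieldType) (X : Type) (L : lieType K) (f : X -> L) m u v :
  leval f (iter m (LBr u) v) = iter m (lbr (leval f u)) (leval f v).
Proof. by elim: m => //= m ->. Qed.

Lemma signed_walk_potential (K : fieldType) n (C : 'M[int]_n) eta i s :
  path (compat C eta) i s ->
  signed_walk K C (eta i) i s = [seq LVar (GenE (eta v) v) | v <- i :: s].
Proof.
elim: s i => //= j s IH i /andP[cij p]; congr cons; rewrite -[RHS]IH //.
by move: cij; rewrite /compat; case: (sign_of _) (eta i) (eta j) => [] [] [].
Qed.

Section Presentation.
Variables (R : rcfType) (K : numFieldType) (n : nat) (C : 'M[int]_n) (d : 'I_n -> R).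
Hypothesis qc : quasi_cartan C d.

Let adj : rel 'I_n := fun i j => C i j != 0.
Let adjC : symmetric adj. Proof. exact: qc_adjC qc. Qed.

Lemma quiver_rel_system (L : lieType K) (h : 'I_n -> L) (e : bool -> 'I_n -> L) :
  chevalley_system C h e ->
  (forall s, chordless_cycle C s -> cut_ok C s -> cycle_rel C e s) ->
  forall u v, quiver_rel C u v -> leval (gen_val h e) u = leval (gen_val h e) v.
Proof.
move=> S rels u v; case=> {u v}.
- exact: cs_hh S.
- exact: cs_ee S.
- exact: cs_he S.
- by move=> eps i delta j; rewrite leval_iter; exact: cs_serre qc S _ _ _ _.
move=> eps i s cc ok; have uis : uniq (i :: s) by case: cc.
have [eta <- p] := ex_potential C eps uis.
rewrite leval_lbr_seq (signed_walk_potential _ p) -map_comp.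
apply: rels => //; apply/negP => /andP[li lj].
by have := ok (long_multiple_edge qc (mem_head i s) li); rewrite li lj.
Qed.

Local Notation g := (pres_lie (@quiver_rel K n C)).
Let h i : g := pres_gen (GenH i).
Let e eps i : g := pres_gen (GenE eps i).

Let genE : (pres_gen : lie_gen n -> g) =1 gen_val h e. Proof. by case. Qed.

Let relE u v : quiver_rel C u v -> leval (pres_gen : lie_gen n -> g) u = leval pres_gen v.
Proof. exact: pres_lie_rel. Qed.

Let h_weight eps i j : {[e eps i, h j]} = - (((-1) ^+ eps * (C j i)%:~R) *: e eps i).
Proof. by rewrite lbrC; congr (- _); exact: relE (rel_he K C j eps i). Qed.

(** On generators nilpotency is the Serre relation or the weight relation; Leibniz's formula spreads
    it to brackets. *)
Lemma quiver_nilp eps i : locally_nilpotent (e eps i).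
Proof.
apply: pres_lie_ind => [|x y [a /eqP xa] [b /eqP yb]|c x [a /eqP xa]|x y [a /eqP xa] [b /eqP yb]|x].
- by exists 0%N.
- exists (maxn a b); apply/eqP.
  have D m u v : iter m (lbr (e eps i)) (u + v) = iter m (lbr (e eps i)) u + iter m (lbr (e eps i)) v.
    by elim: m => //= m ->; rewrite lbrDr.
  by rewrite D (iter_lbr_eq0 (leq_maxl a b) xa) (iter_lbr_eq0 (leq_maxr a b) yb) addr0.
- by exists a; apply/eqP; rewrite iter_lbrZ xa scaler0.
- exists (a + b)%N; apply/eqP; rewrite iter_lbrJ big1 // => m _.
  have [am|ma] := leqP a m; first by rewrite (iter_lbr_eq0 am xa) lbr0l mul0rn.
  have bm : (b <= a + b - m)%N by rewrite -addnBAC ?leq_addl // ltnW.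
  by rewrite (iter_lbr_eq0 bm yb) lbr0r mul0rn.
case: x => [j|delta j].
  by exists 2%N; apply/eqP; rewrite /= [lbr (e eps i) (pres_gen _)]h_weight lbrNr lbrZr lbrxx scaler0 oppr0.
have := relE (rel_serre K C eps i delta j); rewrite leval_iter => E.
by eexists; apply/eqP; exact: E.
Qed.

Lemma quiver_system : chevalley_system C h e.
Proof.
split.
- by move=> i j; exact: relE (rel_hh K C i j).
- by move=> i; exact: relE (rel_ee K C i).
- by move=> i eps j; exact: relE (rel_he K C i eps j).
- move=> i j eps delta ij hc.
  have := relE (rel_serre K C eps i delta j); rewrite leval_iter /=.
  rewrite -signr_addb (_ : absz _ = 0%N) //; case/orP: hc => [/eqP->|].
    by rewrite mulr0.
  rewrite /sign_of; case: ltP => c0; case: eps delta => [] [] //= _; lia.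
- exact: quiver_nilp.
Qed.

Lemma quiver_cycle_rel s : chordless_cycle C s -> cut_ok C s -> cycle_rel C e s.
Proof.
case: s => [|i s] //= cc ok eta p.
have := relE (rel_cycle K (eta i) cc (fun _ => ok)).
by rewrite leval_lbr_seq (signed_walk_potential _ p) -map_comp.
Qed.

Lemma quiver_gen_ind (P : g -> Prop) :
  P 0 -> (forall x y, P x -> P y -> P (x + y)) ->
  (forall a x, P x -> P (a *: x)) -> (forall x y, P x -> P y -> P {[x, y]}) ->
  (forall eps i, P (e eps i)) -> forall x, P x.
Proof.
move=> P0 PD PZ PB Pe; apply: pres_lie_ind => // -[i|eps i]; last exact: Pe.
by rewrite -[pres_gen _]/(h i) -(cs_ee quiver_system i); apply: PB.
Qed.

End Presentation.

(** * Raising the last factor of a cycle relation *)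

Section Ends.
Variables (R : rcfType) (K : numFieldType) (n : nat) (C : 'M[int]_n) (d : 'I_n -> R).
Variables (L : lieType K) (h : 'I_n -> L) (e : bool -> 'I_n -> L).
Hypotheses (qc : quasi_cartan C d) (S : chevalley_system C h e).
Hypothesis rels : forall s, chordless_cycle C s -> cut_ok C s -> cycle_rel C e s.

Let adj : rel 'I_n := fun i j => C i j != 0.
Let adjC : symmetric adj. Proof. exact: qc_adjC qc. Qed.

Lemma cycle_inner0 k j ys i y : chordless_cycle C (k :: j :: rcons ys i) -> y \in ys ->
  C k y = 0.
Proof.
case/(chordless_cycleP adjC); rewrite 2!cons_uniq rcons_uniq => /and4P[_ _ iy _] _ _ _.
move=> /(_ y); rewrite mem_rcons inE last_rcons => ky yys.
by move: ky; rewrite yys orbT (negbTE (memPn iy y yys)) => /(_ isT)/negbFE/eqP.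
Qed.

(** By parity the generator [e kappa k], which raises [e (eta i) i], commutes with all the other
    factors. So the claim is that its power [|C k i|] kills the bracket [W] over the cycle without
    [k]. *)
Lemma ends_bracket k j ys i kappa eta : chordless_cycle C (k :: j :: rcons ys i) ->
  path (compat C eta) j (rcons ys i) -> sign_of (C k i) (+) kappa (+) eta i ->
  rbr ([seq e (eta v) v | v <- j :: ys] ++
       [:: iter `|C k i|%N (lbr (e kappa k)) (e (eta i) i)]) = 0.
Proof.
move=> cc p rki; have [akj aki] := chordless_cycle_ends qc cc.
have kn v : v \in j :: rcons ys i -> k != v.
  by move=> vs; case: cc => /= /andP[ks _] _ _; apply: contraNneq ks => ->.
have ij : i \in j :: rcons ys i by rewrite inE mem_rcons mem_head orbT.
pose eta1 b x := if x == k then b else eta x.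
have eta1E b v : v \in j :: rcons ys i -> eta1 b v = eta v.
  by move=> vs; rewrite /eta1 eq_sym (negbTE (kn v vs)).
have eta1k b : eta1 b k = b by rewrite /eta1 eqxx.
have p1 b : path (compat C (eta1 b)) j (rcons ys i).
  rewrite (@eq_in_path _ (mem (j :: rcons ys i)) _ (compat C eta)) //; last exact/allP.
  by move=> x y xs ys'; rewrite /compat !eta1E.
have map1 b : [seq e (eta1 b v) v | v <- j :: rcons ys i] = [seq e (eta v) v | v <- j :: rcons ys i].
  by apply/eq_in_map => v vs; rewrite eta1E.
have kkj : ~~ (sign_of (C k j) (+) kappa (+) eta j).
  apply/negP => ckj; have : path (compat C (eta1 kappa)) k (j :: rcons ys i).
    by rewrite /= p1 /compat eta1k eta1E ?mem_head // ckj.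
  move/(cycle_parity qc cc); rewrite /= last_rcons (compatC qc) /compat eta1k eta1E //.
  by rewrite rki.
have Tcomm : {in [seq e (eta v) v | v <- j :: ys] ++ [::], forall z, {[e kappa k, z]} = 0}.
  rewrite cats0 => z /mapP[v vs ->]; apply: (cs_comm S).
    by apply: kn; rewrite -rcons_cons mem_rcons inE vs orbT.
  move: vs; rewrite inE => /orP[/eqP->|vs]; first by rewrite kkj orbT.
  by rewrite (cycle_inner0 cc vs) eqxx.
rewrite -iter_rbr //.
have mapE : [seq e (eta v) v | v <- j :: ys] ++ [:: e (eta i) i] =
    [seq e (eta v) v | v <- j :: rcons ys i].
  by rewrite cats1 -map_rcons rcons_cons.
rewrite mapE; set W := rbr _.
have q0 : (0 < `|C k j|)%N by rewrite absz_gt0.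
have p0 : (0 < `|C k i|)%N by rewrite absz_gt0.
(* If the cycle may be opened at [k], its relation says that [e (~~ kappa) k] kills [W], which has
   weight [|C k j| - |C k i|]. As [C k j] is nonzero, [W] is killed after at most [|C k i|] steps,
   or is itself zero when the weight is positive. *)
case: (boolP (cut_ok C (k :: j :: rcons ys i))) => [ok|bad].
  have := rels cc ok (eta := eta1 (~~ kappa)).
  rewrite map_cons map1 rbr_cons // eta1k -/W => /(_ _) fW.
  have {}fW : {[e (~~ kappa) k, W]} = 0.
    apply: fW; rewrite /= p1 /compat eta1k eta1E ?mem_head // andbT.
    by move: kkj; clear; case: (sign_of _) kappa (eta j) => [] [] [].
  have HW : {[(-1) ^+ kappa *: h k, W]} = (`|C k j|%:R - `|C k i|%:R) *: W.
    rewrite /W (rbr_weight (wt := fun x => (-1) ^+ (kappa (+) eta x) * (C k x)%:~R)); last first.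
      by move=> x; rewrite (cs_weight S).
    congr (_ *: _); rewrite big_cons big_rcons /= big_seq big1 ?add0r => [|x xt]; last first.
      by rewrite (cycle_inner0 cc xt) mulr0.
    rewrite [X in _ + X]raise_weight; last by rewrite addbA.
    congr (_ - _); have := @raise_weight K (C k j) (~~ (kappa (+) eta j)).
    rewrite signrN mulNr => /(_ _)/oppr_inj -> //.
    by move: kkj; rewrite -addbA addbN.
  have [pq|qp] := leqP `|C k j| `|C k i|.
    have low : lowest (e (~~ kappa) k) ((-1) ^+ kappa *: h k) (`|C k i| - `|C k j|) W.
      by split; rewrite // HW natrB // opprB.
    apply: iter_lbr_eq0 (lowest_nilp (cs_sl2 qc S kappa k) (cs_nilp S kappa k) low).
    by rewrite -ltnS -subSn // ltnS leq_subLR -addn1 addnC leq_add2r.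
  rewrite (@highest_weight_ge0 _ _ _ _ _ (cs_sl2 qc S kappa k) (cs_nilp S kappa k) W (`|C k j| - `|C k i|).-1) ?iter_lbr0 //.
  by rewrite prednK ?subn_gt0 // natrB // ltnW.
(* Otherwise it may be opened just after [k], and that relation says directly that [e kappa k] kills
   [W]. *)
have cc1 := chordless_cycle_rot 1 cc.
have ok : cut_ok C (rot 1 (k :: j :: rcons ys i)).
  by apply: (cut_ok_rot qc cc bad); rewrite /= size_rcons.
have := rels cc1 ok (eta := eta1 kappa).
rewrite rot1_cons map_rcons map1 -mapE -[rcons (_ ++ _) _]cats1 -catA rbr_cat2 lbrC -scaleN1r rbrZ eta1k => rel.
rewrite -(prednK p0) iterSr.
have -> : {[e kappa k, W]} = 0; last by rewrite iter_lbr0.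
rewrite -[LHS]/(iter 1 (lbr (e kappa k)) _) /W -mapE iter_rbr //=.
apply/eqP; move: rel => /(_ _)/eqP; rewrite scaler_eq0 oppr_eq0 oner_eq0 /=; apply.
rewrite rcons_path p1 last_rcons (compatC qc) /compat eta1k eta1E //.
Qed.

End Ends.

(** * The mutated generators and their relations *)

Definition mutated_h (K : fieldType) (L : lieType K) n (k : 'I_n) (I : pred 'I_n)
    (C : 'M[int]_n) (h : 'I_n -> L) i : L :=
  if I i then h i - (C i k)%:~R *: h k else h i.

(** The sign of the generator at [k] is the one for which it raises [e eps i]. *)
Definition mutated_e (K : fieldType) (L : lieType K) n (k : 'I_n) (I : pred 'I_n)
    (C : 'M[int]_n) (e : bool -> 'I_n -> L) (eps : bool) i : L :=
  if I i then
    ((- (-1) ^+ eps) ^ C k i / `|C k i|%N`!%:R) *: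
      iter `|C k i|%N (lbr (e (~~ (sign_of (C k i) (+) eps)) k)) (e eps i)
  else e eps i.

Section MutatedSystem.
Variables (R : rcfType) (K : numFieldType) (n : nat).
Variables (o : rel 'I_n) (C : 'M[int]_n) (d : 'I_n -> R) (k : 'I_n).
Hypothesis G : good_orientation o C d.
Variables (L : lieType K) (h : 'I_n -> L) (e : bool -> 'I_n -> L).
Hypothesis S : chevalley_system C h e.
Hypothesis rels : forall s, chordless_cycle C s -> cut_ok C s -> cycle_rel C e s.
Hypothesis gen_ind : forall (P : L -> Prop),
  P 0 -> (forall x y, P x -> P y -> P (x + y)) ->
  (forall a x, P x -> P (a *: x)) -> (forall x y, P x -> P y -> P {[x, y]}) ->
  (forall eps i, P (e eps i)) -> forall x, P x.

Let qc := good_qc G.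
Let C' := cartan_mutation k (o^~ k) C.
Let qc1 : quasi_cartan C' d. Proof. exact: qc' G k. Qed.
Let h' := mutated_h k (o^~ k) C h.
Let e' := mutated_e k (o^~ k) C e.
Let adj : rel 'I_n := fun i j => C i j != 0.
Let adjC : symmetric adj. Proof. exact: qc_adjC qc. Qed.

(** Two lifts of the reflection at [k], one for each choice of the raising generator. They differ on
    generators only by scalars, and a proof may use the one suited to its signs. *)
Let s kappa := reflection (cs_nilp S kappa k) (cs_nilp S (~~ kappa) k).
Let sl2 kappa := cs_sl2 qc S kappa k.

Let sZ kappa a x : s kappa (a *: x) = a *: s kappa x.
Proof. exact: reflectionZ. Qed.
Let sB kappa x y : s kappa {[x, y]} = {[s kappa x, s kappa y]}.
Proof. exact: reflectionB. Qed.
Let s_hom kappa : lie_hom (s kappa). Proof. exact: reflection_hom. Qed.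
Let s0 kappa : s kappa 0 = 0. Proof. exact: reflection0. Qed.

Let sk kappa : s kappa (e kappa k) = - e (~~ kappa) k.
Proof. exact: reflection_e (sl2 kappa) _ _. Qed.
Let sNk kappa : s kappa (e (~~ kappa) k) = - e kappa k.
Proof. exact: reflection_f (sl2 kappa) _ _. Qed.

Let sh kappa i : s kappa (h i) = h i - (C i k)%:~R *: h k.
Proof.
rewrite /s (reflection_cartan (sl2 kappa) _ _ (c := (-1) ^+ kappa * (C i k)%:~R)).
- by rewrite scalerA mulrAC -expr2 sqrr_sign mul1r.
- exact: cs_he S _ _ _.
- by rewrite (cs_he S) signrN mulNr.
Qed.

Let s_far kappa eps i : i != k -> C k i = 0 -> s kappa (e eps i) = e eps i.
Proof.
move=> ik cki; rewrite /s (reflection_fix (e := e kappa k)) //; apply: (cs_comm S);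
  by rewrite ?cki ?eqxx // eq_sym.
Qed.

Let entry3 i : i != k -> (`|C k i| <= 3)%N.
Proof.
move=> ik; have [->//|cki] := eqVneq (C k i) 0.
by have := qc_pair qc (_ : k != i) cki; rewrite eq_sym => /(_ ik);
  rewrite !inE => H; case/orP: H => [/eqP[->]//|H]; move: H;
  do !(case/orP => [/eqP[->]//|]); case/eqP => ->.
Qed.

Let raised kappa eps i : i != k -> sign_of (C k i) (+) kappa (+) eps ->
  lowest (e (~~ kappa) k) ((-1) ^+ kappa *: h k) `|C k i|%N (e eps i).
Proof. by move=> ik r; apply: (cs_lowest S); rewrite 1?eq_sym // r orbT. Qed.

Let killed kappa eps i : i != k -> ~~ (sign_of (C k i) (+) kappa (+) eps) ->
  lowest (e kappa k) (- ((-1) ^+ kappa *: h k)) `|C k i|%N (e eps i).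
Proof.
move=> ik r; have := @raised (~~ kappa) eps i ik; rewrite negbK signrN scaleNr; apply.
by move: r; case: (sign_of _) kappa eps => [] [] [].
Qed.

Let s_raised kappa eps i : i != k -> sign_of (C k i) (+) kappa (+) eps ->
  s kappa (e eps i) = (`|C k i|%N`!%:R)^-1 *: iter `|C k i|%N (lbr (e kappa k)) (e eps i).
Proof.
by move=> ik r; apply: (reflection_lowest (sl2 kappa)); [exact: entry3|exact: raised].
Qed.

Let s_killed kappa eps i : i != k -> ~~ (sign_of (C k i) (+) kappa (+) eps) ->
  s kappa (e eps i) = ((-1) ^+ `|C k i|%N / `|C k i|%N`!%:R) *:
    iter `|C k i|%N (lbr (e (~~ kappa) k)) (e eps i).
Proof.
by move=> ik r; apply: (reflection_highest (sl2 kappa)); [exact: entry3|exact: killed].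
Qed.

(** For one choice of [kappa] the generator [e eps i] is a lowest weight vector, for the other a
    highest one. Both [reflection_lowest] and [reflection_highest] lead to the same iterated
    bracket. *)
Let e'_in kappa eps i : o i k -> exists2 a : K, a != 0 & e' eps i = a *: s kappa (e eps i).
Proof.
move=> oik; have ik := good_arr_neq G oik; rewrite /e' /mutated_e oik.
set c := C k i; have nz : (- (-1) ^+ eps : K) ^ c != 0.
  by rewrite expfz_neq0 // oppr_eq0 signr_eq0.
case: (boolP (sign_of c (+) kappa (+) eps)) => r.
  exists ((- (-1) ^+ eps) ^ c) => //; rewrite s_raised // scalerA.
  by have -> : ~~ (sign_of c (+) eps) = kappa
    by move: r; case: (sign_of c) kappa eps {nz} => [] [] [].
exists ((- (-1) ^+ eps) ^ c * (-1) ^+ `|c|%N); first by rewrite mulf_neq0 // signr_eq0.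
rewrite s_killed // scalerA mulrA -(mulrA _ _ ((-1) ^+ _)) -expr2 sqrr_sign mulr1.
by have -> : ~~ (sign_of c (+) eps) = ~~ kappa
    by move: r; case: (sign_of c) kappa eps {nz} => [] [] [].
Qed.

(** The factor (-eps)^c in the formula makes this scalar independent of [eps]. Since its square is
    1, the two mutated generators at [i] bracket exactly to [h' i]. *)
Let eta i : K := if C k i < 0 then (-1) ^+ `|C k i|%N else 1.

Let e'_in0 eps i : o i k -> e' eps i = eta i *: s false (e eps i).
Proof.
move=> oik; have ik := good_arr_neq G oik; rewrite /e' /mutated_e oik /eta.
have kill := @s_killed false eps i ik; have rais := @s_raised false eps i ik.
move: kill rais; rewrite addbF /sign_of; set c := C k i.
have absE (x : K) : x = 1 \/ x = -1 -> x ^ c = x ^+ `|c|%N.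
  move=> x1; case: c => // m; rewrite NegzE -invr_expz abszN /= -exprVn.
  by case: x1 => ->; rewrite ?invr1 ?invrN1.
case: ltP => c0; case: eps => /= kill rais.
- by rewrite kill // scalerA expr1 opprK absE ?expr1n; auto; rewrite mulrA -expr2 sqrr_sign.
- by rewrite rais // scalerA expr0 absE; auto.
- by rewrite rais // scale1r expr1 opprK absE ?expr1n ?mul1r; auto.
- by rewrite kill // scale1r expr0 absE; auto.
Qed.

Let eta2 i : eta i * eta i = 1.
Proof. by rewrite /eta; case: ifP; rewrite ?mulr1 // -expr2 sqrr_sign. Qed.

Let e'_out eps i : ~~ o i k -> e' eps i = e eps i.
Proof. by rewrite /e' /mutated_e => /negbTE->. Qed.

Let ok_k : o k k = false. Proof. exact: good_irr G k. Qed.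

(** Writing every [h' i] as an image under [s] allows its action on reflected generators to be
    computed before [s] is applied. *)
Let h'E i : h' i = s false (h i - (if o i k then 0 else C i k)%:~R *: h k).
Proof.
have -> : s false (h i - (if o i k then 0 else C i k)%:~R *: h k) =
    s false (h i) - (if o i k then 0 else C i k)%:~R *: s false (h k).
  have [sD _ _] := s_hom false.
  by rewrite -scaleNr sD sZ scaleNr.
rewrite /h' /mutated_h !sh (qc_diag qc); case: ifP => _; first by rewrite scale0r subr0.
have -> : h k - 2%:~R *: h k = - h k.
  by rewrite -[2%:~R]/(2%:R) scaler_nat mulr2n opprD addrA subrr add0r.
by rewrite scalerN opprK subrK.
Qed.

Lemma mutated_hh i j : {[h' i, h' j]} = 0.
Proof.
rewrite /h' /mutated_h; case: ifP => _; case: ifP => _;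
  by rewrite ?lbrDl ?lbrDr ?lbrNl ?lbrNr ?lbrZl ?lbrZr ?lbrDr ?lbrNr ?lbrZr ?(cs_hh S) ?scaler0 ?oppr0 ?addr0 ?scaler0 ?oppr0 ?addr0.
Qed.

Lemma mutated_ee i : {[e' false i, e' true i]} = h' i.
Proof.
case: (boolP (o i k)) => oik.
  rewrite !e'_in0 // lbrZl lbrZr scalerA eta2 scale1r -sB (cs_ee S) h'E oik.
  by rewrite scale0r subr0.
by rewrite !e'_out // (cs_ee S) /h' /mutated_h (negbTE oik).
Qed.

Lemma mutated_he i eps j : {[h' i, e' eps j]} = ((-1) ^+ eps * (C' i j)%:~R) *: e' eps j.
Proof.
have hke b : {[h i - b%:~R *: h k, e eps j]} = ((-1) ^+ eps * (C i j - b * C k j)%:~R) *: e eps j.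
  rewrite lbrDl lbrNl lbrZl !(cs_he S) scalerA -scaleNr -scalerDl; congr (_ *: _).
  by rewrite rmorphB rmorphM /=; ring.
case: (boolP (o j k)) => ojk.
  rewrite h'E !e'_in0 // lbrZr -sB hke sZ !scalerA mulrC.
  congr ((_ * _%:~R * _) *: _); rewrite mxE ojk; case: (o i k) => /=; first by rewrite mul0r.
  by [].
rewrite !e'_out // /h' /mutated_h mxE (negbTE ojk) addbF; case: (o i k) => //.
by rewrite (cs_he S) subr0.
Qed.

(** The image is a subalgebra containing a nonzero multiple of every generator. This lets local
    nilpotency pass from [e eps i] to its image. *)
Lemma reflection_surj y : exists x, y = s false x.
Proof.
elim/gen_ind: y => [|_ _ [x ->] [y ->]|a _ [x ->]|_ _ [x ->] [y ->]|eps i].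
- by exists 0; rewrite s0.
- by exists (x + y); case: (s_hom false) => ->.
- by exists (a *: x); rewrite sZ.
- by exists {[x, y]}; rewrite sB.
have [->|ik] := eqVneq i k.
  case: eps; first by exists (- e false k); rewrite -scaleN1r sZ sk scaleN1r opprK.
  by exists (- e true k); rewrite -scaleN1r sZ (sNk false) scaleN1r opprK.
have m3 : (`|C k i| <= `|C k i| <= 3)%N by rewrite leqnn entry3.
have [a a0] : exists2 a : K, a != 0 & exists x, s false x = a *: e eps i.
  case: (boolP (sign_of (C k i) (+) false (+) eps)) => r.
    have [a a0 E] := reflection_lowest_iter (sl2 false) (cs_nilp S _ _) (cs_nilp S _ _) m3 (raised ik r).
    by exists a => //; rewrite subnn in E; eexists; exact: E.
  have [a a0 E] := reflection_highest_iter (sl2 false) (cs_nilp S _ _) (cs_nilp S _ _) m3 (killed ik r).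
  by exists a => //; rewrite subnn in E; eexists; exact: E.
by case=> x E; exists (a^-1 *: x); rewrite sZ E scalerA mulVf ?scale1r.
Qed.

Lemma mutated_nilp eps i : locally_nilpotent (e' eps i).
Proof.
case: (boolP (o i k)) => oik; last by rewrite e'_out //; exact: cs_nilp S _ _.
rewrite e'_in0 // => y; have [x ->] := reflection_surj y.
have [m /eqP xm] := cs_nilp S eps i x; exists m; apply/eqP.
by rewrite iter_lbrZl -reflection_iter xm reflection0 scaler0.
Qed.

Let sign_rot (x y z : int) : 0 < x * y * z ->
  sign_of x = sign_of y (+) sign_of z.
Proof.
move=> p; have : sign_of (x * y * z) = false by rewrite /sign_of ltNge ltW.
have [x0 y0 z0] : [/\ x != 0, y != 0 & z != 0].
  by move: p; have [->|_] := eqVneq x 0; have [->|_] := eqVneq y 0;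
     have [->|_] := eqVneq z 0; rewrite ?(mul0r, mulr0) ?ltxx.
rewrite /sign_of !mulr_lt0 mulf_neq0 // x0 y0 z0 /=.
by case: (x < 0) (y < 0) (z < 0) => [] [] [].
Qed.

(** If [i] and [j] are not adjacent, [e delta j] commutes both with [e eps i] and with the raising
    generator at [k]. If they are, [k, j, i] is a chordless triangle and this is [ends_bracket]. *)
Lemma in_out_killed eps delta i j kappa : o i k -> o k j ->
  sign_of (C k i) (+) kappa (+) eps -> ~~ (sign_of (C k j) (+) kappa (+) delta) ->
  {[e' eps i, e delta j]} = 0.
Proof.
move=> oik okj ri kj; have [ik kjn] := (good_arr_neq G oik, good_arr_neq G okj).
have ij : i != j by apply: contraTneq oik => ->; rewrite (good_arr_asym G okj).
have e'E : exists a : K, e' eps i = a *: iter `|C k i|%N (lbr (e kappa k)) (e eps i).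
  rewrite /e' /mutated_e oik; eexists; congr (_ *: iter _ (lbr (e _ k)) _).
  by move: ri; clear; case: (sign_of _) kappa eps => [] [] [].
case: e'E => a ->; apply: lbr_eq0C; rewrite lbrZr.
suff -> : {[e delta j, iter `|C k i|%N (lbr (e kappa k)) (e eps i)]} = 0 by rewrite scaler0.
have [cij|cij] := eqVneq (C i j) 0.
  rewrite -iter_lbr_comm; last by apply: (cs_comm S) => //; rewrite kj orbT.
  rewrite [X in iter _ _ X](_ : _ = 0) ?iter_lbr0 //; apply: (cs_comm S); first by rewrite eq_sym.
  by have := adjC i j; rewrite /adj cij eqxx => /esym/negbFE ->.
have [_ u ajk aki cc] := in_out_triangle G oik okj cij.
have [pos _ _] := in_out_ok G oik okj cij.
have := @ends_bracket _ _ _ _ _ _ _ _ qc S rels k j [::] i kappa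
  (fun x => if x == j then delta else eps) cc.
rewrite /= eqxx (negbTE ij) => -> //; rewrite andbT /compat eqxx (negbTE ij).
have := sign_rot pos; rewrite (qc_sign qc i j) (qc_sign qc j k) => ->.
by move: ri kj; clear; case: (sign_of _) (sign_of _) kappa eps delta => [] [] [] [] [].
Qed.

(** If [j] is [k] or is not joined to [k], then [e delta j] is itself an image under [s] up to sign,
    and the commutation is inherited. For i -> k -> j it depends on whether the generator that
    raises [e eps i] kills or raises [e delta j]. *)
Let comm_in_notin eps delta i j : o i k -> ~~ o j k -> i != j ->
  (C' i j == 0) || ~~ (sign_of (C' i j) (+) eps (+) delta) ->
  {[e' eps i, e' delta j]} = 0.
Proof.
move=> oik ojk ij hc; rewrite [e' delta j]e'_out //.
have ik := good_arr_neq G oik.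
have [jk|jk] := eqVneq j k.
  subst j; have [a _ ->] := @e'_in (~~ delta) eps i oik.
  rewrite -[e delta k]opprK -[delta in e delta k]negbK -sk lbrNr lbrZl -sB.
  rewrite (cs_comm S) ?s0 ?scaler0 ?oppr0 //.
  have aik : C i k != 0 := good_arr_adj G oik.
  move: hc; rewrite (mutation_rk G) // oik oppr_eq0 (negbTE aik) /=.
  rewrite /sign_of oppr_lt0; move: aik; case: ltgtP => //= _ _;
    by case: eps delta => [] [].
case: (boolP (o k j)) => okj; last first.
  have ckj : C k j = 0.
    by apply/eqP; apply: contraNT okj; rewrite (good_arr G) 1?eq_sym // (negbTE ojk) orbF.
  have [a _ ->] := @e'_in false eps i oik.
  rewrite -(s_far false delta jk ckj) lbrZl -sB (cs_comm S) ?s0 ?scaler0 //.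
  by move: hc; rewrite mxE ckj mulr0; case: ifP; rewrite subr0.
pose kappa := ~~ (sign_of (C k i) (+) eps).
have ri : sign_of (C k i) (+) kappa (+) eps.
  by rewrite /kappa; case: (sign_of _) (eps) => [] [].
clearbody kappa.
case: (boolP (sign_of (C k j) (+) kappa (+) delta)) => rj; last first.
  exact: in_out_killed ri rj.
have aik : C i k != 0 := good_arr_adj G oik.
have akj : C k j != 0 := good_arr_adj G okj.
have aki : C k i != 0 by rewrite -/(adj k i) adjC.
have sgn : sign_of (C i k * C k j) = eps (+) delta.
  rewrite /sign_of mulr_lt0 aik akj /= -!/(sign_of _) (qc_sign qc i k).
  move: ri rj; clear; case: (sign_of _) (sign_of _) kappa eps delta => [] [] [] [] [] //.
(* When both are raised, a nonzero mutated entry would have the sign opposite to [C i k * C k j],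
   contrary to [hc]. So it is zero: [e' eps i] has weight 0 for the triple at [j], and being killed
   by one of its nilpotent elements, it is killed by the other. *)
have c'0 : C' i j = 0.
  apply/eqP; apply: contraTT hc => c'ij; rewrite (negbTE c'ij) /= negbK.
  move: c'ij; rewrite (mutation_in_out G oik okj) => c'ij.
  suff -> : sign_of (C i j - C i k * C k j) = ~~ sign_of (C i k * C k j).
    by rewrite sgn; case: (eps) (delta) => [] [].
  have prod0 : C i k * C k j != 0 by rewrite mulf_neq0.
  move: c'ij prod0; rewrite /sign_of; have [->|cij] := eqVneq (C i j) 0.
    by rewrite sub0r oppr_lt0 => _; case: ltgtP.
  have [pos le _] := in_out_ok G oik okj cij.
  have := sign_rot pos; rewrite (qc_sign qc j k) (qc_sign qc k i) /sign_of.
  move: le; rewrite addbC; have := mulr_lt0 (C i k) (C k j); rewrite aik akj /= => <-.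
  by move: (C i k * C k j) (C i j) => x y; clear; lia.
have jneq : j != i by rewrite eq_sym.
have fj : {[e (~~ delta) j, e' eps i]} = 0.
  apply/lbr_eq0C/(in_out_killed oik okj ri).
  by move: rj; clear; case: (sign_of _) kappa delta => [] [] [].
apply/lbr_eq0C; apply: (lowest_nilp (m := 0) (cs_sl2 qc S delta j) (cs_nilp S _ _)).
split=> //; rewrite oppr0 scale0r lbrZl; have := mutated_he j eps i.
have -> : C' j i = 0.
  by have := qc_adjC qc1 i j; rewrite c'0 eqxx => /esym/negbFE/eqP.
by rewrite /h' /mutated_h (negbTE ojk) => ->; rewrite mulr0 scale0r scaler0.
Qed.

Lemma mutated_comm i j eps delta : i != j ->
  (C' i j == 0) || ~~ (sign_of (C' i j) (+) eps (+) delta) ->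
  {[e' eps i, e' delta j]} = 0.
Proof.
move=> ij hc; case: (boolP (o i k)) => oik; case: (boolP (o j k)) => ojk.
- rewrite !e'_in0 // lbrZl lbrZr -sB (cs_comm S) ?s0 ?scaler0 //.
  by move: hc; rewrite mxE oik ojk /= subr0.
- exact: comm_in_notin.
- apply/lbr_eq0C/comm_in_notin => //; first by rewrite eq_sym.
  have -> : (C' j i == 0) = (C' i j == 0).
    by apply: negb_inj; rewrite (qc_adjC qc1).
  by move: hc; rewrite (qc_sign qc1); case: (_ == 0) (sign_of _) (eps) (delta) => [] [] [] [].
- rewrite !e'_out // (cs_comm S) //.
  by move: hc; rewrite mxE (negbTE oik) (negbTE ojk) subr0.
Qed.

Lemma mutated_system : chevalley_system C' h' e'.
Proof.
split; [exact: mutated_hh|exact: mutated_ee|exact: mutated_he|exact: mutated_comm|].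
exact: mutated_nilp.
Qed.

Let adj' : rel 'I_n := fun i j => C' i j != 0.

Lemma chordless_cycle_sorted z : chordless_cycle C' z -> sorted adj' z.
Proof.
case: z => [|v z] // cc; have [us s3 cE] := cc; rewrite /=.
apply/(pathP v) => m mz; have vz : (m.+1 < size (v :: z))%N by [].
have mz' : (m < size (v :: z))%N by apply: ltn_trans vz.
have := cE (nth v (v :: z) m) (nth v (v :: z) m.+1); rewrite !mem_nth // => /(_ isT isT).
rewrite nth_uniq // ltn_eqF // => /(_ isT).
have nE := next_nth_mod v us mz'; rewrite modn_small // in nE.
by rewrite nE eqxx.
Qed.

(** Without in-neighbours of [k] on the cycle nothing changes; without out-neighbours all its
    mutated generators are, up to scalars, images under [s], and the relation is the image of an old
    one. *)
Lemma mutated_cycle_same z : ~~ (has (o^~ k) z && has (o k) z) ->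
  chordless_cycle C' z -> cut_ok C' z -> cycle_rel C' e' z.
Proof.
move=> io cc' ok'; have cc : chordless_cycle C z by apply/(mutation_cycle_same G io).
have adjE := mutation_adj_same G io.
have longE x : x \in z -> long_in_cycle C' z x = long_in_cycle C z x.
  move=> xz; apply/(long_in_cycleP qc1)/(long_in_cycleP qc) => -[v vz [xv dxv]];
    exists v => //; split=> //; by have := adjE x v xz vz; rewrite xv.
have ok : cut_ok C z.
  by case: z ok' longE {cc cc' io adjE} => // v z; rewrite /cut_ok => + longE;
     rewrite !longE ?mem_head ?mem_last.
move=> eta0 p; case/nandP: io => /hasPn io; last first.
  (* [s] exchanges the two generators at [k] up to sign, so the sign at [k] has to be switched; this
     matches the sign change of the entries [C k v]. *)
  pose eta1 v := eta0 v (+) (v == k).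
  have e'E v : v \in z -> exists a : K, e' (eta0 v) v = a *: s false (e (eta1 v) v).
    move=> vz; rewrite /eta1; have [->|vk] := eqVneq v k.
      exists (-1); rewrite e'_out ?ok_k // addbT scaleN1r.
      by case: (eta0 k); rewrite ?sk ?(sNk false) opprK.
    rewrite addbF; case: (boolP (o v k)) => ovk.
      by have [a _ E] := @e'_in false (eta0 v) v ovk; exists a.
    exists 1; rewrite scale1r e'_out // s_far //; apply/eqP; apply: contraNT (io v vz).
    by rewrite (good_arr G) 1?eq_sym // (negbTE ovk) orbF.
  have [a ->] : exists a : K, rbr [seq e' (eta0 v) v | v <- z] =
      a *: rbr [seq s false (e (eta1 v) v) | v <- z].
    elim: z e'E {cc cc' ok' ok io adjE longE p} => [|v [|w z] IH] E.
    - by exists 0; rewrite scaler0.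
    - by have [a Ea] := E v (mem_head _ _); exists a.
    have [a Ea] := E v (mem_head _ _).
    have [|b Eb] := IH; first by move=> x xz; apply: E; rewrite inE xz orbT.
    by exists (a * b); rewrite map_cons rbr_cons // Ea Eb lbrZl lbrZr scalerA.
  rewrite (map_comp (s false) (fun v => e (eta1 v) v)) -(rbr_hom _ (s_hom false)).
  rewrite (rels cc ok) ?s0 ?scaler0 //.
  have : sorted [rel x y | compat C' eta0 x y && adj' x y] z.
    by rewrite sorted_relI p chordless_cycle_sorted.
  apply: (@sub_in_sorted _ (mem z)); last exact/allP.
  move=> x y xz yz /= /andP[cxy axy].
  have no v : v \in z -> v != k -> adj' k v -> o v k.
    move=> vz vk; rewrite -/(adj' k v) [adj' k v](mutation_adjk G) (good_arr G) 1?eq_sym //.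
    by rewrite (negbTE (io v vz)).
  have C'k v : v \in z -> v != k -> adj' k v -> sign_of (C' k v) = ~~ sign_of (C k v).
    move=> vz vk akv; rewrite (mutation_k G) // no //.
    have := akv; rewrite [adj' k v](mutation_adjk G) /sign_of oppr_lt0; by case: ltgtP.
  move: cxy; rewrite /compat /eta1.
  have [xk|xk] := eqVneq x k; have [yk|yk] := eqVneq y k; rewrite ?addbT ?addbF.
  - by subst x y; rewrite (qc_diag qc1) (qc_diag qc) addbb.
  - by subst x; rewrite C'k //; case: (sign_of _) (eta0 k) (eta0 y) => [] [] [].
  - subst y; rewrite (qc_sign qc1) (qc_sign qc) C'k //; last by rewrite /adj' (qc_adjC qc1).
    by case: (sign_of _) (eta0 k) (eta0 x) => [] [] [].
  - by rewrite (mutation_other G) // negb_and ?(io x) ?(io y) ?orbT.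
have e'E v : v \in z -> e' (eta0 v) v = e (eta0 v) v by move=> /io; apply: e'_out.
have -> : [seq e' (eta0 v) v | v <- z] = [seq e (eta0 v) v | v <- z].
  by apply/eq_in_map => v; apply: e'E.
have CC : {in mem z &, compat C' eta0 =2 compat C eta0}.
  by move=> x y xz yz; rewrite /compat mxE (negbTE (io x xz)) (negbTE (io y yz)) subr0.
have zz : all (mem z) z by apply/allP.
by apply: (rels cc ok); rewrite -(eq_in_sorted CC zz).
Qed.

(** The edge between [i] and [j] was created by the mutation. As [e' eps i] is a multiple of an
    iterated bracket of the generator at [k] with [e eps i], the relation is [ends_bracket] for the
    longer cycle through [k]. *)
Lemma mutated_cycle_ends j ys i : o k j -> o i k ->
  chordless_cycle C (k :: j :: rcons ys i) -> chordless_cycle C' (j :: rcons ys i) ->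
  cycle_rel C' e' (j :: rcons ys i).
Proof.
move=> okj oik cc cc' eta0 p.
have ys0 v : v \in ys -> C k v = 0 := cycle_inner0 qc cc.
have kn v : v \in j :: rcons ys i -> v != k.
  by move=> vs; case: cc => /= /andP[ks _] _ _; apply: contraNneq ks => <-.
have far v : v \in ys -> (o v k = false) * (o k v = false).
  move=> vs; have vk : v != k by apply: kn; rewrite inE mem_rcons inE vs !orbT.
  have := good_arr G (_ : k != v); rewrite eq_sym => /(_ vk); rewrite ys0 // eqxx.
  by move/esym/negbT; rewrite negb_or => /andP[/negbTE-> /negbTE->].
have no_in v : v \in j :: ys -> ~~ o v k.
  by rewrite inE => /orP[/eqP->|/far->//]; rewrite (good_arr_asym G okj).
rewrite -rcons_cons map_rcons -cats1.
have -> : [seq e' (eta0 v) v | v <- j :: ys] = [seq e (eta0 v) v | v <- j :: ys].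
  by apply/eq_in_map => v vs; rewrite e'_out // no_in.
rewrite /e' /mutated_e oik rbrZ (ends_bracket qc S rels cc) ?scaler0 //; last first.
  by case: (sign_of _) (eta0 i) => [] [].
case/lastP: ys cc' p far ys0 kn {cc no_in} => [[_ //]|ys y] cc' p far ys0 kn.
move: p; rewrite [sorted _ _]/= ![path _ _ (rcons (rcons _ _) _)]rcons_path !last_rcons => /andP[p cyi].
have ymem : y \in rcons ys y by rewrite mem_rcons mem_head.
apply/andP; split; last first.
  move: cyi; rewrite /compat (mutation_other G) ?(far y ymem) ?andbF //; apply: kn.
    by rewrite inE mem_rcons inE ymem !orbT.
  by rewrite inE mem_rcons mem_head orbT.
move: p.
have nk v : v \in j :: rcons ys y -> v != k.
  by move=> vs; apply: kn; rewrite -rcons_cons mem_rcons inE vs orbT.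
rewrite (@eq_in_path _ (mem (j :: rcons ys y)) _ (compat C eta0)) //; last exact/allP.
have nin v : v \in j :: rcons ys y -> o v k = false.
  by rewrite inE => /orP[/eqP->|/far->//]; rewrite (good_arr_asym G okj).
by move=> u v us vs; rewrite /compat (mutation_other G) ?nk ?nin.
Qed.

Lemma rbr_merge X x y Y : {in Y, forall z, {[x, z]} = 0} ->
  rbr (X ++ [:: x, y & Y]) = rbr (X ++ {[x, y]} :: Y) :> L.
Proof.
move=> xY; elim: X => [|z X IH].
  by rewrite (rbr_cons x) // -[lbr x (rbr _)]/(iter 1 (lbr x) (rbr ([::] ++ y :: Y))) iter_rbr.
have nn w l1 : l1 ++ w :: Y != [::] :> seq L by case: l1.
have nn2 l1 : l1 ++ [:: x, y & Y] != [::] :> seq L by case: l1.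
by rewrite !cat_cons !rbr_cons // IH.
Qed.

(** Removes [k] from a bracket passing through i, k, j. The bracket of the generators at [k] and [j]
    is a multiple of the image under [s] of an iterated bracket of length [|C k j| - 1], and all
    other factors are images under [s] as well. Inside [s] the iteration can be pulled out in front,
    because it commutes with everything but the factor at [j]. *)
Lemma walk_through X Y i j kappa eta0 : o i k -> o k j ->
  {in X ++ Y, forall v, v != k /\ C k v = 0} ->
  sign_of (C k i) (+) kappa (+) eta0 i -> ~~ (sign_of (C k j) (+) kappa (+) eta0 j) ->
  eta0 k = ~~ kappa ->
  iter `|C k j|.-1 (lbr (e (~~ kappa) k)) (rbr [seq e (eta0 v) v | v <- X ++ i :: j :: Y]) = 0 ->
  rbr [seq e' (eta0 v) v | v <- X ++ i :: k :: j :: Y] = 0.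
Proof.
move=> oik okj far ri kj ek it0.
have ik := good_arr_neq G oik; have jk : j != k by rewrite eq_sym (good_arr_neq G okj).
have far_e' v : v \in X ++ Y -> e' (eta0 v) v = e (eta0 v) v.
  move=> /far[vk ckv]; rewrite e'_out //; apply: contraTN isT => ovk.
  by have := good_arr_adjr G ovk; rewrite ckv eqxx.
have farS b v : v \in X ++ Y -> {[e b k, e (eta0 v) v]} = 0.
  by move=> /far[vk ckv]; apply: (cs_comm S); rewrite ?ckv ?eqxx // eq_sym.
have q0 : (0 < `|C k j|)%N by rewrite absz_gt0; exact: (good_arr_adj G okj).
have [a _ Ei] := @e'_in kappa (eta0 i) i oik.
have q3 : (`|C k j|.-1 <= `|C k j| <= 3)%N by rewrite leq_pred entry3.
have [c c0 Ej] := reflection_highest_iter (sl2 kappa) (cs_nilp S _ _) (cs_nilp S _ _) q3 (killed jk kj).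
have {Ej} Ej : {[e (~~ kappa) k, e (eta0 j) j]} =
    c^-1 *: s kappa (iter `|C k j|.-1 (lbr (e (~~ kappa) k)) (e (eta0 j) j)).
  rewrite /s Ej scalerA mulVf // scale1r -[in X in (X - _)%N](prednK q0) subSnn //.
rewrite map_cat /= Ei !e'_out ?ok_k ?(good_arr_asym G okj) // ek.
have mapE Z : {subset Z <= X ++ Y} -> [seq e' (eta0 v) v | v <- Z] =
    map (s kappa) [seq e (eta0 v) v | v <- Z].
  move=> ZXY; rewrite -map_comp; apply/eq_in_map => v /ZXY vs /=.
  by rewrite far_e' // s_far //; case: (far v vs).
have sX : {subset X <= X ++ Y} by move=> v; rewrite mem_cat => ->.
have sY : {subset Y <= X ++ Y} by move=> v; rewrite mem_cat => ->; rewrite orbT.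
rewrite rbrZ -cat_rcons rbr_merge; last first.
  by move=> z /mapP[v vY ->]; rewrite far_e' ?sY // farS ?sY.
rewrite Ej rbrZ !mapE // cat_rcons.
set ej := iter _ _ _; set ei := e _ i.
have -> : map (s kappa) [seq e (eta0 v) v | v <- X] ++
    [:: s kappa ei, s kappa ej & map (s kappa) [seq e (eta0 v) v | v <- Y]] =
    map (s kappa) ([seq e (eta0 v) v | v <- X] ++ [:: ei, ej & [seq e (eta0 v) v | v <- Y]]).
  by rewrite map_cat.
rewrite -(rbr_hom _ (s_hom kappa)) -cat_rcons /ej -iter_rbr.
  by rewrite cat_rcons -(map_cons (fun v => e (eta0 v) v)) -(map_cons (fun v => e (eta0 v) v) i) -map_cat it0 s0 !scaler0.
move=> z; rewrite mem_cat mem_rcons inE => /orP[/orP[/eqP->|]|].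
- apply: (cs_comm S); first by rewrite eq_sym.
  by move: ri; clear; case: (sign_of _) kappa (eta0 i) => [] [] []; rewrite /= ?orbT.
- by case/mapP => v vX ->; rewrite farS ?sX.
- by case/mapP => v vY ->; rewrite farS ?sY.
Qed.

Let compat_in_out i j eta0 : o i k -> o k j -> compat C' eta0 i k -> compat C' eta0 k j ->
  (sign_of (C k i) (+) ~~ eta0 k (+) eta0 i) *
  ~~ (sign_of (C k j) (+) ~~ eta0 k (+) eta0 j).
Proof.
move=> oik okj; have ik := good_arr_neq G oik.
have jk : j != k by rewrite eq_sym (good_arr_neq G okj).
have aki : C k i != 0 := good_arr_adjr G oik.
rewrite (compatC qc1) /compat !(mutation_k G) // oik (good_arr_asym G okj).
have -> : sign_of (- C k i) = ~~ sign_of (C k i).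
  by rewrite /sign_of oppr_lt0; move: aki; case: ltgtP.
by case: (sign_of _) (sign_of _) (eta0 k) (eta0 i) (eta0 j) => [] [] [] [] [].
Qed.

(** If [i] and [j] are not adjacent in [C], [walk_through] reduces the relation to their commuting.
    Otherwise [in_out_ok] gives weight 1 on [i j] and 2 on the edges at [k], so [|C k j|] is 1 or
    2. *)
Lemma mutated_triangle i j : o i k -> o k j -> chordless_cycle C' [:: k; j; i] ->
  exists b, cycle_rel C' e' (rot b [:: k; j; i]).
Proof.
move=> oik okj cc'; have ik := good_arr_neq G oik.
have jk : j != k by rewrite eq_sym (good_arr_neq G okj).
have ij : i != j by apply: contraTneq oik => ->; rewrite (good_arr_asym G okj).
have nil0 : {in [::] ++ [::] : seq 'I_n, forall v, v != k /\ C k v = 0} by [].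
have through q : `|C k j|%N = q.+1 ->
    (forall eta0, compat C' eta0 i k -> compat C' eta0 k j ->
      iter q (lbr (e (eta0 k) k)) {[e (eta0 i) i, e (eta0 j) j]} = 0) ->
    exists b, cycle_rel C' e' (rot b [:: k; j; i]).
  move=> Eq H; exists 2%N => eta0; rewrite /rot /= => /and3P[cik ckj _].
  have [ri kj] := compat_in_out oik okj cik ckj.
  apply: (walk_through (X := [::]) (Y := [::]) oik okj nil0 ri kj); first by rewrite negbK.
  by rewrite Eq negbK /= H.
have q0 : (0 < `|C k j|)%N by rewrite absz_gt0; exact: (good_arr_adj G okj).
have [cij|cij] := eqVneq (C i j) 0.
  apply: (through _ (esym (prednK q0))) => eta0 _ _.
  by rewrite (cs_comm S) ?cij ?eqxx // iter_lbr0.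
have [_ u ajk aki cc] := in_out_triangle G oik okj cij.
have [pos _ wts] := in_out_ok G oik okj cij.
have c'ij : C' i j != 0.
  by have /= := chordless_triangle_adj qc1 cc'; rewrite (qc_adjC qc1).
have [w1 w2 w3] := wts c'ij; have sg := sign_rot pos.
have : (`|C k j|%N == 1%N) || (`|C k j|%N == 2%N).
  have : (`|C k j| %| absz (C k j * C j k)%R)%N by rewrite abszM dvdn_mulr.
  by rewrite w3; move: q0; case: (`|C k j|)%N => [|[|[|m]]] // _ /(@dvdn_leq _ 2 isT).
case/orP=> /eqP q.
  (* For [|C k j| = 1] the triangle is opened at [k]: the generator at [k] kills [e' i], and its
     bracket with [e j] is [s (e j)], so what remains is the image of [e_j, e_i] = 0. *)
  exists 0%N => eta0; rewrite rot0 => /= /and3P[ckj cji _].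
  have ncik : ~~ compat C' eta0 i k by have /= := cycle_parity qc1 cc' (eta := eta0); rewrite ckj cji; apply.
  have sgn' : sign_of (C' k i) = ~~ sign_of (C k i).
    by rewrite (mutation_k G) // oik /sign_of oppr_lt0; move: (aki : C k i != 0); case: ltgtP.
  have ri : sign_of (C k i) (+) eta0 k (+) eta0 i.
    move: ncik; rewrite (compatC qc1) /compat sgn'.
    by case: (sign_of _) (eta0 k) (eta0 i) => [] [] [].
  have rj : sign_of (C k j) (+) eta0 k (+) eta0 j.
    by move: ckj; rewrite /compat (mutation_k G) // (good_arr_asym G okj).
  rewrite (@e'_out _ k) ?ok_k // (@e'_out _ j) ?(good_arr_asym G okj) //.
  have TE : {[e (eta0 k) k, e' (eta0 i) i]} = 0.
    have -> : e' (eta0 i) i = ((- (-1) ^+ eta0 i) ^ C k i / `|C k i|%N`!%:R) *: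
        iter `|C k i|%N (lbr (e (eta0 k) k)) (e (eta0 i) i).
      rewrite /e' /mutated_e oik; congr (_ *: iter _ (lbr (e _ k)) _).
      by move: ri; case: (sign_of _) (eta0 k) (eta0 i) => [] [] [].
    by rewrite lbrZr -iterS (cs_nilp_lowest qc S) ?scaler0 1?eq_sym // ri orbT.
  have Es : s (eta0 k) (e (eta0 j) j) = {[e (eta0 k) k, e (eta0 j) j]}.
    by rewrite (s_raised jk rj) q factS fact0 invr1 scale1r.
  rewrite lbr_comml // [X in lbr X _](esym Es).
  have [a _ ->] := @e'_in (eta0 k) (eta0 i) i oik.
  rewrite lbrZr -sB (cs_comm S) ?s0 ?scaler0 1?eq_sym //; apply/orP; right.
  rewrite (qc_sign qc) sg (qc_sign qc j k).
  by move: ri rj; clear; case: (sign_of _) (sign_of _) (eta0 k) (eta0 i) (eta0 j) => [] [] [] [] [].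
(* For [|C k j| = 2] one bracket with the generator at [k] is left over, and the result is the old
   relation of the triangle opened at [k]. That opening is allowed because [i] is not long:
   [d i = d j] exceeds [d k]. *)
apply: (through 1%N q) => eta0 cik ckj /=.
have [cji|ncji] := boolP (compat C eta0 j i); last first.
  rewrite (cs_comm S) ?lbr0r //; apply/orP; right.
  by move: ncji; rewrite (compatC qc).
have ok : cut_ok C [:: k; j; i].
  rewrite /cut_ok negb_and; apply/orP; right; apply/(long_in_cycleP qc) => -[v].
  have dij : d i = d j := qc_wt1 qc w1.
  have dkj : d k < d j.
    rewrite -(qc_long qc (good_arr_adj G okj)).
    have : (`|C k j| * `|C j k| = 2)%N by rewrite -abszM w3.
    rewrite -!abszE ltz_nat q; clear.
    by case: (`|C j k|)%N => [|[|a]] //; rewrite mulnC !mulSn.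
  by rewrite !inE => /or3P[] /eqP-> []; rewrite ?dij ?ltxx // => _ /(lt_trans dkj); rewrite ltxx.
rewrite [lbr (e _ i) _]lbrC lbrNr -[lbr (e _ k) _]/(rbr [:: e (eta0 k) k; e (eta0 j) j; e (eta0 i) i]).
rewrite (rels cc ok (eta := eta0)) ?oppr0 //= cji.
by rewrite !andbT; move: ckj; rewrite /compat (mutation_k G) // (good_arr_asym G okj).
Qed.

(** By [walk_through] the relation reduces to that of the cycle without [k] in [C], provided the
    opening does not separate [i], [k], [j]. Since the length is at least 4, two such openings are
    at hand, just after [j] and one vertex later, and at most one of them is forbidden in [C]. *)
Lemma mutated_long_cycle i j y t : o i k -> o k j ->
  chordless_cycle C' (k :: j :: y :: rcons t i) ->
  exists b, cycle_rel C' e' (rot b (k :: j :: y :: rcons t i)).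
Proof.
move=> oik okj cc'; have ik := good_arr_neq G oik.
have jk : j != k by rewrite eq_sym (good_arr_neq G okj).
have sz : (2 <= size (y :: rcons t i))%N by rewrite /= size_rcons.
have io : o j k (+) o (last j (y :: rcons t i)) k.
  by rewrite /= last_rcons oik (good_arr_asym G okj).
have [cZ Cji] := mutation_cycle_delete G cc' sz io; rewrite /= last_rcons in Cji.
have kn v : v \in j :: y :: rcons t i -> v != k.
  by move=> vs; case: cc' => /= /andP[ks _] _ _; apply: contraNneq ks => <-.
have far v : v \in y :: t -> v != k /\ C k v = 0.
  move=> vt; split; first by apply: kn; move: vt; rewrite !inE mem_rcons !inE => /orP[]->; rewrite ?orbT.
  apply/eqP; have := mutation_adjk G k v; rewrite -/C'.
  by rewrite (@cycle_inner0 _ _ _ _ qc1 k j (y :: t) i v cc' vt) eqxx => /esym/negbFE.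
have nadj v : C k v = 0 -> v != k -> (o v k = false) * (o k v = false).
  move=> ckv vk; have := good_arr G (_ : k != v); rewrite eq_sym => /(_ vk).
  by rewrite ckv eqxx => /esym/negbT; rewrite negb_or => /andP[/negbTE-> /negbTE->].
have through xs ys : xs ++ ys =i y :: t -> cycle_rel C e (xs ++ i :: j :: ys) ->
    cycle_rel C' e' (xs ++ i :: k :: j :: ys).
  move=> memE rel eta0; rewrite sorted_cat_cons => /andP[pX /= /and3P[cik ckj pY]].
  have [ri kj] := compat_in_out oik okj cik ckj.
  apply: (walk_through oik okj _ ri kj); rewrite ?negbK //.
    by move=> v; rewrite memE; apply: far.
  rewrite rel ?iter_lbr0 // sorted_cat_cons /=; apply/and3P; split.
  - have CC : {in mem (rcons xs i) &, compat C' eta0 =2 compat C eta0}.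
      have no v : v \in rcons xs i -> v != k /\ o k v = false.
        rewrite mem_rcons inE => /orP[/eqP->|vxs]; first by rewrite (good_arr_asym G oik).
        have [] := far v; first by rewrite -memE mem_cat vxs.
        by move=> vk ckv; rewrite (nadj v).
      move=> u v /no[uk ou] /no[vk ov].
      by rewrite /compat (mutation_other G) ?ou ?ov ?andbF.
    by rewrite -(eq_in_sorted CC) //; apply/allP.
  - rewrite /compat (qc_sign qc) Cji; move: ri kj.
    have ajk : C j k != 0 := good_arr_adjr G okj.
    have aki : C k i != 0 := good_arr_adjr G oik.
    rewrite {3}/sign_of mulr_lt0 ajk aki -!/(sign_of _) (qc_sign qc j k); clear.
    by case: (sign_of _) (sign_of _) (eta0 k) (eta0 i) (eta0 j) => [] [] [] [] [].
  have CC : {in mem (j :: ys) &, compat C' eta0 =2 compat C eta0}.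
    have no v : v \in j :: ys -> v != k /\ o v k = false.
      rewrite inE => /orP[/eqP->|vxs]; first by rewrite (good_arr_asym G okj).
      have [] := far v; first by rewrite -memE mem_cat vxs orbT.
      by move=> vk ckv; rewrite (nadj v).
    move=> u v /no[uk ou] /no[vk ov].
    by rewrite /compat (mutation_other G) ?ou ?ov.
  by rewrite -(eq_in_path CC) //; apply/allP.
have rE0 : rot 1 (j :: y :: rcons t i) = (y :: t) ++ [:: i; j].
  by rewrite rot1_cons -[y :: rcons t i]/(rcons (y :: t) i) -!cats1 -catA.
case: (boolP (cut_ok C (rot 1 (j :: y :: rcons t i)))) => ok.
  exists 2%N; have -> : rot 2 (k :: j :: y :: rcons t i) = (y :: t) ++ [:: i; k; j].
    by rewrite /rot /= -cats1 -catA.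
  apply: (through (y :: t) [::]); first by rewrite cats0.
  rewrite -rE0; apply: rels ok; exact: chordless_cycle_rot.
have c1 := chordless_cycle_rot 1 cZ.
exists 3%N; have -> : rot 3 (k :: j :: y :: rcons t i) = t ++ [:: i; k; j; y].
  by rewrite /rot /= drop0 take0 -cats1 -catA.
apply: (through t [:: y]); first by move=> v; rewrite mem_cat !inE orbC.
have ok1 : cut_ok C (rot 1 (rot 1 (j :: y :: rcons t i))).
  by apply: (cut_ok_rot qc c1 ok); rewrite size_rot /= size_rcons.
have := rels (chordless_cycle_rot 1 c1) ok1.
by rewrite rE0 cat_cons rot1_cons -cats1 -catA.
Qed.

Lemma mutated_neighbour_cycle i j t : o i k -> o k j ->
  chordless_cycle C' (k :: j :: rcons t i) ->
  exists b, cycle_rel C' e' (rot b (k :: j :: rcons t i)).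
Proof. by case: t => [|y t]; [exact: mutated_triangle|exact: mutated_long_cycle]. Qed.

Lemma rot_rot_ex (T : Type) m p (z : seq T) : exists b, rot m (rot p z) = rot b z.
Proof.
have [sp|ps] := leqP (size z) p; first by exists m; rewrite (rot_oversize sp).
have [sm|ms] := leqP (size z) m; first by exists p; rewrite [LHS]rot_oversize ?size_rot.
by eexists; rewrite (rot_add_mod (ltnW ps) (ltnW ms)).
Qed.

Lemma rot_inv_ex (T : Type) m (z : seq T) : exists b, rot b (rot m z) = z.
Proof. by exists (size (rot m z) - m)%N; rewrite -[RHS](rotK m z). Qed.

Let transfer b b' z : chordless_cycle C' z -> cut_ok C' (rot b' z) ->
  cycle_rel C' e' (rot b z) -> cycle_rel C' e' (rot b' z).
Proof.
move=> cc ok; have [c cE] := rot_inv_ex b z.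
have [b1 Eb1] := rot_rot_ex b' c (rot b z); rewrite cE in Eb1.
rewrite Eb1 in ok * => rel.
have cc1 := chordless_cycle_rot b cc.
have [bs|sb] := leqP b1 (size (rot b z)); last by rewrite rot_oversize // ltnW.
by apply: (cycle_rel_transfer qc1 mutated_system).
Qed.

(** Since relations transfer to all admissible openings, one opening of the cycle is enough, even
    one that is not admissible for the mutated matrix. Reversal reduces to the case where the in-
    and the out-neighbour of [k] stand in the order of the preceding lemmas. *)
Lemma mutated_cycle_rel z : chordless_cycle C' z -> cut_ok C' z -> cycle_rel C' e' z.
Proof.
move=> cc ok; case: (boolP (has (o^~ k) z && has (o k) z)) => [/andP[hin hout]|io]; last first.
  exact: mutated_cycle_same.
suff [b] : exists b, cycle_rel C' e' (rot b z).
  by rewrite -{2}[z]rot0; apply: transfer; rewrite ?rot0.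
case: (boolP (k \in z)) => kz; last first.
  have [m [i [t [Em io _ ccC]]]] := mutation_cycle_avoid G cc kz hin hout.
  have cc1 := chordless_cycle_rot m cc; rewrite Em in cc1.
  exists m; rewrite Em.
  case/lastP: t {Em} io ccC cc1 => [|ys l]; first by move=> _ _ [].
  rewrite last_rcons => /orP[] /andP[oik okl] ccC cc1; last exact: mutated_cycle_ends.
  have E : rev (l :: rcons (rev ys) i) = i :: rcons ys l.
    by rewrite rev_cons rev_rcons revK.
  have cc2 : chordless_cycle C' (l :: rcons (rev ys) i).
    by rewrite -[_ :: _]revK E; exact: chordless_cycle_rev.
  rewrite -E; apply: (cycle_rel_rev qc1 mutated_system cc2).
  exact: mutated_cycle_ends (chordless_cycle_swap ccC) cc2.
have [m z1 Em] := rot_to kz.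
have cc1 := chordless_cycle_rot m cc; rewrite Em in cc1.
have memE : z =i k :: z1 by move=> v; rewrite -Em mem_rot.
case: z1 cc1 Em memE => [[]//|j z1]; case/lastP: z1 => [[]//|t i] cc1 Em memE.
have [v vz ov] := hasP hin; have [w wz ow] := hasP hout.
have vk := good_arr_neq G ov; have wk : w != k by rewrite eq_sym (good_arr_neq G ow).
have nb u : u \in z -> u != k -> C k u != 0 -> u = j \/ u = i.
  rewrite memE => uz uk cku; apply: (cycle_neighbours qc1 cc1) => //.
  by rewrite -/C' (mutation_adjk G).
have := nb w wz wk (good_arr_adj G ow); have := nb v vz vk (good_arr_adjr G ov).
have back y : chordless_cycle C' y -> (exists b, cycle_rel C' e' (rot b y)) ->
    (exists c, y = rot c z) -> exists b, cycle_rel C' e' (rot b z).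
  by move=> _ [b rel] [c E]; have [b1 E1] := rot_rot_ex b c z; exists b1; rewrite -E1 -E.
case=> Ev; case=> Ew; subst v w.
- by rewrite (good_arr_asym G ov) in ow.
- have cc2 := chordless_cycle_swap cc1.
  have [b rel] := mutated_neighbour_cycle ov ow cc2.
  have E1 : rev (k :: i :: rcons (rev t) j) = rot 1 (k :: j :: rcons t i).
    by rewrite rot1_cons !rev_cons rev_rcons revK.
  have Er : rev (rot b (k :: i :: rcons (rev t) j)) = rotr b (rot 1 (k :: j :: rcons t i)).
    by rewrite rev_rot E1.
  have := cycle_rel_rev qc1 mutated_system (chordless_cycle_rot b cc2) rel.
  rewrite Er /rotr -Em => rel'.
  have [b1 E2] := rot_rot_ex 1 m z.
  have [b2 E3] := rot_rot_ex (size (rot 1 (rot m z)) - b) b1 z.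
  by exists b2; rewrite -E3 -E2.
- by have [b rel] := mutated_neighbour_cycle ov ow cc1; apply: back cc1 _ _; [exists b|exists m].
- by rewrite (good_arr_asym G ov) in ow.
Qed.

End MutatedSystem.

(** * The homomorphisms and their composition *)

Section MutationHom.
Variables (R : rcfType) (K : numFieldType) (n : nat) (k : 'I_n).

Notation g C := (pres_lie (@quiver_rel K n C)).
Notation hgen C := (fun i => pres_gen (GenH i) : g C).
Notation egen C := (fun eps i => pres_gen (GenE eps i) : g C).

Lemma mutation_hom (o : rel 'I_n) (C C' : 'M[int]_n) (d : 'I_n -> R) :
  good_orientation o C d -> C' = cartan_mutation k (o^~ k) C ->
  exists phi : g C' -> g C, [/\ lie_hom phi,
    forall i, phi (hgen C' i) = mutated_h k (o^~ k) C (hgen C) i &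
    forall eps i, phi (egen C' eps i) = mutated_e k (o^~ k) C (egen C) eps i].
Proof.
move=> G ->; have qc := good_qc G; have qc1 := qc' G k.
have S := quiver_system K C; have rels := @quiver_cycle_rel K n C.
have gens := @quiver_gen_ind K n C.
have S' := mutated_system k G S rels gens.
have rels' := mutated_cycle_rel (k := k) G S rels gens.
have [phi [phi_hom phi_gen _]] := pres_lie_univ (quiver_rel_system qc1 S' rels').
by exists phi; split.
Qed.

(** On a generator with i -> k the composition is [f^m e^m] on a lowest weight vector, divided by
    [(m!)^2], because the sign used at [k] is reversed with the sign of [C k i]. The powers of -eps
    cancel since [C' k i = - C k i]. *)
Lemma mutation_cancel (o : rel 'I_n) (C C' : 'M[int]_n) (d : 'I_n -> R)
    (phi : g C' -> g C) (psi : g C -> g C') :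
  good_orientation o C d -> C' = cartan_mutation k (o^~ k) C ->
  lie_hom phi -> lie_hom psi ->
  (forall eps i, phi (egen C' eps i) = mutated_e k (o^~ k) C (egen C) eps i) ->
  (forall eps i, psi (egen C eps i) = mutated_e k (o^~ k) C' (egen C') eps i) ->
  cancel phi psi.
Proof.
move=> G EC' [phiD phiZ phiB] [psiD psiZ psiB] phiE psiE.
have qc := good_qc G; have qc1 : quasi_cartan C' d by rewrite EC'; exact: qc' G k.
have S' := quiver_system K C'.
apply: quiver_gen_ind => [|x y Ex Ey|a x Ex|x y Ex Ey|eps i].
- have phi0 : phi 0 = 0 by have := phiZ 0 0; rewrite !scale0r.
  by have := psiZ 0 0; rewrite phi0 !scale0r.
- by rewrite phiD psiD Ex Ey.
- by rewrite phiZ psiZ Ex.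
- by rewrite phiB psiB Ex Ey.
have ekE b : psi (egen C b k) = egen C' b k.
  by rewrite psiE /mutated_e (good_irr G).
have psi_iter m b x : psi (iter m (lbr (egen C b k)) x) = iter m (lbr (egen C' b k)) (psi x).
  by elim: m => //= m IH; rewrite psiB ekE IH.
rewrite phiE /mutated_e; case: ifP => [oik|nik]; last by rewrite psiE /mutated_e nik.
have ik := good_arr_neq G oik.
rewrite psiZ psi_iter psiE /mutated_e oik iter_lbrZ scalerA.
have C'k : C' k i = - C k i by rewrite EC' (mutation_k G) // oik.
have aik : C k i != 0 := good_arr_adjr G oik.
have sg : sign_of (C' k i) = ~~ sign_of (C k i).
  by rewrite C'k /sign_of oppr_lt0; move: aik; case: ltgtP.
have -> : `|C k i|%N = `|C' k i|%N by rewrite C'k abszN.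
set kappa := ~~ (sign_of (C' k i) (+) eps).
have -> : ~~ (sign_of (C k i) (+) eps) = ~~ kappa.
  by rewrite /kappa sg; case: (sign_of _) (eps) => [] [].
have low := @cs_lowest _ _ _ _ _ _ S' kappa k eps i.
rewrite (lowest_fm_em (cs_sl2 qc1 S' kappa k)); last first.
  apply: low; first by rewrite eq_sym.
  by rewrite /kappa; apply/orP; right; case: (sign_of _) (eps) => [] [].
rewrite scalerA -[RHS]scale1r; congr (_ *: _); rewrite C'k.
have nz : `|C k i|%N`!%:R != 0 :> K by rewrite pnatr_eq0 -lt0n fact_gt0.
have u0 : (- (-1) ^+ eps : K) != 0 by rewrite oppr_eq0 signr_eq0.
rewrite abszN -[_ ^ - C k i]invr_expz.
have u1 : (- (-1) ^+ eps : K) ^ C k i != 0 by rewrite expfz_neq0.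
by field; rewrite nz u1.
Qed.

End MutationHom.

Theorem theoremA (R : realType) (n : nat) (S S' : svquiver n) (k : 'I_n)
    (S_mutation_dynkin : mutation_dynkin (gss_of S))
    (S'_mutation : svq_mutation k S S') :
  exists (phi : quiver_lie R[i] S' -> quiver_lie R[i] S)
         (psi : quiver_lie R[i] S -> quiver_lie R[i] S'),
  [/\ lie_hom phi /\ lie_hom psi,
      cancel phi psi /\ cancel psi phi,
      (forall (eps : bool) (i : 'I_n),
         phi (ge R[i] S' eps i) =
           let c := cartan S k i in let delta := arr_sign S i k in
           if arr S i k then
             ((- (-1) ^+ eps) ^ c / (`|c|%N`!)%:R) *:
               iter `|c|%N (lbr (ge R[i] S (~~ (delta (+) eps)) k))
                    (ge R[i] S eps i)
           else ge R[i] S eps i) /\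
      (forall i : 'I_n,
         phi (gh R[i] S' i) =
           if arr S i k then gh R[i] S i - (cartan S i k)%:~R *: gh R[i] S k
           else gh R[i] S i) &
      (forall (eps : bool) (i : 'I_n),
         psi (ge R[i] S eps i) =
           let c := cartan S k i in let delta := arr_sign S i k in
           if arr S i k then
             ((- (-1) ^+ eps) ^ c / (`|c|%N`!)%:R) *:
               iter `|c|%N (lbr (ge R[i] S' (delta (+) eps) k))
                    (ge R[i] S' eps i)
           else ge R[i] S' eps i) /\
      (forall i : 'I_n,
         psi (gh R[i] S i) =
           if arr S i k then gh R[i] S' i + (cartan S i k)%:~R *: gh R[i] S' k
           else gh R[i] S' i)].
Proof.
have [o [C [d [G0 SE]]]] := mutation_dynkin_good R S_mutation_dynkin.
have [oE CE] := gss_mx_inj G0 SE.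
have G : good_orientation (arr S) (cartan S) d.
  have -> : arr S = o by apply/funext => i; apply/funext => j; exact: oE.
  by rewrite CE.
have G' := good_mutation G k.
have [o'E C'E] : arr S' =2 arrow_mutation k (arr S) (cartan S) /\
    cartan S' = cartan_mutation k ((arr S)^~ k) (cartan S).
  apply: (gss_mx_inj G'); rewrite -(mutation_gss_mx k G) -gss_ofE.
  exact: S'_mutation.
rewrite -C'E in G'.
(* The former in-neighbours of [k] are its out-neighbours after mutation. With all arrows reversed
   they are in-neighbours again, so the same construction applies to Q' with the same set of
   vertices and, [cartan_mutation] being an involution, leads back to Q. *)
have Gop := good_opposite G'.
pose op : rel 'I_n := fun i j => arrow_mutation k (arr S) (cartan S) j i.
have opk : op^~ k = (arr S)^~ k by apply/funext => i; exact: arrow_mutation_k.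
have irr : ~~ arr S k k by rewrite arr_irr.
have CE' : cartan S = cartan_mutation k (op^~ k) (cartan S').
  by rewrite opk C'E cartan_mutationK // (qc_diag (good_qc G)).
have [phi [phi_hom phiH phiE]] := mutation_hom R[i] G C'E.
have [psi [psi_hom psiH psiE]] := mutation_hom R[i] Gop CE'.
rewrite -/op opk in psiH psiE.
have sgnE i : arr S i k -> arr_sign S i k = sign_of (cartan S k i).
  move=> aik; rewrite -(qc_sign (good_qc G)) mxE aik.
  by rewrite (negbTE (good_arr_neq G aik)).
have mutE i : arr S i k -> (cartan S' k i = - cartan S k i) * (cartan S' i k = - cartan S i k).
  move=> aik; rewrite C'E (mutation_k G) ?(mutation_rk G) ?(good_arr_neq G aik) //.
  by rewrite aik.
exists phi, psi; split=> //; split.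
- exact: (mutation_cancel (d := d) G C'E).
- by apply: (mutation_cancel (d := d) Gop CE') => //; rewrite -/op opk.
- by move=> eps i; rewrite [LHS]phiE /mutated_e /=; case: ifP => // /sgnE->.
- by move=> i; rewrite [LHS]phiH /mutated_h.
- move=> eps i; rewrite [LHS]psiE /mutated_e /=; case: ifP => // aik.
  rewrite (mutE _ aik) abszN (sgnE _ aik) -invr_expz.
  have -> : ~~ (sign_of (- cartan S k i) (+) eps) = sign_of (cartan S k i) (+) eps.
    have : cartan S k i != 0 := good_arr_adjr G aik.
    by rewrite /sign_of oppr_lt0; case: ltgtP; case: (eps).
  (* The exponent comes out as the opposite of [cartan S k i], which makes no difference as the base
     is 1 or -1. *)
  congr ((_ / _) *: _); apply: mulr1_eq.
  have x0 : (- (-1) ^+ eps : R[i]) \is a GRing.unit by rewrite unitrN unitrX // unitrN unitr1.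
  by rewrite -exprzMl // mulrNN -expr2 sqrr_sign exp1rz.
- move=> i; rewrite [LHS]psiH /mutated_h; case: ifP => // aik.
  by rewrite (mutE _ aik) mulrNz scaleNr opprK.
Qed.
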